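(* Let $p\ge2$. Assume that $u_0\in L^p(\Omega;L^2(\mathcal O))$ and, in the case of the stochastic wave equation (SWE), $v_0\in L^p(\Omega;\dot{\mathbb H}^{-1})$. Let $u$ and $\tilde u$ be the mild solutions of $Lu=b(u)+\xi$ and of $L\tilde u=b(\tilde u)+\tilde\xi$, respectively, with the same initial and boundary conditions, where $\tilde\xi$ is the Wong-Zakai approximation of $\xi$ with time step $k=T/m$ and space step $h=1/n$. Then there exists a constant $C$, depending only on $p,T,H,u_0,v_0$ (and on the fixed function $b$), and not on $m,n$, such that for the stochastic heat equation (SHE) $$\sup_{t\in I}\Big(\mathbb E\big[\|u(t)-\tilde u(t)\|_{L^2(\mathcal O)}^p\big]\Big)^{1/p}\le C\big(h^H+k^{1/4}h^{H-1/2}\big),$$ and for the SWE $$\sup_{t\in I}\Big(\mathbb E\big[\|u(t)-\tilde u(t)\|_{L^2(\mathcal O)}^p\big]\Big)^{1/p}\le C\big(h^H+k^{1/2}h^{H-1/2}\big).$$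
   Context: Setting. $T>0$, $I=[0,T]$, $\mathcal O=(0,1)$, $0<H\le 1/2$, and $b:\mathbb R\to\mathbb R$ is a fixed Lipschitz continuous function. $L=\partial_t-\partial_{xx}$ (SHE, initial condition $u(0,\cdot)=u_0$) or $L=\partial_{tt}-\partial_{xx}$ (SWE, initial conditions $u(0,\cdot)=u_0$, $\partial_tu(0,\cdot)=v_0$), with homogeneous Dirichlet boundary condition $u(t,0)=u(t,1)=0$. Noise. On a stochastic basis $(\Omega,\mathscr F,(\mathscr F_t)_{t\in I},\mathbb P)$, $W=\{W(t,x)\}_{(t,x)\in I\times\overline{\mathcal O}}$ is a centered Gaussian field with $\mathbb E[W(s,x)W(t,y)]=(s\wedge t)\,\frac{x^{2H}+y^{2H}-|x-y|^{2H}}{2}$, and $\xi=\frac{\partial^2W}{\partial t\,\partial x}$. For a deterministic step function $f=\sum_{i,j}f_{ij}\chi_{(a_i,a_{i+1}]\times(b_j,b_{j+1}]}$ on $I\times\overline{\mathcal O}$, $\int_I\int_{\mathcal O}f(s,y)\,\xi(ds,dy):=\sum_{i,j}f_{ij}\big(W(a_{i+1},b_{j+1})-W(a_i,b_{j+1})-W(a_{i+1},b_j)+W(a_i,b_j)\big)$. The integral is extended by isometry to the completion $\mathcal H$ of the step functions under the scalar product $\langle f,g\rangle=\mathbb E\big[\int\!\!\int f\,d\xi\,\int\!\!\int g\,d\xi\big]$. Wong-Zakai approximation. For $m,n\in\mathbb N_+$ let $k=T/m$, $h=1/n$, $I_i=(ik,(i+1)k]$ ($0\le i\le m-1$), $\mathcal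 O_j=(jh,(j+1)h]$ ($0\le j\le n-1$), $\chi_{i,j}$ the indicator function of $I_i\times\mathcal O_j$, and $$\tilde\xi(t,x)=\sum_{i=0}^{m-1}\sum_{j=0}^{n-1}\Big[\frac1{kh}\int_{I_i}\int_{\mathcal O_j}\xi(ds,dy)\Big]\chi_{i,j}(t,x).$$ Eigensystem, spaces, mild solutions. For $\alpha\in\mathbb N_+$, $\lambda_\alpha=(\alpha\pi)^2$, $\varphi_\alpha(x)=\sqrt2\sin(\sqrt{\lambda_\alpha}x)$; $\dot{\mathbb H}^\beta$ ($\beta\in\mathbb R$) has norm $\|v\|_\beta=\big(\sum_{\alpha\ge1}\lambda_\alpha^\beta(v,\varphi_\alpha)^2\big)^{1/2}$. $\phi_\alpha(t)=e^{-\lambda_\alpha t}$ for SHE and $\phi_\alpha(t)=\sin(\sqrt{\lambda_\alpha}t)/\sqrt{\lambda_\alpha}$ for SWE; $G_t(x,y)=\sum_{\alpha\ge1}\phi_\alpha(t)\varphi_\alpha(x)\varphi_\alpha(y)$. The mild solution $u$ is the solution of $$u(t,x)=\omega(t,x)+\int_0^t\int_{\mathcal O}G_{t-s}(x,y)b(u(s,y))\,dy\,ds+\int_0^t\int_{\mathcal O}G_{t-s}(x,y)\,\xi(ds,dy),$$ and $\tilde u$ is the solution of $$\tilde u(t,x)=\omega(t,x)+\int_0^t\int_{\mathcal O}G_{t-s}(x,y)b(\tilde u(s,y))\,dy\,ds+\int_0^t\int_{\mathcal O}G_{t-s}(x,y)\tilde\xi(s,y)\,dy\,ds,$$ where $\omega(t,x)=\int_{\mathcal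 O}G_t(x,y)u_0(y)\,dy$ for SHE and $\omega(t,x)=\int_{\mathcal O}G_t(x,y)v_0(y)\,dy+\int_{\mathcal O}\partial_tG_t(x,y)u_0(y)\,dy$ for SWE (understood through the eigenfunction expansion). *)

(* Defs.v *)
From HB Require Import structures.
From mathcomp Require Import all_boot all_order all_algebra.
From mathcomp Require Import all_classical all_reals all_analysis.

Set Implicit Arguments.
Unset Strict Implicit.
Unset Printing Implicit Defensive.
Import Order.TTheory GRing.Theory Num.Theory.
Import numFieldNormedType.Exports.
Local Open Scope classical_set_scope.
Local Open Scope ring_scope.

Section norms.
Context {R : realType}.

Definition Itime (T : R) : set (measurableTypeR R) := `[0%R, T]%classic.

Definition Ospace : set (measurableTypeR R) := `]0%R, 1%R[%classic.

(** Restriction of the Lebesgue measure to the space domain. *)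
Definition muO : {measure set (measurableTypeR R) -> \bar R} :=
  mrestr (@lebesgue_measure R) (measurable_itv `]0%R, 1%R[ : measurable Ospace).

Definition L2norm (f : R -> R) : \bar R := Lnorm muO 2%:E (EFin \o f).

(** [lambda a] and [eigf a] are meant for [a >= 1]. *)
Definition lambda (a : nat) : R := (a%:R * pi) ^+ 2.

Definition eigf (a : nat) (x : R) : R :=
  Num.sqrt 2 * sin (Num.sqrt (lambda a) * x).

Definition coef (f : R -> R) (a : nat) : R :=
  \int[lebesgue_measure]_(x in Ospace) (f x * eigf a x).

(** An element [v] of the space of order [beta] (possibly negative, so that [v]
    need not be a function) is given by its coefficients [(v, eigf a)], [a >= 1].
    The entry of index 0 is not used. *)
Definition dotH_norm (beta : R) (v : nat -> R) : \bar R :=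
  ((\sum_(1 <= a <oo) (lambda a `^ beta * v a ^+ 2)%:E) `^ 2^-1)%E.

End norms.

Section probability.
Context {d : measure_display} {Omega : measurableType d} {R : realType}.
Variable P : probability Omega R.

Definition filtration (T : R) (F : R -> set (set Omega)) : Prop :=
  (forall t : R, t \in `[0, T] ->
     sigma_algebra [set: Omega] (F t) /\ F t `<=` measurable) /\
  (forall s t : R, 0 <= s -> s <= t -> t <= T -> F s `<=` F t).

Definition Lp_L2 (p : R) (v : Omega -> R -> R) : Prop :=
  measurable_fun ([set: Omega] `*` Ospace)
    (fun z : Omega * measurableTypeR R => v z.1 z.2) /\
  (Lnorm P p%:E (fun w => L2norm (v w)) < +oo)%E.

Definition Lp_dotH (p beta : R) (v : Omega -> nat -> R) : Prop :=
  (forall a, measurable_fun setT (fun w => v w a)) /\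
  (Lnorm P p%:E (fun w => dotH_norm beta (v w)) < +oo)%E.

(** [normal_prob 0 0] is not the Dirac mass at 0, hence the case distinction. *)
Definition centered_gaussian (X : Omega -> R) : Prop :=
  measurable_fun setT X /\
  ((forall A, measurable A -> P (X @^-1` A) = \d_(0 : R) A) \/
   (exists2 s : R, 0 < s &
      forall A, measurable A -> P (X @^-1` A) = normal_prob 0 s A)).

(** The field is indexed by time, then space; its values outside of
    [[0,T] x [0,1]] are irrelevant. *)
Definition fractional_sheet (T H : R) (W : R -> R -> Omega -> R) : Prop :=
  (forall (n : nat) (c s x : 'I_n -> R),
     (forall i, s i \in `[0, T]) -> (forall i, x i \in `[0, 1]) ->
     centered_gaussian (fun w => \sum_(i < n) c i * W (s i) (x i) w)) /\
  (forall s t x y : R, s \in `[0, T] -> t \in `[0, T] ->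
     x \in `[0, 1] -> y \in `[0, 1] ->
     expectation P (fun w => W s x w * W t y w) =
     (Num.min s t *
      ((x `^ (2 * H) + y `^ (2 * H) - `|x - y| `^ (2 * H)) / 2))%:E).

End probability.

Section noise_integral.
Context {d : measure_display} {Omega : measurableType d} {R : realType}.
Implicit Types (W : R -> R -> Omega -> R) (w : Omega).

(** Noise integral of the indicator function of [`]s, s'] x ]x, x']]. *)
Definition rect_noise W (s s' x x' : R) w : R :=
  W s' x' w - W s x' w - W s' x w + W s x w.

(** Only [tgrid i], [i <= tsteps], and [xgrid j], [j <= xsteps], are used. *)
Record step_fun := StepFun {
  tsteps : nat;
  xsteps : nat;
  tgrid : nat -> R;
  xgrid : nat -> R;
  value : nat -> nat -> R }.

Definition step_on (T : R) (f : step_fun) : Prop :=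
  [/\ forall i, (i <= tsteps f)%N -> tgrid f i \in `[0, T],
      forall j, (j <= xsteps f)%N -> xgrid f j \in `[0, 1],
      forall i, (i < tsteps f)%N -> tgrid f i < tgrid f i.+1 &
      forall j, (j < xsteps f)%N -> xgrid f j < xgrid f j.+1].

Definition step_eval (f : step_fun) (s y : R) : R :=
  \sum_(i < tsteps f) \sum_(j < xsteps f)
    value f i j * \1_`]tgrid f i, tgrid f i.+1] s
                * \1_`]xgrid f j, xgrid f j.+1] y.

Definition step_integral W (f : step_fun) w : R :=
  \sum_(i < tsteps f) \sum_(j < xsteps f)
    value f i j * rect_noise W (tgrid f i) (tgrid f i.+1)
                               (xgrid f j) (xgrid f j.+1) w.

(** [Z] is a version of the noise integral of [f], i.e. of the extension by
    isometry of [step_integral] to the completion of the step functions for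
    [<f, g> = E (step_integral f * step_integral g)].  A sequence of step
    functions is Cauchy for this product iff its integrals are Cauchy in
    [L^2(Omega)].  As [H <= 1/2], the norm of the completion dominates the norm
    of [L^2([0,T] x (0,1))] up to a constant, and the completion is identified
    with a subspace of the latter: a function [f] stands for the limit of a
    Cauchy sequence of step functions that converges to [f] in [L^2]. *)
Definition noise_integral (P : probability Omega R) (T : R) W
    (f : R -> R -> R) (Z : Omega -> R) : Prop :=
  [/\ measurable_fun (Itime T `*` Ospace)
        (fun z : measurableTypeR R * measurableTypeR R => f z.1 z.2),
      measurable_fun setT Z &
      exists g : nat -> step_fun,
        [/\ forall q, step_on T (g q),
            (\int[lebesgue_measure]_(s in Itime T)
               \int[lebesgue_measure]_(y in Ospace)
                 ((step_eval (g q) s y - f s y) ^+ 2)%:E)%E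
              @[q --> \oo] --> 0%E &
            expectation P (fun w => (step_integral W (g q) w - Z w) ^+ 2)
              @[q --> \oo] --> 0%E]].

(** Wong-Zakai approximation of the noise with [m] time steps and [n] space
    steps. *)
Definition wz_noise (T : R) (m n : nat) W (t x : R) w : R :=
  let k := T / m%:R in
  let h := n%:R^-1 in
  \sum_(i < m) \sum_(j < n)
    (k * h)^-1 * rect_noise W (i%:R * k) (i.+1%:R * k)
                              (j%:R * h) (j.+1%:R * h) w
    * \1_`]i%:R * k, i.+1%:R * k] t * \1_`]j%:R * h, j.+1%:R * h] x.

End noise_integral.

Inductive spde := SHE | SWE.

Section mild.
Context {R : realType}.

Definition phi (E : spde) (a : nat) (t : R) : R :=
  match E with
  | SHE => expR (- lambda a * t)
  | SWE => sin (Num.sqrt (lambda a) * t) / Num.sqrt (lambda a)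
  end.

(** For [SHE] the series diverges in general at [t = 0], where the value of
    [green] is never relevant. *)
Definition green (E : spde) (t x y : R) : R :=
  limn (fun N => \sum_(1 <= a < N) phi E a t * eigf a x * eigf a y).

Context {d : measure_display} {Omega : measurableType d}.
Variable P : probability Omega R.

(** Coefficients of the solution [omega(t)] of the linear problem without
    noise. *)
Definition SHE_coef (u0 : Omega -> R -> R) (t : R) (w : Omega) (a : nat) : R :=
  phi SHE a t * coef (u0 w) a.

Definition SWE_coef (u0 : Omega -> R -> R) (v0 : Omega -> nat -> R)
    (t : R) (w : Omega) (a : nat) : R :=
  phi SWE a t * v0 w a + derive1 (phi SWE a : R -> R^o) t * coef (u0 w) a.

(** [om] is a version of the random function with eigenfunction expansion
    [sum_(a >= 1) c w a * eigf a], which converges in [L^2(0,1)]. *)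
Definition expansion (c : Omega -> nat -> R) (om : R -> Omega -> R) : Prop :=
  measurable_fun (Ospace `*` [set: Omega])
    (fun z : measurableTypeR R * Omega => om z.1 z.2) /\
  {ae P, forall w,
     L2norm (fun x => \sum_(1 <= a < N) c w a * eigf a x - om x w)
       @[N --> \oo] --> 0%E}.

(** [conv_rough P T W E t x Z]: [Z] is a version of the integral of
    [G_{t-s}(x,y)] over [(0,t) x (0,1)] against the noise. *)
Definition conv_rough (T : R) (W : R -> R -> Omega -> R) (E : spde)
    (t x : R) (Z : Omega -> R) : Prop :=
  noise_integral P T W (fun s y => \1_`]0, t[ s * green E (t - s) x y) Z.

Definition conv_wz (T : R) (m n : nat) (W : R -> R -> Omega -> R) (E : spde)
    (t x : R) (Z : Omega -> R) : Prop :=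
  Z = fun w =>
    \int[lebesgue_measure]_(s in Itime t)
      \int[lebesgue_measure]_(y in Ospace)
        (green E (t - s) x y * wz_noise T m n W s y w).

(** Mild solutions are measurable random fields with paths in
    [L^2([0,T] x (0,1))]; [c t w] are the coefficients of [omega(t)], and
    [conv t x] characterizes the versions of the stochastic convolution. *)
Definition mild_solution (T : R) (E : spde) (b : R -> R)
    (c : R -> Omega -> nat -> R) (conv : spde -> R -> R -> (Omega -> R) -> Prop)
    (u : R -> R -> Omega -> R) : Prop :=
  [/\ measurable_fun (Itime T `*` Ospace `*` [set: Omega])
        (fun z : measurableTypeR R * measurableTypeR R * Omega => u z.1.1 z.1.2 z.2),
      {ae P, forall w,
         (\int[lebesgue_measure]_(t in Itime T)
            \int[lebesgue_measure]_(x in Ospace)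
              (u t x w ^+ 2)%:E < +oo)%E} &
      forall t : R, t \in `[0, T] ->
        exists om Z : R -> Omega -> R,
          [/\ expansion (c t) om,
              {ae muO, forall x, conv E t x (Z x)} &
              {ae muO, forall x, {ae P, forall w,
                 u t x w = om x w
                   + \int[lebesgue_measure]_(s in Itime t)
                       \int[lebesgue_measure]_(y in Ospace)
                         (green E (t - s) x y * b (u s y w))
                   + Z x w}}]].

Definition sup_error (T p : R) (u v : R -> R -> Omega -> R) : \bar R :=
  ereal_sup [set Lnorm P p%:E (fun w => L2norm (fun x => u t x w - v t x w))
            | t in `[0, T]].

End mild.

(* Main.v *)
Require Import Defs.
From HB Require Import structures.
From mathcomp Require Import all_boot all_order all_algebra.
From mathcomp Require Import all_classical all_reals all_analysis.
From mathcomp Require Import measurable_realfun measure_negligible.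
From mathcomp Require Import ring lra.
Set Implicit Arguments.
Unset Strict Implicit.
Unset Printing Implicit Defensive.
Import Order.TTheory GRing.Theory Num.Theory.
Import numFieldNormedType.Exports.
Local Open Scope classical_set_scope.
Local Open Scope ring_scope.

(** The Lebesgue integral of [2 * Num.min rho l] is [l `^ (2 * H)] for a suitable
    [rho] between 0 and 1 (this needs [H <= 1/2]), and [2 * Num.min r l] is the
    square norm of the increment with step [r] of the indicator function of an
    interval of length [l].  Hence the noise is isometric to the quadratic form
    [incr_form] that integrates [(f(s, y + rho(theta)) - f(s, y))^2] over
    [s, theta, y].  This form is defined for every measurable function and is
    lower semicontinuous by Fatou's lemma, and noise integrals are limits of
    Gaussian variables, so that the moments of a noise integral are bounded by
    powers of the form of its integrand ([noise_integral_moment]).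

    Write [G] for the function [(s, y) |-> G_{t-s}(x, y)].  The stochastic
    convolution of the Wong-Zakai noise is the noise integral of the projection
    [PG] of [G] on the functions that are constant on the cells of the grid,
    hence the moments of the difference of the two convolutions are controlled by
    the form of [G - PG].  The eigenfunctions are orthonormal in [x], so the
    integral of this form over [x] is at most the sum over [a] of the forms of
    the modes: a mode is the product of a function of [s] and of [eigf a], minus
    the product of their cell averages.  It splits into (time factor) times
    (eigenfunction minus its average) plus (time factor minus its average) times
    (average of the eigenfunction), and the form of a product is a product.
    Summing over [a] gives [h^(2H) + k^(1/2) h^(2H-1)] for SHE and
    [h^(2H) + k h^(2H-1)] for SWE ([integral_incr_form_kproj]), the squares of
    the announced rates up to constants.

    Initial data are the same for both equations and cancel.  The difference of
    the drift terms at [(t, x)] is bounded through Cauchy-Schwarz and the Lipschitz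
    constant by the [L^2] norm of [G] and that of the error up to time [t], and
    the square of the former is integrable in [x].  A pathwise Gronwall inequality
    then bounds the error by the difference of the convolutions, and an integral
    form of the Minkowski inequality exchanges the moment of order [p / 2] with
    the integrals over space and time ([sq_error_moment]). *)

(** * Integration tools *)
Lemma integral_restr d (T : measurableType d) (R : realType)
    (m : {measure set T -> \bar R}) (D : set T) (mD : measurable D)
    (f : T -> \bar R) : measurable_fun setT f ->
  (\int[mrestr m mD]_x f x = \int[m]_(x in D) f x)%E.
Proof.
move=> mf.
have -> : (\int[m]_(x in D) f x = \int[mrestr m mD]_(x in D) f x)%E.
  by apply: eq_measure_integral => A mA AD /=; rewrite /mrestr setIidl.
rewrite [RHS]integral_mkcond; apply: ae_eq_integral => //.
  by apply/(measurable_restrictT _ _).1 => //; exact: measurable_funTS.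
exists (~` D); split => /=; first exact: measurableC.
  by rewrite /= /mrestr setICl.
move=> x /=; apply: contra_not => Dx _; rewrite patchE mem_set //.
Qed.

Lemma sqrD_le_dbl (R : realDomainType) (a b : R) :
  (a + b) ^+ 2 <= 2 * a ^+ 2 + 2 * b ^+ 2.
Proof. rewrite -subr_ge0; have := sqr_ge0 (a - b); rewrite !expr2; lra. Qed.

Lemma integrable_of_fin_num d (T : measurableType d) (R : realType)
    (m : {measure set T -> \bar R}) (f : T -> \bar R) :
  measurable_fun setT f -> (\int[m]_x f x)%E \is a fin_num ->
  m.-integrable setT f.
Proof.
move=> mf; rewrite integralE => E.
apply/integrableP; split => //.
rewrite (eq_integral (fun x => f^\+ x + f^\- x)%E); last first.
  by move=> x _; rewrite -[LHS]/((abse \o f) x) fune_abse.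
rewrite ge0_integralD//; [|exact: measurable_funepos|exact: measurable_funeneg].
have p0 : (0 <= \int[m]_x f^\+ x)%E by exact: integral_ge0.
have n0 : (0 <= \int[m]_x f^\- x)%E by exact: integral_ge0.
move: E p0 n0.
case: (\int[m]_x f^\+ x)%E => [a||]; case: (\int[m]_x f^\- x)%E => [b||] //=.
by rewrite ltry.
Qed.

(** The square norm of a finite combination depends only on its Gram matrix:
    two families with the same Gram matrix give isometric combinations. *)
Lemma integral_sqr_sum d (T : measurableType d) (R : realType)
    (m : {measure set T -> \bar R}) (I : finType) (A : I -> T -> R)
    (c : I -> R) (G : I -> I -> R) :
  (forall i, measurable_fun setT (A i)) ->
  (forall i j, \int[m]_x (A i x * A j x)%:E = (G i j)%:E)%E ->
  (\int[m]_x ((\sum_i c i * A i x) ^+ 2)%:E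
    = (\sum_i \sum_j c i * c j * G i j)%:E)%E.
Proof.
move=> mA mG.
have iA i j : m.-integrable setT (fun x => (A i x * A j x)%:E).
  apply: integrable_of_fin_num; last by rewrite mG.
  by apply/measurable_EFinP; apply: measurable_funM.
rewrite (eq_integral (fun x => \sum_i \sum_j ((c i * c j)%:E * (A i x * A j x)%:E)%E)%R).
  rewrite integral_sum//=; last first.
    by move=> i; apply: integrable_sum => // j _; exact: integrableZl.
  rewrite -sumEFin; apply: eq_bigr => i _.
  rewrite integral_sum//=; last by move=> j; exact: integrableZl.
  rewrite -sumEFin; apply: eq_bigr => j _.
  by rewrite integralZl// mG.
move=> x _; rewrite expr2 mulr_suml -sumEFin; apply: eq_bigr => i _.
rewrite mulr_sumr -sumEFin; apply: eq_bigr => j _.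
by rewrite -EFinM; congr EFin; ring.
Qed.

Lemma cvge0P (R : realType) (u : nat -> \bar R) : (forall n, 0 <= u n)%E ->
  u n @[n --> \oo] --> 0%E <->
  (forall e : R, 0 < e -> \forall n \near \oo, (u n <= e%:E)%E).
Proof.
move=> u0; split.
  move=> /fine_cvgP[fu /cvgrPdist_le cu] e e0; move: fu (cu e e0).
  apply: filterS2 => n fn /=; rewrite sub0r normrN => H.
  by rewrite -(fineK fn) lee_fin (le_trans _ H)// ler_norm.
move=> H; apply/fine_cvgP.
have fu : \forall n \near \oo, u n \is a fin_num.
  near=> n; rewrite ge0_fin_numE// (@le_lt_trans _ _ 1%E) ?ltry//.
  by near: n; exact: H.
split => //; apply/cvgrPdist_le => e e0; move: fu (H e e0).
apply: filterS2 => n fn /=; rewrite sub0r normrN -{1}(fineK fn) lee_fin => En.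
by rewrite ger0_norm// fine_ge0.
Unshelve. all: by end_near. Qed.

(** Along a subsequence the integrals are summable, hence the series of the
    functions is integrable and almost everywhere finite. *)
Lemma ae_cvg0_subseq d (T : measurableType d) (R : realType)
    (m : {measure set T -> \bar R}) (F : nat -> T -> \bar R) :
  (forall q, measurable_fun setT (F q)) -> (forall q x, 0 <= F q x)%E ->
  (\int[m]_x F q x @[q --> \oo] --> 0)%E ->
  exists phi : nat -> nat, (forall q, (q <= phi q)%N) /\
    {ae m, forall x, F (phi q) x @[q --> \oo] --> 0%E}.
Proof.
move=> mF F0 cF.
have H q : exists N, (q <= N)%N /\ (\int[m]_x F N x <= (1 / (2 ^ q.+1)%:R : R)%:E)%E.
  have I0 n : (0 <= \int[m]_x F n x)%E by exact: integral_ge0.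
  have E0 : (0 : R) < 1 / (2 ^ q.+1)%:R by rewrite divr_gt0// ltr0n expn_gt0.
  have [N _ NP] := (cvge0P I0).1 cF _ E0; exists (maxn q N).
  rewrite leq_maxl; split => //.
  by apply: NP; rewrite /= leq_maxr.
pose phi q := sval (cid (H q)).
exists phi; split => [q|]; first by rewrite /phi; case: cid => //= ? [].
have mS : measurable_fun setT (fun x => \sum_(0 <= q <oo) F (phi q) x)%E.
  by apply: ge0_emeasurable_sum.
have : m.-integrable setT (fun x => \sum_(0 <= q <oo) F (phi q) x)%E.
  apply: integrable_of_fin_num => //.
  rewrite ge0_fin_numE; last by apply: integral_ge0 => x _; exact: nneseries_ge0.
  rewrite integral_nneseries//.
  apply: (@le_lt_trans _ _ (\sum_(0 <= q <oo) (1 / (2 ^ q.+1)%:R : R)%:E)%E).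
    apply: lee_nneseries => [q _ _|q _]; first exact: integral_ge0.
    by rewrite /phi; case: cid => //= ? [].
  apply: le_lt_trans (epsilon_trick0 xpredT _) _ => //; exact: ltry.
move=> /integrable_ae => /(_ measurableT); apply: filterS => x /(_ I) Sx.
apply/cvge0P => // e e0.
have Slt : (\sum_(0 <= q <oo) F (phi q) x < +oo)%E.
  by rewrite -ge0_fin_numE//; apply: nneseries_ge0.
have T0 n : (0 <= \sum_(n <= q <oo) F (phi q) x)%E by apply: nneseries_ge0.
have [N _ NP] := (cvge0P T0).1 (nneseries_tail_cvg Slt (fun _ _ => F0 _ _)) _ e0.
exists N => // n /= Nn; apply: le_trans (NP n Nn).
by rewrite (nneseries_split n 1)// addn1 big_nat1 leeDl//; exact: nneseries_ge0.
Qed.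

Lemma lee_poweR (R : realType) (r : R) (x y : \bar R) :
  (0 <= r)%R -> (0 <= x)%E -> (x <= y)%E -> (x `^ r <= y `^ r)%E.
Proof.
move=> r0 x0 xy; apply: gt0_ler_poweR => //; rewrite in_itv/= leey andbT//.
exact: le_trans xy.
Qed.

Lemma ge0_integral_shift (R : realType) (r : R) (f : R -> \bar R) :
  measurable_fun setT f -> (forall x, 0 <= f x)%E ->
  (\int[lebesgue_measure]_x f (x + r)%R = \int[lebesgue_measure]_x f x)%E.
Proof.
move=> mf f0.
pose phi := (fun x : measurableTypeR R => (x + r : measurableTypeR R)).
have mphi : measurable_fun setT phi by apply: measurable_funD.
rewrite -[LHS]/(\int[lebesgue_measure]_(x in phi @^-1` setT) (f \o phi) x)%E.
rewrite -(ge0_integral_pushforward mphi) //.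
apply: eq_measure_integral => A mA _.
apply/esym; apply: lebesgue_measure_unique => // X [[a b] /= _ <-].
rewrite /pushforward; set Y := phi @^-1` _.
have -> : Y = `]a - r, b - r]%classic.
  by apply/seteqP; split => x; rewrite /Y /phi /= !in_itv/=; lra.
rewrite !lebesgue_measure_itv /= !lte_fin; rewrite ltrD2r; case: ifPn => // _.
by rewrite -!EFinB; congr EFin; ring.
Qed.

(** Fatou's lemma in the form used for lower semicontinuity: bounds on the
    integrals pass to almost everywhere limits. *)
Lemma ae_fatou_le d (T : measurableType d) (R : realType)
    (m : {measure set T -> \bar R}) (F : nat -> T -> \bar R) (f : T -> \bar R)
    (B : \bar R) :
  (forall q, measurable_fun setT (F q)) -> (forall q x, 0 <= F q x)%E ->
  measurable_fun setT f -> (forall x, 0 <= f x)%E ->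
  {ae m, forall x, F q x @[q --> \oo] --> f x} ->
  (\forall q \near \oo, \int[m]_x F q x <= B)%E ->
  (\int[m]_x f x <= B)%E.
Proof.
move=> mF F0 mf f0 cF HB.
rewrite (ge0_ae_eq_integral (g := fun x => limn_einf (F ^~ x))) //.
- apply: le_trans (fatou _ _ _ _) _ => //.
  rewrite limn_einf_lim; apply: lime_le; first exact: is_cvg_einfs.
  move: HB; apply: filterS => q Hq; apply: le_trans Hq; apply: ereal_inf_lbound.
  by exists q => //=.
- rewrite (_ : (fun _ => _) = (fun x => - limn_esup (fun q => - F q x))%E).
    apply: measurableT_comp => //; apply: measurable_fun_limn_esup => q.
    exact: measurableT_comp.
  by apply/funext => x; rewrite -limn_einfN; congr limn_einf; apply/funext => q /=; rewrite oppeK.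
- move=> x _; rewrite limn_einf_lim; apply: lime_ge; first exact: is_cvg_einfs.
  by near=> q; apply: le_ereal_inf_tmp => _ [n _ <-].
- move: cF; apply: filterS => x cx _.
  by rewrite (cvg_limn_einf_sup cx).1.
Unshelve. all: by end_near. Qed.

Lemma integral_cauchy_schwarz d (T : measurableType d) (R : realType)
    (m : {measure set T -> \bar R}) (f g : T -> R) (a b : R) :
  measurable_fun setT f -> measurable_fun setT g -> 0 <= a -> 0 <= b ->
  (\int[m]_x ((f x) ^+ 2)%:E <= a%:E)%E ->
  (\int[m]_x ((g x) ^+ 2)%:E <= b%:E)%E ->
  (\int[m]_x `|f x * g x|%:E <= (Num.sqrt a * Num.sqrt b)%:E)%E.
Proof.
move=> mf mg a0 b0 fa gb.
have mf2 : measurable_fun setT (fun x => ((f x) ^+ 2)%:E).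
  by apply/measurable_EFinP; apply: measurable_funX.
have mg2 : measurable_fun setT (fun x => ((g x) ^+ 2)%:E).
  by apply/measurable_EFinP; apply: measurable_funX.
have := hoelder m mf mg (p := 2) (q := 2).
have pow2 (h : T -> R) : 'N[m]_2%:E[EFin \o h]%E = ((\int[m]_x ((h x) ^+ 2)%:E) `^ 2^-1)%E.
  rewrite Lnorm.unlock; congr (_ `^ _)%E; apply: eq_integral => x _ /=.
  by rewrite powR_mulrn// real_normK// num_real.
rewrite Lnorm1 !pow2 => H.
have H2 : (2 : R)^-1 + 2^-1 = 1 by lra.
have := H ltac:(lra) ltac:(lra) H2; move/le_trans; apply.
have sq (h : T -> R) (c : R) : 0 <= c -> (\int[m]_x ((h x) ^+ 2)%:E <= c%:E)%E ->
    ((\int[m]_x ((h x) ^+ 2)%:E) `^ 2^-1 <= (Num.sqrt c)%:E)%E.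
  move=> c0 hc; rewrite -powR12_sqrt// -poweR_EFin.
  have h0 : (0 <= \int[m]_x ((h x) ^+ 2)%:E)%E.
    by apply: integral_ge0 => x _; rewrite lee_fin sqr_ge0.
  exact: lee_poweR.
by rewrite EFinM; apply: lee_pmul; rewrite ?poweR_ge0//; exact: sq.
Qed.

(** Young's inequality for [a / A] and 1; the parameter [A] is optimized after
    integration. *)
Lemma young_powR (R : realType) (a A q : R) : 0 <= a -> 0 < A -> 1 <= q ->
  a <= A * (1 - q^-1) + A / q * (A `^ (- q) * a `^ q).
Proof.
move=> a0 A0 q1; have q0 : 0 < q by lra.
have aA : (a / A) `^ q = A `^ (- q) * a `^ q.
  rewrite powRM ?invr_ge0 ?(ltW A0)// mulrC; congr (_ * _).
  by rewrite powRN -(powR_inv1 (ltW A0)) -powRrM mulN1r powRN.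
suff H : a / A <= (1 - q^-1) + (a / A) `^ q / q.
  rewrite -(ler_pM2l A0) in H; rewrite mulrCA divff ?gt_eqF// mulr1 in H.
  by apply: le_trans H _; rewrite aA mulrDr lerD2l le_eqVlt; apply/orP; left; apply/eqP; ring.
have [->|qn1] := eqVneq q 1.
  by rewrite powRr1 ?divr_ge0 ?(ltW A0)// invr1 mulr1 subrr add0r.
have q1' : 1 < q by rewrite lt_neqAle eq_sym qn1.
have q'0 : 0 < (1 - q^-1)^-1 by rewrite invr_gt0 subr_gt0 invf_lt1.
have H := @conjugate_powR _ (a / A) 1 q (1 - q^-1)^-1.
rewrite mulr1 powR1 invrK mul1r in H; rewrite addrC.
have aA0 : 0 <= a / A by rewrite divr_ge0// ltW.
by apply: H => //; rewrite addrC subrK.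
Qed.

Lemma young_poweR (R : realType) (a : \bar R) (r A q : R) :
  (0 <= a)%E -> 0 < r -> 0 < A -> 1 <= q ->
  (a <= (A * (1 - q^-1))%:E * r%:E
     + (A / q * A `^ (- q))%:E * ((r `^ (1 - q))%:E * a `^ q))%E.
Proof.
move=> a0 r0 A0 q1.
have q0 : 0 < q by lra.
have c0 : 0 < A / q * A `^ (- q) by rewrite !mulr_gt0 ?powR_gt0 ?invr_gt0.
case: a a0 => [a a0|_|//]; last first.
  rewrite poweRyr ?gt_eqF// gt0_muley ?lte_fin ?powR_gt0//.
  by rewrite gt0_muley ?lte_fin// addey.
rewrite poweR_EFin -!EFinM -EFinD lee_fin.
have := @young_powR _ (r^-1 * a) A q.
rewrite mulr_ge0 ?invr_ge0 ?(ltW r0)// => /(_ isT A0 q1).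
move=> H; rewrite -(ler_pM2l r0) in H.
rewrite mulVKf ?gt_eqF// in H; apply: le_trans H _.
rewrite powRM ?invr_ge0 ?(ltW r0)// -(powR_inv1 (ltW r0)) -(powRrM r) mulN1r.
rewrite powRD; last by rewrite (gt_eqF r0) implybT.
rewrite powRr1 ?(ltW r0)//.
by rewrite le_eqVlt; apply/orP; left; apply/eqP; ring.
Qed.

(** The weight [rho] makes the inequality meaningful on a space of infinite
    measure.  It results from the integration of Young's inequality for
    [Y x / rho x]. *)
Lemma jensen_poweR d (T : measurableType d) (R : realType)
    (m : {measure set T -> \bar R}) (Y : T -> \bar R) (rho : T -> R) (S q : R) :
  measurable_fun setT Y -> (forall x, 0 <= Y x)%E ->
  measurable_fun setT rho -> (forall x, 0 < rho x) -> 0 < S -> 1 <= q ->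
  (\int[m]_x (rho x)%:E <= S%:E)%E ->
  ((\int[m]_x Y x) `^ q
    <= (S `^ (q - 1))%:E * \int[m]_x ((rho x `^ (1 - q))%:E * Y x `^ q))%E.
Proof.
move=> mY Y0 mrho rho0 S0 q1 iS; have q0 : 0 < q by lra.
have mZ : measurable_fun setT (fun x => (rho x `^ (1 - q))%:E * Y x `^ q)%E.
  apply: emeasurable_funM.
    apply/measurable_EFinP.
    exact: (measurableT_comp (measurable_powR (1 - q))).
  exact: (measurableT_comp (measurable_poweR q)).
have Z0 x : (0 <= (rho x `^ (1 - q))%:E * Y x `^ q)%E.
  by rewrite mule_ge0// ?poweR_ge0// lee_fin powR_ge0.
set J := (\int[m]_x ((rho x `^ (1 - q))%:E * _))%E.
have J0 : (0 <= J)%E by exact: integral_ge0.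
have [Jy|Jfin] := eqVneq J +oo%E.
  by rewrite Jy gt0_muley ?lte_fin ?powR_gt0// leey.
have fJ : J \is a fin_num by rewrite ge0_fin_numE// lt_neqAle Jfin leey.
apply/lee_addgt0Pr => e e0.
pose e' := e / S `^ (q - 1).
have e'0 : 0 < e' by rewrite divr_gt0// powR_gt0.
(* The optimal parameter is [A = (J / S)^(1 / q)]; adding [e'] keeps [A] positive
   when [J] vanishes. *)
pose c := (fine J + e') / S.
have c0 : 0 < c by rewrite divr_gt0// ltr_wpDl// fine_ge0.
pose A := c `^ q^-1.
have A0 : 0 < A by rewrite powR_gt0.
have mrE : measurable_fun setT (fun x => (rho x)%:E) by exact/measurable_EFinP.
have q1' : 0 <= 1 - q^-1 by rewrite subr_ge0 invf_le1.
have H : (\int[m]_x Y x <= (A * S)%:E)%E.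
  apply: (@le_trans _ _ (\int[m]_x ((A * (1 - q^-1))%:E * (rho x)%:E
     + (A / q * A `^ (- q))%:E * ((rho x `^ (1 - q))%:E * Y x `^ q)))%E).
    apply: ge0_le_integral => //; last by move=> x _; exact: young_poweR.
    by apply: emeasurable_funD; apply: emeasurable_funM.
  rewrite ge0_integralD//; last first.
  - by apply: emeasurable_funM.
  - by move=> x _; rewrite mule_ge0// lee_fin !mulr_ge0 ?powR_ge0// ?invr_ge0 ltW.
  - by apply: emeasurable_funM.
  - by move=> x _; rewrite mule_ge0// lee_fin ?mulr_ge0// ltW.
  rewrite ge0_integralZl_EFin//; last 2 first.
  - by move=> x _; rewrite lee_fin ltW.
  - by rewrite mulr_ge0// ltW.
  rewrite ge0_integralZl_EFin//; last by rewrite !mulr_ge0 ?powR_ge0// ?invr_ge0 ltW.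
  apply: (@le_trans _ _ ((A * (1 - q^-1))%:E * S%:E + (A / q * A `^ (- q))%:E * (fine J + e')%:E)%E).
    apply: leeD; apply: lee_pmul => //.
    - by rewrite lee_fin mulr_ge0// ltW.
    - by apply: integral_ge0 => x _; rewrite lee_fin ltW.
    - by rewrite lee_fin !mulr_ge0 ?powR_ge0// ?invr_ge0 ltW.
    - by rewrite -/J -{1}(fineK fJ) lee_fin lerDl ltW.
  rewrite -!EFinM -EFinD lee_fin.
  have -> : A `^ (- q) = c^-1 by rewrite /A -powRrM mulrN mulVf ?gt_eqF// powR_inv1 ?ltW.
  rewrite /c le_eqVlt; apply/orP; left; apply/eqP; field.
  by rewrite ?gt_eqF//= /c; apply: lt_le_trans e'0 _; rewrite lerDr fine_ge0.
have Y0i : (0 <= \int[m]_x Y x)%E by exact: integral_ge0.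
apply: (le_trans (lee_poweR (ltW q0) Y0i H)).
rewrite poweR_EFin powRM ?(ltW A0) ?(ltW S0)// /A -powRrM mulVf ?gt_eqF//.
rewrite powRr1 ?(ltW c0)// -(fineK fJ) -EFinM -EFinD lee_fin.
rewrite powRB; last by rewrite (gt_eqF S0) implybT.
rewrite /c /e' powRB; last by rewrite (gt_eqF S0) implybT.
rewrite powRr1 ?(ltW S0)//.
rewrite le_eqVlt; apply/orP; left; apply/eqP; field.
by rewrite ?gt_eqF// powR_gt0.
Qed.

(** A substitute for Minkowski's integral inequality that asks for the moments
    of [Y x] only in terms of an integrable profile [rho], for almost every [x]:
    after [jensen_poweR] with weight [rho], only Tonelli's theorem is left. *)
Lemma minkowski_integral d1 d2 (T : measurableType d1) (Om : measurableType d2)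
    (R : realType) (m : {sigma_finite_measure set T -> \bar R})
    (P : {sigma_finite_measure set Om -> \bar R})
    (Y : T * Om -> \bar R) (rho : T -> R) (K S q : R) :
  measurable_fun setT Y -> (forall z, 0 <= Y z)%E ->
  measurable_fun setT rho -> (forall x, 0 < rho x) -> 0 < S -> 1 <= q -> 0 <= K ->
  (\int[m]_x (rho x)%:E <= S%:E)%E ->
  {ae m, forall x, (\int[P]_w (Y (x, w) `^ q) <= (K * rho x `^ q)%:E)%E} ->
  (\int[P]_w ((\int[m]_x Y (x, w)) `^ q) <= (K * S `^ q)%:E)%E.
Proof.
move=> mY Y0 mrho rho0 S0 q1 K0 iS HY.
have mZ : measurable_fun setT (fun z => (rho z.1 `^ (1 - q))%:E * Y z `^ q)%E.
  apply: emeasurable_funM.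
    apply/measurable_EFinP.
    by apply: (measurableT_comp (measurable_powR (1 - q))); exact: measurableT_comp.
  exact: (measurableT_comp (measurable_poweR q)).
have Z0 z : (0 <= (rho z.1 `^ (1 - q))%:E * Y z `^ q)%E.
  by rewrite mule_ge0// ?poweR_ge0// lee_fin powR_ge0.
have mYx x : measurable_fun setT (fun w => Y (x, w)) by exact: measurableT_comp.
have mYw w : measurable_fun setT (fun x => Y (x, w)) by exact: measurableT_comp.
have mW := measurable_fun_fubini_tonelli_G (m1 := m) _ mZ Z0.
apply: (@le_trans _ _ (\int[P]_w ((S `^ (q - 1))%:E *
    \int[m]_x ((rho x `^ (1 - q))%:E * Y (x, w) `^ q)))%E).
  apply: ge0_le_integral => //.
  - by move=> w _; exact: poweR_ge0.
  - apply: (measurableT_comp (measurable_poweR q)).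
    exact: (measurable_fun_fubini_tonelli_G (m1 := m) _ mY Y0).
  - by apply: emeasurable_funM => //; exact: mW.
  - by move=> w _; exact: jensen_poweR.
rewrite ge0_integralZl_EFin//; last 2 first.
- by move=> w _; apply: integral_ge0 => x _; exact: (Z0 (x, w)).
- exact: powR_ge0.
rewrite -(fubini_tonelli _ mZ Z0)/=.
apply: (@le_trans _ _ ((S `^ (q - 1))%:E * \int[m]_x (K%:E * (rho x)%:E))%E).
  apply: lee_wpmul2l; first by rewrite lee_fin powR_ge0.
  apply: ae_ge0_le_integral => //.
  - by move=> x _; apply: integral_ge0 => w _; exact: (Z0 (x, w)).
  - exact: (measurable_fun_fubini_tonelli_F (m2 := P) _ mZ Z0).
  - by move=> x _; rewrite lee_fin mulr_ge0// ltW.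
  - by apply: emeasurable_funM => //; exact/measurable_EFinP.
  move: HY; apply: filterS => x Hx _.
  rewrite ge0_integralZl_EFin//; last 3 first.
  - by move=> w _; exact: poweR_ge0.
  - exact: (measurableT_comp (measurable_poweR q)).
  - exact: powR_ge0.
  apply: (@le_trans _ _ ((rho x `^ (1 - q))%:E * (K * rho x `^ q)%:E)%E).
    by apply: lee_wpmul2l => //; rewrite lee_fin powR_ge0.
  rewrite -!EFinM lee_fin mulrCA -powRD; last by rewrite (gt_eqF (rho0 x)) implybT.
  by rewrite subrK powRr1// ltW.
rewrite ge0_integralZl_EFin//; last 2 first.
- by move=> x _; rewrite lee_fin ltW.
- exact/measurable_EFinP.
apply: (@le_trans _ _ ((S `^ (q - 1))%:E * (K%:E * S%:E))%E).
  by apply: lee_wpmul2l; [rewrite lee_fin powR_ge0|apply: lee_wpmul2l].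
rewrite -!EFinM lee_fin mulrCA ler_wpM2l//.
by rewrite mulrC mulr_powRB1// ?ltW//; lra.
Qed.

(** * Moments of Gaussian variables *)

Lemma measurable_fun_lt d (T : measurableType d) (R : realType) (f g : T -> R) :
  measurable_fun setT f -> measurable_fun setT g ->
  measurable (setT `&` [set x | f x < g x]).
Proof.
move=> mf mg; rewrite setTI.
have -> : [set x | f x < g x] = ~` [set x | g x <= f x].
  by apply/seteqP; split => x /=; rewrite ltNge => /negP.
by apply: measurableC; rewrite -[X in measurable X]setTI; exact: measurable_fun_le.
Qed.

Lemma integral_density d (T : measurableType d) (R : realType)
    (nu m : {sigma_finite_measure set T -> \bar R}) (f g : T -> R) :
  measurable_fun setT f -> (forall x, 0 <= f x) ->
  measurable_fun setT g -> (forall x, 0 <= g x) ->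
  (forall A, measurable A -> nu A = \int[m]_(x in A) (g x)%:E)%E ->
  (\int[nu]_x (f x)%:E = \int[m]_x (f x * g x)%:E)%E.
Proof.
move=> mf f0 mg g0 nuE.
pose E := [set z : T * measurableTypeR R | 0 <= z.2 /\ z.2 < f z.1].
have mE : measurable E.
  have m1 : measurable_fun setT (fun z : T * measurableTypeR R => z.2) by exact: measurable_snd.
  have m2 : measurable_fun setT (fun z : T * measurableTypeR R => f z.1).
    exact: measurableT_comp.
  have -> : E = [set z | (fun=> 0) z <= z.2] `&` [set z | z.2 < f z.1] by [].
  by apply: measurableI; rewrite -[X in measurable X]setTI;
    [apply: measurable_fun_le|apply: measurable_fun_lt].
have fE x : ((f x)%:E = \int[lebesgue_measure]_v (\1_E (x, v))%:E)%E.
  rewrite (eq_integral (fun v => (\1_(`[0, f x[%classic : set (measurableTypeR R)) v)%:E)).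
    rewrite integral_indic//= setIT lebesgue_measure_itv/= lte_fin.
    case: ltP => [_|]; first by rewrite sube0.
    by move=> fx0; congr EFin; apply/eqP; rewrite eq_le fx0 f0.
  move=> v _; congr EFin; rewrite !indicE; congr (nat_of_bool _)%:R.
  apply/idP/idP; rewrite !inE/= in_itv/=; first by case=> -> ->.
  by move=> /andP[].
have mI : measurable_fun setT (fun z => (\1_E z)%:E : \bar R).
  by apply/measurable_EFinP; exact: measurable_indic.
have mIg : measurable_fun setT (fun z => (\1_E z * g z.1)%:E : \bar R).
  apply/measurable_EFinP; apply: measurable_funM; first exact: measurable_indic.
  exact: measurableT_comp.
under eq_integral do rewrite fE.
rewrite (fubini_tonelli (m1 := nu) (m2 := lebesgue_measure) _ mI)/=; last first.
  by move=> z; rewrite lee_fin.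
rewrite [RHS](eq_integral
    (fun x => (\int[lebesgue_measure]_v (\1_E (x, v) * g x)%:E)%E)); last first.
  move=> x _; rewrite EFinM fE -ge0_integralZr//.
    exact: (measurableT_comp mI (pair1_measurable x)).
  by rewrite lee_fin.
have := fubini_tonelli (m1 := m) (m2 := lebesgue_measure) _ mIg.
rewrite /= => ->; last by move=> z; rewrite lee_fin mulr_ge0.
apply: eq_integral => v _.
have mEv : measurable (ysection E v) by exact: measurable_ysection.
have yE x : \1_E (x, v) = \1_(ysection E v) x :> R.
  by rewrite !indicE mem_ysection.
under eq_integral do rewrite yE.
transitivity (nu (ysection E v)); first by rewrite integral_indic// setIT.
rewrite nuE// integral_mkcond; apply: eq_integral => x _.
by rewrite patchE yE indicE; case: ifPn; rewrite ?mul1r ?mul0r.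
Qed.

Lemma powR_le_expR (R : realType) (p : R) : 0 <= p ->
  exists2 C : R, 0 <= C & forall y, 0 <= y -> y `^ p <= C * expR (3 / 8 * y ^+ 2).
Proof.
move=> p0; pose N := (Num.trunc p).+1.
have pN : p <= (2 * N)%:R.
  apply: (@le_trans _ _ N%:R); first by rewrite ltW// truncnS_gt.
  by rewrite ler_nat leq_pmull.
exists (1 + N`!%:R * (8 / 3) ^+ N) => [|y y0].
  by rewrite addr_ge0// mulr_ge0// exprn_ge0.
have e1 : 1 <= expR (3 / 8 * y ^+ 2).
  by rewrite -[leLHS]expR0 ler_expR mulr_ge0// sqr_ge0.
have [y1|y1] := leP y 1.
  apply: (@le_trans _ _ 1).
    have <- : 1 `^ p = 1 :> R by rewrite powR1.
    apply: ge0_ler_powR => //; rewrite nnegrE//.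
  by rewrite mulrDl mul1r (le_trans e1)// lerDl mulr_ge0 ?expR_ge0.
apply: (@le_trans _ _ (y ^+ (2 * N))).
  by rewrite -powR_mulrn//; apply: ler_powR => //; exact: ltW.
rewrite mulrDl mul1r ler_wpDl ?expR_ge0//.
have z0 : 0 <= 3 / 8 * y ^+ 2 by rewrite mulr_ge0// sqr_ge0.
have := expR_ge1Dxn (Num.trunc p) z0; rewrite -/N => H.
have {}H : (3 / 8 * y ^+ 2) ^+ N / N`!%:R <= expR (3 / 8 * y ^+ 2).
  by apply: le_trans H; rewrite lerDr.
have f0 : (0 : R) < N`!%:R by rewrite ltr0n fact_gt0.
have c0 : (0 : R) <= N`!%:R * (8 / 3) ^+ N by rewrite mulr_ge0// ?exprn_ge0// ltW.
apply: le_trans (ler_wpM2l c0 H).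
have <- : (8 / 3) ^+ N * (3 / 8 * y ^+ 2) ^+ N = y ^+ (2 * N).
  by rewrite -exprMn exprM; congr (_ ^+ _); field.
move: (_ ^+ N) ((3 / 8 * y ^+ 2) ^+ N) => u v.
rewrite le_eqVlt; apply/orP; left; apply/eqP; field.
by rewrite gt_eqF.
Qed.

(** The factor [expR (3 / 8 * y ^+ 2)] is the quotient of the Gaussian densities
    with deviations 2 and 1, up to a constant.  Domination by a wider density
    replaces the change of variables to the standard normal law. *)
Lemma normal_pdf_le_scale (R : realType) (s x : R) (p C : R) : 0 < s -> 0 <= p ->
  (forall y, 0 <= y -> y `^ p <= C * expR (3 / 8 * y ^+ 2)) ->
  `|x| `^ p * normal_pdf 0 s x <= 2 * C * s `^ p * normal_pdf 0 (2 * s) x.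
Proof.
move=> s0 p0 HC.
have s1 : s != 0 by rewrite gt_eqF.
have s2 : 2 * s != 0 by rewrite mulf_neq0.
rewrite !normal_pdfE// /normal_fun !subr0.
have pk : normal_peak (2 * s) = normal_peak s / 2.
  rewrite /normal_peak exprMn -mulrA -mulrnAr sqrtrM ?exprn_ge0// sqrtr_sqr.
  by rewrite ger0_norm// invfM mulrC.
rewrite pk.
have xs : `|x| `^ p = s `^ p * (`|x| / s) `^ p.
  rewrite -powRM ?divr_ge0// ?(ltW s0)//; congr (_ `^ _).
  by rewrite mulrC mulfVK.
rewrite xs.
have H := HC (`|x| / s) (divr_ge0 (normr_ge0 _) (ltW s0)).
have pk0 : 0 <= normal_peak s by exact: normal_peak_ge0.
have sp0 : 0 <= s `^ p by exact: powR_ge0.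
apply: (@le_trans _ _ (s `^ p * (C * expR (3 / 8 * (`|x| / s) ^+ 2)) *
   (normal_peak s * expR (- x ^+ 2 / (s ^+ 2 *+ 2))))).
  rewrite ler_wpM2r ?mulr_ge0 ?expR_ge0//.
  by rewrite ler_wpM2l.
have -> : - x ^+ 2 / (s ^+ 2 *+ 2) = - x ^+ 2 / ((2 * s) ^+ 2 *+ 2) - 3 / 8 * (`|x| / s) ^+ 2.
  rewrite expr_div_n real_normK ?num_real// -(mulr_natl (s ^+ 2)).
  by rewrite -(mulr_natl ((2 * s) ^+ 2)); field; rewrite s1.
rewrite expRD expRN.
rewrite le_eqVlt; apply/orP; left; apply/eqP; field.
by rewrite gt_eqF// expR_gt0.
Qed.

Lemma normal_second_moment_ge (R : realType) (s : R) : 0 < s ->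
  ((s ^+ 2 / 8)%:E <= \int[lebesgue_measure]_x (x ^+ 2 * normal_pdf 0 s x)%:E)%E.
Proof.
move=> s0.
have s1 : s != 0 by rewrite gt_eqF.
have pk0 : 0 <= normal_peak s by exact: normal_peak_ge0.
have pk : s * normal_peak s <= 1 / 2.
  rewrite /normal_peak -mulrnAr sqrtrM ?sqr_ge0// sqrtr_sqr.
  rewrite ger0_norm ?(ltW s0)// invfM mulrA divff// mul1r.
  have p2 : 0 < pi *+ 2 :> R by rewrite mulrn_wgt0// pi_gt0.
  rewrite div1r lef_pV2 ?posrE ?sqrtr_gt0//.
  rewrite -[leLHS](ger0_norm (x := 2))// -sqrtr_sqr ler_sqrt ?(ltW p2)//.
  by rewrite mulr2n expr2; have := pi_ge2 R; lra.
have mpdf := measurable_normal_pdf (0 : R) s.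
(* As the density is at most [1 / (2 * s)], the interval [I] of length [s]
   carries at most half of the mass, and [x ^+ 2 >= s ^+ 2 / 4] outside of [I]. *)
pose I : set (measurableTypeR R) := `[- (s / 2), s / 2]%classic.
have mI : measurable I by exact: measurable_itv.
set M := (X in (_ <= X)%E).
have M0 : (0 <= M)%E.
  by apply: integral_ge0 => x _; rewrite lee_fin mulr_ge0 ?sqr_ge0 ?normal_pdf_ge0.
have q0 x : 0 <= x ^+ 2 * normal_pdf 0 s x.
  exact: mulr_ge0 (sqr_ge0 _) (normal_pdf_ge0 _ _ _).
have c0 : 0 <= 4 / s ^+ 2 by apply: divr_ge0 => //; exact: sqr_ge0.
have : (1 <= (1 / 2)%:E + (4 / s ^+ 2)%:E * M)%E.
  rewrite -(integral_normal_pdf (0 : R) s).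
  apply: (@le_trans _ _ (\int[lebesgue_measure]_x ((normal_peak s)%:E * (\1_I x)%:E
      + (4 / s ^+ 2)%:E * (x ^+ 2 * normal_pdf 0 s x)%:E))%E).
    apply: ge0_le_integral => //.
    - by move=> x _; rewrite lee_fin normal_pdf_ge0.
    - exact/measurable_EFinP.
    - apply: emeasurable_funD; apply: emeasurable_funM => //; apply/measurable_EFinP.
        exact: measurable_indic.
      by apply: measurable_funM => //; exact: measurable_funX.
    move=> x _; rewrite -!EFinM -EFinD lee_fin.
    have n0 := normal_pdf_ge0 0 s x.
    rewrite indicE; case: (boolP (x \in I)) => xI.
      rewrite mulr1 (le_trans (normal_pdf_ub 0 x s1))// lerDl.
      exact: mulr_ge0.
    rewrite mulr0 add0r mulrA ler_peMl//.
    rewrite mulrAC ler_pdivlMr ?exprn_gt0// mul1r.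
    have xs : s / 2 <= `|x|.
      rewrite leNgt; apply/negP => xs; move: xI; rewrite notin_setE; apply => /=.
      by rewrite /I /= in_itv/= -ler_norml ltW.
    have h0 : 0 <= s / 2 by lra.
    have := ler_pM h0 h0 xs xs; rewrite -!expr2 real_normK ?num_real// expr_div_n.
    by rewrite !expr2; lra.
  rewrite ge0_integralD//; last 4 first.
  - by move=> x _; rewrite mule_ge0 ?lee_fin.
  - by apply: emeasurable_funM => //; apply/measurable_EFinP; exact: measurable_indic.
  - by move=> x _; rewrite mule_ge0 ?lee_fin.
  - apply: emeasurable_funM => //; apply/measurable_EFinP.
    by apply: measurable_funM => //; exact: measurable_funX.
  rewrite ge0_integralZl_EFin//; last first.
    by apply/measurable_EFinP; exact: measurable_indic.
  rewrite ge0_integralZl_EFin//; last 2 first.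
  - by move=> x _; rewrite lee_fin.
  - apply/measurable_EFinP.
    by apply: measurable_funM => //; exact: measurable_funX.
  have mIs : lebesgue_measure I = s%:E.
    rewrite /I lebesgue_measure_itv/= lte_fin ifT; last by lra.
    by rewrite -EFinB; congr EFin; lra.
  apply: leeD => //; rewrite integral_indic// setIT.
  by rewrite [X in (_ * X)%E]mIs -EFinM lee_fin mulrC.
case: M M0 => [M||] // M0; last by rewrite leey.
rewrite -EFinM -EFinD !lee_fin => H.
have {}H : 1 / 2 <= 4 / s ^+ 2 * M by lra.
move: H; rewrite mulrAC ler_pdivlMr ?exprn_gt0// => H.
by move: H; rewrite -[s ^+ 2]/(s ^+ 2); lra.
Qed.

(** The density with deviation [s] is controlled by that with deviation [2 * s],
    which has mass 1, and [s ^+ 2] is at most 8 times the variance. *)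
Lemma gaussian_moment d (Om : measurableType d) (R : realType)
    (P : probability Om R) (p : R) : 0 < p ->
  exists2 K : R, 0 <= K & forall (X : Om -> R) (v : R), centered_gaussian P X ->
    (\int[P]_w ((X w) ^+ 2)%:E <= v%:E)%E ->
    (\int[P]_w (`|X w| `^ p)%:E <= (K * v `^ (p / 2))%:E)%E.
Proof.
move=> p0; have [C C0 HC] := powR_le_expR (ltW p0).
exists (2 * C * 8 `^ (p / 2)) => [|X v [mX HX] Ev].
  by rewrite !mulr_ge0// powR_ge0.
have v0 : 0 <= v.
  rewrite -lee_fin (le_trans _ Ev)//; apply: integral_ge0 => x _.
  by rewrite lee_fin sqr_ge0.
pose X' : Om -> measurableTypeR R := X.
have mX' : measurable_fun setT X' by exact: mX.
have push (f : measurableTypeR R -> R) : measurable_fun setT f -> (forall x, 0 <= f x) ->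
  (\int[P]_w (f (X w))%:E = \int[pushforward P X']_x (f x)%:E)%E.
  move=> mf f0; rewrite (ge0_integral_pushforward mX')//; first exact/measurable_EFinP.
  by move=> y _; rewrite lee_fin.
have mp : measurable_fun setT (fun x : R => `|x| `^ p).
  exact: (measurableT_comp (measurable_powR p)).
have m2 : measurable_fun setT (fun x : R => x ^+ 2) by exact: measurable_funX.
rewrite (push (fun x => `|x| `^ p) mp (fun x => powR_ge0 _ _)).
rewrite (push (fun x => x ^+ 2) m2 (fun x => sqr_ge0 _)) in Ev.
case: HX => [HX|[s s0 HX]].
  rewrite (_ : (\int[pushforward P X']_x _ = 0)%E).
    by rewrite lee_fin !mulr_ge0// powR_ge0.
  rewrite (eq_measure_integral (dirac (0 : measurableTypeR R))); last by move=> A mA _; exact: HX.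
  rewrite integral_dirac//; last exact/measurable_EFinP.
  by rewrite normr0 powR0 ?gt_eqF// mule0.
have eqn (f : measurableTypeR R -> R) : measurable_fun setT f -> (forall x, 0 <= f x) ->
  (\int[pushforward P X']_x (f x)%:E
     = \int[lebesgue_measure]_x (f x * normal_pdf 0 s x)%:E)%E.
  move=> mf f0.
  transitivity (\int[normal_prob 0 s]_x (f x)%:E)%E.
    by apply: eq_measure_integral => A mA _; exact: HX.
  rewrite (integral_density (m := lebesgue_measure) (g := normal_pdf 0 s))//.
    exact: measurable_normal_pdf.
  by move=> x; exact: normal_pdf_ge0.
rewrite eqn// in Ev; last by move=> x; exact: sqr_ge0.
rewrite eqn//.
have sv : s ^+ 2 / 8 <= v.
  by rewrite -lee_fin (le_trans _ Ev)//; exact: normal_second_moment_ge.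
apply: (@le_trans _ _ (\int[lebesgue_measure]_x ((2 * C * s `^ p)%:E * (normal_pdf 0 (2 * s) x)%:E))%E).
  apply: ge0_le_integral => //.
  - by move=> x _; rewrite lee_fin mulr_ge0 ?powR_ge0 ?normal_pdf_ge0.
  - by apply/measurable_EFinP; apply: measurable_funM => //; exact: measurable_normal_pdf.
  - by apply: emeasurable_funM => //; apply/measurable_EFinP; exact: measurable_normal_pdf.
  - by move=> x _; rewrite -EFinM lee_fin; apply: normal_pdf_le_scale => //; exact: ltW.
rewrite ge0_integralZl_EFin//; last 3 first.
- by move=> x _; rewrite lee_fin normal_pdf_ge0.
- by apply/measurable_EFinP; exact: measurable_normal_pdf.
- by rewrite !mulr_ge0// powR_ge0.
rewrite integral_normal_pdf mule1 lee_fin -!mulrA; do 2 apply: ler_wpM2l => //.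
rewrite -powRM//; have -> : s `^ p = (s ^+ 2) `^ (p / 2).
  by rewrite -powR_mulrn ?(ltW s0)// -powRrM; congr (_ `^ _); field.
by apply: ge0_ler_powR; rewrite ?nnegrE ?sqr_ge0 ?mulr_ge0//; lra.
Qed.

(** * A layer-cake formula for the fractional power *)

Lemma is_derive_powR_anti (R : realType) (c g x : R) : g != 1 -> 0 < x ->
  is_derive x (1 : R) (fun t : R => - c * t `^ (1 - g) / (g - 1)) (c * x `^ (- g)).
Proof.
move=> g1 x0; have H := is_derive1_powR (1 - g) x0.
have -> : (fun t : R => - c * t `^ (1 - g) / (g - 1))
    = (- c / (g - 1)) \*: (fun t : R => t `^ (1 - g)).
  by apply/funext => t /=; rewrite /GRing.scale/=; ring.
have -> : c * x `^ (- g) = (- c / (g - 1)) *: ((1 - g) * x `^ (1 - g - 1)).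
  rewrite /GRing.scale/= [1 - g - 1]addrAC subrr sub0r; field.
  by rewrite subr_eq0.
exact: is_deriveZ.
Qed.

Lemma integral_powR_tail (R : realType) (c g a : R) : 0 < a -> 1 < g -> 0 <= c ->
  (\int[lebesgue_measure]_(x in `[a, +oo[) (c * x `^ (- g))%:E
    = (c * a `^ (1 - g) / (g - 1))%:E)%E.
Proof.
move=> a0 g1 c0.
have g1' : g != 1 by rewrite gt_eqF.
have D (x : R) : 0 < x -> is_derive x (1 : R) (fun t : R => - c * t `^ (1 - g) / (g - 1)) (c * x `^ (- g)).
  by move=> x0; exact: is_derive_powR_anti.
have C (e x : R) : 0 < x -> {for x, continuous (fun t : R => t `^ e)}.
  move=> x0; apply: differentiable_continuous; apply/derivable1_diffP.
  by apply: derivable_powR; rewrite in_itv/= x0.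
rewrite (ge0_continuous_FTC2y (F := fun t : R => - c * t `^ (1 - g) / (g - 1)) (l := 0)).
- by rewrite sub0e -EFinN; congr EFin; ring.
- by move=> x ax; rewrite mulr_ge0// powR_ge0.
- apply: continuous_in_subspaceT => x; rewrite inE/= in_itv/= andbT => ax.
  by apply: cvgM; [exact: cvg_cst|apply: C; exact: lt_le_trans ax].
- rewrite -[X in _ --> X](mulr0 (- c / (g - 1))).
  have -> : (fun t : R => - c * t `^ (1 - g) / (g - 1))
    = (fun t => (- c / (g - 1)) * t `^ (1 - g)) by apply/funext => t; ring.
  apply: cvgMr; apply/cvgrPdist_le => e e0; near=> x.
  have x0 : 0 < x by near: x; exact: nbhs_pinfty_gt.
  rewrite sub0r normrN ger0_norm ?powR_ge0//.
  have -> : e = (e `^ (1 - g)^-1) `^ (1 - g).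
    by rewrite -powRrM mulVf ?powRr1 ?(ltW e0)// subr_eq0 eq_sym.
  rewrite -opprB !powRN lef_pV2 ?posrE ?powR_gt0//.
  have e'0 : 0 < e `^ (- (g - 1)^-1) by rewrite powR_gt0.
  apply: ge0_ler_powR; rewrite ?nnegrE ?subr_ge0 ?powR_ge0 ?(ltW g1) ?(ltW x0)//.
- by move=> x ax; case: (D x (lt_trans a0 ax)).
- apply: cvg_at_right_filter.
  apply: cvgM; last exact: cvg_cst.
  by apply: cvgM; [exact: cvg_cst|exact: C].
- move=> x; rewrite in_itv/= andbT => ax; rewrite derive1E.
  by case: (D x (lt_trans a0 ax)).
Unshelve. all: by end_near. Qed.

(** Take [rho = 1] on [[0, H[] and [rho x = (H / x)^(1 / (1 - 2 H))] for
    [x >= H] (0 if [H = 1/2]).  The function [rho] crosses the level [l <= 1] at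
    [A = H l^(2H - 1)], so [Num.min rho l] contributes [l A = H l^(2H)] before [A];
    the tail after [A] contributes [(1/2 - H) l^(2H)]. *)
Lemma exists_increment_scale (R : realType) (H : R) : 0 < H -> H <= 2^-1 ->
  exists rho : R -> R, [/\ measurable_fun setT rho,
    (forall x, 0 <= rho x), (forall x, rho x <= 1) &
    forall l, 0 <= l -> l <= 1 ->
     (\int[lebesgue_measure]_x (2 * Num.min (rho x) l)%:E = (l `^ (2 * H))%:E)%E].
Proof.
move=> H0 H2.
pose g := (1 - 2 * H)^-1.
pose h : R -> R := fun x => if H < 2^-1 then H `^ g * x `^ (- g) else 0.
pose rho : R -> R := fun x => \1_`[0, H[%classic x + h x * \1_`[H, +oo[%classic x.
have hE x : 0 <= h x by rewrite /h; case: ifP => // _; rewrite mulr_ge0 ?powR_ge0.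
have H1 x : H <= x -> h x <= 1.
  move=> Hx; rewrite /h; case: ifPn => // H21.
  have g0 : 0 < g by rewrite invr_gt0; lra.
  have x0 : 0 < x by lra.
  rewrite powRN ler_pdivrMr ?powR_gt0// mul1r.
  by apply: ge0_ler_powR; rewrite ?nnegrE; lra.
have mh : measurable_fun setT h.
  rewrite /h; have [_|_] := boolP (H < 2^-1) => //.
  by apply: measurable_funM => //; exact: measurable_powR.
have mrho : measurable_fun setT rho.
  rewrite /rho; apply: measurable_funD; first exact: measurable_indic.
  by apply: measurable_funM => //; exact: measurable_indic.
exists rho; split.
- exact: mrho.
- by move=> x; rewrite addr_ge0// mulr_ge0.
- move=> x; rewrite /rho !indicE !mem_setE !in_itv/= andbT.
  have [x0|x0] := leP 0 x; have [xH|xH] := ltP x H; rewrite /= ?addr0 ?mulr0 ?mulr1 ?add0r ?addr0//.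
  + exact: H1.
  + by lra.
move=> l l0 l1.
have m1 : measurable_fun setT (fun x : R => (2 * Num.min (rho x) l)%:E).
  apply/measurable_EFinP; apply: measurable_funM => //.
  exact: measurable_minr.
have [->|ln0] := eqVneq l 0.
  rewrite powR0 ?mulf_neq0 ?gt_eqF//.
  rewrite integral0_eq// => x _; rewrite min_r ?mulr0//.
  by rewrite addr_ge0// mulr_ge0.
have lp : 0 < l by rewrite lt_neqAle eq_sym ln0.
pose A := H * l `^ (2 * H - 1).
have A0 : 0 < A by rewrite mulr_gt0// powR_gt0.
have HA : H <= A.
  rewrite /A ler_peMr ?(ltW H0)//.
  apply: (@le_trans _ _ (l `^ 0)); first by rewrite powRr0.
  by apply: ger_powR; [rewrite lp|lra].
have lA : l * A = H * l `^ (2 * H).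
  by rewrite /A mulrCA; congr (_ * _); rewrite mulr_powRB1//; lra.
have key : H < 2^-1 -> H `^ g * A `^ (- g) = l.
  move=> H21; rewrite /A powRM ?powR_ge0 ?(ltW H0)// mulrA -powRD; last first.
    by rewrite (gt_eqF H0) implybT.
  rewrite subrr powRr0 mul1r -powRrM.
  have -> : (2 * H - 1) * - g = 1 by rewrite /g; field; lra.
  by rewrite powRr1.
rewrite (eq_integral (fun x => (2 * l)%:E * (\1_(`[0, A[%classic : set (measurableTypeR R)) x)%:E
    + 2%:E * ((h x)%:E * (\1_(`[A, +oo[%classic : set (measurableTypeR R)) x)%:E))%E); last first.
  move=> x _; rewrite -!EFinM -EFinD; congr EFin.
  rewrite /rho !indicE !mem_setE !in_itv/= !andbT.
  have hA : A <= x -> h x <= l.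
    move=> Ax; rewrite /h; case: ifPn => H21; last by lra.
    have g0 : 0 < g by rewrite invr_gt0; lra.
    have x0 : 0 < x by lra.
    rewrite -(key H21) ler_wpM2l ?powR_ge0// !powRN lef_pV2 ?posrE ?powR_gt0//.
    by apply: ge0_ler_powR; rewrite ?nnegrE; lra.
  have hl : H <= x -> x < A -> l <= h x.
    move=> Hx xA; rewrite /h; case: ifPn => H21.
      have g0 : 0 < g by rewrite invr_gt0; lra.
      have x0 : 0 < x by lra.
      rewrite -(key H21) ler_wpM2l ?powR_ge0// !powRN lef_pV2 ?posrE ?powR_gt0//.
      by apply: ge0_ler_powR; rewrite ?nnegrE; lra.
    exfalso; move: xA; rewrite /A (_ : 2 * H - 1 = 0); last by lra.
    by rewrite powRr0; lra.
  have [x0|x0] := leP 0 x; have [xH|xH] := ltP x H; have [xA|xA] := ltP x A;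
    rewrite /= ?mulr0 ?mulr1 ?addr0 ?add0r ?mul0r; try by (exfalso; lra).
  - by rewrite min_r.
  - by rewrite min_r// hl.
  - by rewrite min_l// hA.
  - by rewrite min_l ?mulr0.
have m3 : measurable_fun setT (fun x => ((h x)%:E * (\1_(`[A, +oo[%classic : set (measurableTypeR R)) x)%:E)%E).
  by apply: emeasurable_funM; apply/measurable_EFinP => //; exact: measurable_indic.
have m4 : measurable_fun setT (fun x : R => (\1_(`[0, A[%classic : set (measurableTypeR R)) x)%:E : \bar R).
  by apply/measurable_EFinP; exact: measurable_indic.
have p3 x : (0 <= (h x)%:E * (\1_(`[A, +oo[%classic : set (measurableTypeR R)) x)%:E)%E.
  by rewrite mule_ge0 ?lee_fin.
have l20 : 0 <= 2 * l by lra.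
rewrite ge0_integralD//; last 4 first.
- by move=> x _; rewrite mule_ge0 ?lee_fin.
- exact: emeasurable_funM.
- by move=> x _; rewrite mule_ge0.
- exact: emeasurable_funM.
rewrite ge0_integralZl_EFin// ge0_integralZl_EFin// integral_indic// setIT.
have mA : lebesgue_measure (`[0, A[%classic : set (measurableTypeR R)) = A%:E.
  by rewrite lebesgue_measure_itv/= lte_fin A0 sube0.
rewrite [X in (_ * X + _)%E]mA.
have -> : (\int[lebesgue_measure]_x ((h x)%:E * (\1_(`[A, +oo[%classic : set (measurableTypeR R)) x)%:E)
    = \int[lebesgue_measure]_(x in `[A, +oo[) (h x)%:E)%E.
  rewrite [RHS]integral_mkcond; apply: eq_integral => x _.
  by rewrite patchE indicE; case: ifP => // _; rewrite ?mule1 ?mule0.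
rewrite /h; have [H21|H21] := boolP (H < 2^-1); last first.
  rewrite integral0 mule0 adde0 -EFinM; congr EFin; rewrite -mulrA lA.
  have -> : H = 2^-1 by lra.
  by rewrite mulrA divff// mul1r.
have g1 : 1 < g by rewrite /g invf_gt1; lra.
rewrite (integral_powR_tail A0 g1 (powR_ge0 _ _)).
rewrite powRD; last by rewrite (gt_eqF A0) implybT.
rewrite (powRr1 (ltW A0)) mulrCA (key H21) -!EFinM -EFinD; congr EFin.
have -> : 2 * l * A = 2 * (H * l `^ (2 * H)) by rewrite -mulrA lA.
have -> : A * l = H * l `^ (2 * H) by rewrite mulrC lA.
have -> : g - 1 = 2 * H * g by rewrite /g; field; lra.
by rewrite /g; field; rewrite gt_eqF//; lra.
Qed.

(** * The increment form *)

Section sigma_finite_product.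
Context d1 d2 (T1 : measurableType d1) (T2 : measurableType d2) (R : realType).
Variables (m1 : {sigma_finite_measure set T1 -> \bar R})
          (m2 : {sigma_finite_measure set T2 -> \bar R}).

(** A copy of the product measure that carries its sigma-finite structure, so
    that products can be iterated. *)
Definition sfprod : set (T1 * T2) -> \bar R := (m1 \x m2)%E.

HB.instance Definition _ := Measure.on sfprod.

Let sfprod_sigma_finite : sigma_finite setT sfprod.
Proof.
have /sigma_finiteP[F [TF ndF Foo]] := sigma_finiteT m1.
have /sigma_finiteP[G [TG ndG Goo]] := sigma_finiteT m2.
exists (fun n => F n `*` G n).
  rewrite -setXTT TF TG predeqE => -[x y]; split.
    move=> [/= [n _ Fnx] [k _ Gky]]; exists (maxn n k) => //; split.
    - by move: x Fnx; exact/subsetPset/ndF/leq_maxl.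
    - by move: y Gky; exact/subsetPset/ndG/leq_maxr.
  by move=> [n _ []/= ? ?]; split; exists n.
move=> k; have [? ?] := Foo k; have [? ?] := Goo k.
split; first exact: measurableX.
by rewrite /sfprod product_measure1E// lte_mul_pinfty// ge0_fin_numE.
Qed.

HB.instance Definition _ := Measure_isSigmaFinite.Build _ _ _ sfprod
  sfprod_sigma_finite.

Lemma sfprod_tonelli (f : T1 * T2 -> \bar R) :
  measurable_fun setT f -> (forall z, 0 <= f z)%E ->
  (\int[sfprod]_z f z = \int[m1]_x \int[m2]_y f (x, y))%E.
Proof. by move=> mf f0; rewrite -fubini_tonelli1. Qed.

End sigma_finite_product.

Section increment_form.
Context {R : realType}.
Variable rho : R -> R.
Hypothesis mrho : measurable_fun setT rho.
Local Notation mu := (@lebesgue_measure R).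
Local Notation mR := (measurableTypeR R).
Local Notation mu2 := (sfprod mu mu).
Local Notation mu3 := (sfprod mu (sfprod mu mu)).

Definition incr (f : R -> R -> R) (z : mR * (mR * mR)) : R :=
  f z.1 (z.2.2 + rho z.2.1) - f z.1 z.2.2.

Definition incr_form (f : R -> R -> R) : \bar R :=
  (\int[mu3]_z ((incr f z) ^+ 2)%:E)%E.

Definition fun2 (f : R -> R -> R) : mR * mR -> R := fun z => f z.1 z.2.

Lemma measurable_shift2 (r : R -> R) : measurable_fun setT r ->
  measurable_fun setT (fun z : mR * (mR * mR) => (z.1, z.2.2 + r z.2.1) : mR * mR).
Proof.
move=> mr; apply: measurable_fun_pair; first exact: measurable_fst.
apply: measurable_funD.
  exact: (measurableT_comp measurable_snd measurable_snd).
apply: (measurableT_comp mr).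
exact: (measurableT_comp measurable_fst measurable_snd).
Qed.

Lemma measurable_incr f : measurable_fun setT (fun2 f) ->
  measurable_fun setT (incr f).
Proof.
move=> mf; apply: measurable_funB.
  exact: (measurableT_comp mf (measurable_shift2 mrho)).
have H := measurableT_comp mf (measurable_shift2 (measurable_cst (0 : R))).
by apply: eq_measurable_fun H => z _ /=; rewrite /fun2/= addr0.
Qed.

Lemma measurable_incr_sqr f : measurable_fun setT (fun2 f) ->
  measurable_fun setT (fun z => ((incr f z) ^+ 2)%:E).
Proof.
by move=> mf; apply/measurable_EFinP; apply: measurable_funX; exact: measurable_incr.
Qed.

Lemma incr_form_ge0 f : (0 <= incr_form f)%E.
Proof. by apply: integral_ge0 => z _; rewrite lee_fin sqr_ge0. Qed.

Lemma incr_formD f g : measurable_fun setT (fun2 f) -> measurable_fun setT (fun2 g) ->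
  (incr_form (fun s y => (f s y + g s y)%R)
    <= 2%:E * incr_form f + 2%:E * incr_form g)%E.
Proof.
move=> mf mg.
rewrite /incr_form -!ge0_integralZl_EFin//; last 4 first.
- by move=> z _; rewrite lee_fin sqr_ge0.
- exact: measurable_incr_sqr.
- by move=> z _; rewrite lee_fin sqr_ge0.
- exact: measurable_incr_sqr.
rewrite -ge0_integralD//; last 4 first.
- by move=> z _; rewrite mule_ge0// lee_fin sqr_ge0.
- by apply: emeasurable_funM => //; exact: measurable_incr_sqr.
- by move=> z _; rewrite mule_ge0// lee_fin sqr_ge0.
- by apply: emeasurable_funM => //; exact: measurable_incr_sqr.
apply: ge0_le_integral => //.
- by move=> z _; rewrite lee_fin sqr_ge0.
- apply: (measurable_incr_sqr (f := fun s y => f s y + g s y)).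
  exact: measurable_funD.
- by apply: emeasurable_funD; apply: emeasurable_funM => //; exact: measurable_incr_sqr.
- move=> z _; rewrite -!EFinM -EFinD lee_fin.
  apply: le_trans (sqrD_le_dbl _ _).
  by rewrite /incr opprD addrACA.
Qed.

(** For fixed [theta] the map [y |-> y + r theta] preserves the Lebesgue measure,
    so the preimage of a null set is a null set. *)
Lemma ae_shift2 (r : R -> R) (A : mR * mR -> Prop) : measurable_fun setT r ->
  {ae mu2, forall z, A z} ->
  {ae mu3, forall z : mR * (mR * mR), A (z.1, z.2.2 + r z.2.1)}.
Proof.
move=> mr [N [mN N0 AN]].
pose phi := (fun z : mR * (mR * mR) => (z.1, z.2.2 + r z.2.1) : mR * mR).
have mphi : measurable_fun setT phi by exact: measurable_shift2.
exists (phi @^-1` N); split.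
- by rewrite -[X in measurable X]setTI; exact: mphi.
- have mI : measurable_fun setT (fun z : mR * mR => (\1_N z)%:E : \bar R).
    by apply/measurable_EFinP; exact: measurable_indic.
  have mIp : measurable_fun setT (fun z => (\1_N (phi z))%:E : \bar R).
    exact: (measurableT_comp mI mphi).
  have -> : mu3 (phi @^-1` N) = (\int[mu3]_z (\1_N (phi z))%:E)%E.
    rewrite -[phi @^-1` N]setIT -integral_indic//.
    by rewrite -[X in measurable X]setTI; exact: mphi.
  rewrite sfprod_tonelli//.
  have I0 (z : mR * mR) : (0 <= (\1_N z)%:E :> \bar R)%E by rewrite lee_fin.
  have mfub := measurable_fun_fubini_tonelli_F (m2 := mu) _ mI I0.
  have N0' : (\int[mu]_s \int[mu]_y (\1_N (s, y))%:E = 0)%E.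
    by rewrite -(sfprod_tonelli mu mu mI I0) integral_indic// setIT.
  rewrite (eq_integral (fun s => \int[mu]_th (\int[mu]_y (\1_N (s, y))%:E))%E); last first.
    move=> s _.
    rewrite (sfprod_tonelli mu mu (f := fun z => (\1_N (phi (s, z)))%:E)).
    - apply: eq_integral => th _.
      rewrite -(ge0_integral_shift (r th) (f := fun y => (\1_N (s, y))%:E))//.
      exact: (measurableT_comp mI (pair1_measurable s)).
    - exact: (measurableT_comp mIp (pair1_measurable s)).
    - by move=> z; rewrite lee_fin.
  have := fubini_tonelli (m1 := mu) (m2 := mu)
     (fun z => \int[mu]_y (\1_N (z.1, y))%:E)%E.
  move=> /= ->.
  - by rewrite N0' integral0.
  - exact: (measurableT_comp mfub measurable_fst).
  - by move=> z; exact: integral_ge0.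
- by move=> z /= nA; exact: AN.
Qed.

(** Lower semicontinuity: for almost every [(s, theta, y)] both endpoints of the
    increment lie in the set of convergence. *)
Lemma incr_form_fatou (F : nat -> R -> R -> R) f (B : \bar R) :
  (forall q, measurable_fun setT (fun2 (F q))) -> measurable_fun setT (fun2 f) ->
  {ae mu2, forall z, F q z.1 z.2 @[q --> \oo] --> f z.1 z.2} ->
  (\forall q \near \oo, incr_form (F q) <= B)%E -> (incr_form f <= B)%E.
Proof.
move=> mF mf cF HB; apply: ae_fatou_le HB.
- by move=> q; exact: measurable_incr_sqr.
- by move=> q z; rewrite lee_fin sqr_ge0.
- exact: measurable_incr_sqr.
- by move=> z; rewrite lee_fin sqr_ge0.
have c1 := ae_shift2 mrho cF.
have c2 := ae_shift2 (measurable_cst (0 : R)) cF.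
move: c1 c2; apply: filterS2 => z /= z1; rewrite addr0 => z2.
apply: cvg_EFin; first exact: nearW.
have cB : incr (F q) z @[q --> \oo] --> incr f z by exact: cvgB.
exact: (cvgM cB cB).
Qed.

Lemma incr_form_tensor (psi g : R -> R) : measurable_fun setT psi -> measurable_fun setT g ->
  (incr_form (fun s y => (psi s * g y)%R)
   = (\int[mu]_s ((psi s) ^+ 2)%:E) *
     (\int[mu]_th \int[mu]_y ((g (y + rho th)%R - g y) ^+ 2)%:E))%E.
Proof.
move=> mpsi mg.
have mtens : measurable_fun setT (fun2 (fun s y => psi s * g y)).
  apply: measurable_funM; first exact: (measurableT_comp mpsi measurable_fst).
  exact: (measurableT_comp mg measurable_snd).
have mG : measurable_fun setT (fun z : mR * mR => ((g (z.2 + rho z.1) - g z.2) ^+ 2)%:E).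
  apply/measurable_EFinP; apply: measurable_funX; apply: measurable_funB.
    apply: (measurableT_comp mg); apply: measurable_funD; first exact: measurable_snd.
    exact: (measurableT_comp mrho measurable_fst).
  exact: (measurableT_comp mg measurable_snd).
rewrite /incr_form sfprod_tonelli//; last 2 first.
- exact: measurable_incr_sqr.
- by move=> z; rewrite lee_fin sqr_ge0.
rewrite -(sfprod_tonelli mu mu mG); last by move=> z; rewrite lee_fin sqr_ge0.
rewrite -ge0_integralZr//.
- apply: eq_integral => s _; rewrite /fubini_F/= -ge0_integralZl_EFin//.
  + by apply: eq_integral => z _; rewrite /incr/= -mulrBr exprMn.
  + by move=> z _; rewrite lee_fin sqr_ge0.
  + exact: sqr_ge0.
- by apply/measurable_EFinP; exact: measurable_funX.
- by move=> z _; rewrite lee_fin sqr_ge0.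
- by apply: integral_ge0 => z _; rewrite lee_fin sqr_ge0.
Qed.

Definition itvind (a b : R) : R -> R := fun y => \1_`]a, b]%classic y.

Lemma measurable_itvind a b : measurable_fun setT (itvind a b).
Proof. exact: measurable_indic. Qed.

Lemma itvindE a b y : itvind a b y = ((a < y) && (y <= b))%:R.
Proof. by rewrite /itvind indicE mem_setE in_itv. Qed.

Lemma integral_itvind a b : a <= b -> (\int[mu]_y (itvind a b y)%:E = (b - a)%:E)%E.
Proof.
move=> ab; rewrite integral_indic// setIT.
suff E : mu (`]a, b]%classic : set mR) = (b - a)%:E by exact: E.
rewrite lebesgue_measure_itv/= lte_fin; case: ltP => [//|ba]; congr EFin.
by have -> : a = b; [apply/eqP; rewrite eq_le ab ba|rewrite subrr].
Qed.

Lemma itvind_sqr a b y : itvind a b y ^+ 2 = itvind a b y.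
Proof. by rewrite itvindE; case: (_ && _); rewrite ?expr1n ?expr0n. Qed.

(** The increment is nonzero on two intervals, of lengths [Num.min r (b - a)]
    each. *)
Lemma itvind_sqr_incr (a b r y : R) : a <= b -> 0 <= r ->
  (itvind a b (y + r) - itvind a b y) ^+ 2 =
  itvind (a - r) (Num.min a (b - r)) y + itvind (Num.max a (b - r)) b y.
Proof.
move=> ab r0; rewrite !itvindE.
have b01 (u v : bool) : (u%:R - v%:R) ^+ 2 = (u (+) v)%:R :> R.
  by case: u; case: v; rewrite /= ?subrr ?subr0 ?sub0r ?sqrrN ?expr1n ?expr0n.
rewrite b01 -ltrBlDr -lerBrDr; case: (leP a (b - r)) => H.
  have h1 : (a < y) ==> (a - r < y) by apply/implyP; lra.
  have h2 : (y <= b - r) ==> (y <= b) by apply/implyP; lra.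
  have h3 : ~~ (a < y) ==> (y <= b - r) by rewrite -leNgt; apply/implyP; lra.
  rewrite (leNgt y a) (ltNge (b - r) y).
  by move: h1 h2 h3; case: (a < y); case: (a - r < y); case: (y <= b - r);
    case: (y <= b); rewrite /= ?addr0 ?add0r.
have h1 : (a < y) ==> (a - r < y) by apply/implyP; lra.
have h2 : (y <= b - r) ==> (y <= b) by apply/implyP; lra.
have h3 : (y <= b - r) ==> ~~ (a < y) by rewrite -leNgt; apply/implyP; lra.
by move: h1 h2 h3; case: (a < y); case: (a - r < y); case: (y <= b - r);
  case: (y <= b); rewrite /= ?addr0 ?add0r.
Qed.

Hypothesis rho0 : forall x, 0 <= rho x.

Variable H : R.
Hypothesis rhoH : forall l, 0 <= l -> l <= 1 ->
  (\int[mu]_x (2 * Num.min (rho x) l)%:E = (l `^ (2 * H))%:E)%E.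

Lemma incr_itvind a b : a <= b -> b - a <= 1 ->
  (\int[mu]_th \int[mu]_y ((itvind a b (y + rho th)%R - itvind a b y) ^+ 2)%:E
    = ((b - a) `^ (2 * H))%:E)%E.
Proof.
move=> ab ba1; rewrite -rhoH ?subr_ge0//; apply: eq_integral => th _.
under eq_integral do rewrite itvind_sqr_incr// EFinD.
rewrite ge0_integralD//.
- rewrite !integral_itvind -?EFinD.
  + by congr EFin; rewrite minEle maxEle; case: (leP a (b - rho th));
      case: (leP (rho th) (b - a)); rewrite ?minEle /=; lra.
  + by rewrite ge_max ab/=; have := rho0 th; lra.
  + by rewrite le_min; apply/andP; split; have := rho0 th; lra.
- by move=> x _; rewrite lee_fin itvindE.
- by apply/measurable_EFinP; exact: measurable_itvind.
- by move=> x _; rewrite lee_fin itvindE.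
- by apply/measurable_EFinP; exact: measurable_itvind.
Qed.

Lemma measurable_itvind2 (a b c e : R) :
  measurable_fun setT (fun2 (fun s y => itvind a b s * itvind c e y)).
Proof.
apply: measurable_funM.
  exact: (measurableT_comp (measurable_itvind _ _) measurable_fst).
exact: (measurableT_comp (measurable_itvind _ _) measurable_snd).
Qed.

Lemma incr_form_rect (t a b : R) : 0 <= t -> a <= b -> b - a <= 1 ->
  incr_form (fun s y => itvind 0 t s * itvind a b y)
    = (t * (b - a) `^ (2 * H))%:E.
Proof.
move=> t0 ab ba1; rewrite incr_form_tensor; try exact: measurable_itvind.
rewrite incr_itvind//; under eq_integral do rewrite itvind_sqr.
by rewrite integral_itvind// subr0 -EFinM.
Qed.

(** Polarization: [1_]0,x]], [1_]0,y]] and their difference [1_]x,y]] all have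
    known forms, and the product of the time indicators is that of
    [Num.min s t].  The result is the covariance of the fractional sheet. *)
Lemma integral_incr_prod (s t x y : R) : 0 <= s -> 0 <= t ->
  0 <= x <= 1 -> 0 <= y <= 1 ->
  (\int[mu3]_z (incr (fun u v => itvind 0 s u * itvind 0 x v) z *
                incr (fun u v => itvind 0 t u * itvind 0 y v) z)%:E
   = (Num.min s t * ((x `^ (2 * H) + y `^ (2 * H) - `|x - y| `^ (2 * H)) / 2))%:E)%E.
Proof.
move=> s0 t0.
wlog xy : s t s0 t0 x y / x <= y.
  move=> W /andP[x0 x1] /andP[y0 y1]; have [xy|yx] := leP x y.
    by apply: W => //; rewrite ?x0 ?y0.
  under eq_integral do rewrite mulrC.
  rewrite (W t s t0 s0 y x (ltW yx)) ?y0 ?x0// minC distrC.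
  by congr (_ * (_ / 2))%:E; lra.
move=> /andP[x0 x1] /andP[y0 y1].
have x01 : x - 0 <= 1 by lra.
have y01 : y - 0 <= 1 by lra.
have xy1 : y - x <= 1 by lra.
have [m ms] : exists m, m = Num.min s t by exists (Num.min s t).
have m0 : 0 <= m by rewrite ms le_min s0.
pose g a b := fun u v : R => itvind 0 m u * itvind a b v.
have Eprod z : incr (fun u v => itvind 0 s u * itvind 0 x v) z *
    incr (fun u v => itvind 0 t u * itvind 0 y v) z =
    ((incr (g 0 x) z) ^+ 2 + (incr (g 0 y) z) ^+ 2 - (incr (g x y) z) ^+ 2) / 2.
  have split v : itvind x y v = itvind 0 y v - itvind 0 x v.
    rewrite !itvindE; have [|] := ltP x v; have [|] := leP v y;
      have [|] := ltP 0 v; have [|] := leP v x => /=; rewrite ?subr0 ?subrr//; lra.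
  have time u : itvind 0 m u = itvind 0 s u * itvind 0 t u.
    by rewrite !itvindE ms le_min; case: (0 < u) => /=; rewrite ?mulr0//; 
      case: (u <= s); case: (u <= t); rewrite /= ?mulr0 ?mul0r ?mulr1.
  rewrite /incr /g -!mulrBr !exprMn itvind_sqr !split time.
  by field.
have I a b : 0 <= a -> a <= b -> b <= 1 -> mu3.-integrable setT (fun z => ((incr (g a b) z) ^+ 2)%:E).
  move=> a0 ab b1; apply: integrable_of_fin_num.
    by apply: measurable_incr_sqr; exact: measurable_itvind2.
  by rewrite -/(incr_form (g a b)) incr_form_rect//; lra.
under eq_integral do rewrite Eprod.
rewrite (eq_integral (fun z => (2^-1)%:E * (((incr (g 0 x) z) ^+ 2)%:E + ((incr (g 0 y) z) ^+ 2)%:E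
   - ((incr (g x y) z) ^+ 2)%:E))%E); last first.
  by move=> z _; rewrite mulrC.
have I1 := I 0 x (lexx _) x0 x1; have I2 := I 0 y (lexx _) y0 y1.
have I3 := I x y x0 xy y1.
rewrite integralZl//; last by apply: integrableB => //; exact: integrableD.
rewrite integralB//; last exact: integrableD.
rewrite integralD//.
rewrite -![(\int[mu3]_z ((incr (g _ _) z) ^+ 2)%:E)%E]/(incr_form (g _ _)).
have F a b : a <= b -> b - a <= 1 -> incr_form (g a b) = (m * (b - a) `^ (2 * H))%:E.
  exact: incr_form_rect.
rewrite (F 0 x x0 x01) (F 0 y y0 y01) (F x y xy xy1).
rewrite -[LHS]/((2^-1 * (m * (x - 0) `^ (2 * H) + m * (y - 0) `^ (2 * H)
  - m * (y - x) `^ (2 * H)))%:E); congr EFin.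
rewrite distrC.
by rewrite -ms !subr0 ger0_norm ?subr_ge0//; field.
Qed.

End increment_form.

(** * Finite combinations of the sheet *)

Section elementary.
Context {d : measure_display} {Omega : measurableType d} {R : realType}.
Variable P : probability Omega R.
Variables (T : R) (W : R -> R -> Omega -> R).

(** Pairs formed by a combination of indicator functions of the rectangles
    []0, s_i] x ]0, x_i]] and the same combination of the values of the sheet.
    Unlike step functions on a grid, they are stable under addition without
    common refinement. *)
Definition elementary (f : R -> R -> R) (X : Omega -> R) : Prop :=
  exists (I : finType) (c s x : I -> R),
    [/\ forall i, s i \in `[0, T], forall i, x i \in `[0, 1],
      f = (fun u v => \sum_i c i * (itvind 0 (s i) u * itvind 0 (x i) v)) &
      X = (fun w => \sum_i c i * W (s i) (x i) w)].

Lemma elementaryD f g X Y : elementary f X -> elementary g Y ->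
  elementary (fun u v => f u v + g u v) (fun w => X w + Y w).
Proof.
move=> [I [c [s [x [sT x1 -> ->]]]]] [J [c' [s' [x' [s'T x'1 -> ->]]]]].
pose glue (a : I -> R) (b : J -> R) (k : I + J) :=
  match k with inl i => a i | inr j => b j end.
exists (I + J)%type, (glue c c'), (glue s s'), (glue x x'); split.
- by case.
- by case.
- by apply/funext => u; apply/funext => v; rewrite big_sumType.
- by apply/funext => w; rewrite big_sumType.
Qed.

Lemma elementaryZ (k : R) f X : elementary f X ->
  elementary (fun u v => k * f u v) (fun w => k * X w).
Proof.
move=> [I [c [s [x [sT x1 -> ->]]]]].
exists I, (fun i => k * c i), s, x; split => //.
- apply/funext => u; apply/funext => v; rewrite mulr_sumr.
  by apply: eq_bigr => i _; rewrite mulrA.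
- by apply/funext => w; rewrite mulr_sumr; apply: eq_bigr => i _; rewrite mulrA.
Qed.

Lemma elementary_sum (n : nat) (f : nat -> R -> R -> R) (X : nat -> Omega -> R) :
  (forall i, (i < n)%N -> elementary (f i) (X i)) ->
  elementary (fun u v => \sum_(i < n) f i u v) (fun w => \sum_(i < n) X i w).
Proof.
elim: n => [_|n IH H].
  exists void, (fun=> 0), (fun=> 0), (fun=> 0); split; try by case.
  - by apply/funext => u; apply/funext => v; rewrite big_ord0 big1// => -[].
  - by apply/funext => w; rewrite big_ord0 big1// => -[].
have := elementaryD (IH (fun i h => H i (ltnW h))) (H n (leqnn _)).
congr elementary.
- by apply/funext => u; apply/funext => v; rewrite big_ord_recr.
- by apply/funext => w; rewrite big_ord_recr.
Qed.

(** Inclusion-exclusion on the four corners. *)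
Lemma elementary_rect s s' x x' : s \in `[0, T] -> s' \in `[0, T] ->
  x \in `[0, 1] -> x' \in `[0, 1] -> s <= s' -> x <= x' ->
  elementary (fun u v => itvind s s' u * itvind x x' v) (rect_noise W s s' x x').
Proof.
move=> sT s'T x1 x'1 ss' xx'.
have E a b : a \in `[0, T] -> b \in `[0, 1] ->
    elementary (fun u v => itvind 0 a u * itvind 0 b v) (W a b).
  move=> aT b1; exists unit, (fun=> 1), (fun=> a), (fun=> b); split => //.
  - by apply/funext => u; apply/funext => v; rewrite big_const card_unit/= mul1r addr0.
  - by apply/funext => w; rewrite big_const card_unit/= mul1r addr0.
have := elementaryD (elementaryD (E s' x' s'T x'1) (elementaryZ (-1) (E s x' sT x'1)))
  (elementaryD (elementaryZ (-1) (E s' x s'T x1)) (E s x sT x1)).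
congr elementary.
- have split (a b v : R) : 0 <= a -> a <= b -> itvind a b v = itvind 0 b v - itvind 0 a v.
    move=> a0 ab; rewrite !itvindE; have [|] := ltP a v; have [|] := leP v b;
      have [|] := ltP 0 v; have [|] := leP v a => /=; rewrite ?subr0 ?subrr//; lra.
  apply/funext => u; apply/funext => v.
  rewrite (split s s')//; last by move: sT; rewrite in_itv/= => /andP[].
  rewrite (split x x')//; last by move: x1; rewrite in_itv/= => /andP[].
  by ring.
- by apply/funext => w; rewrite /rect_noise; ring.
Qed.

Lemma elementary_step g : step_on T g ->
  elementary (step_eval g) (step_integral W g).
Proof.
move=> [tT xO tlt xlt]; rewrite /step_eval /step_integral.
have := @elementary_sum (tsteps g) (fun i u v => \sum_(j < xsteps g)
    value g i j * (itvind (tgrid g i) (tgrid g i.+1) u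
       * itvind (xgrid g j) (xgrid g j.+1) v))
  (fun i w => \sum_(j < xsteps g) value g i j * rect_noise W (tgrid g i) (tgrid g i.+1)
     (xgrid g j) (xgrid g j.+1) w).
have E : (fun s y => \sum_(i < tsteps g) \sum_(j < xsteps g)
      value g i j * \1_`]tgrid g i, tgrid g i.+1] s * \1_`]xgrid g j, xgrid g j.+1] y) =
    (fun s y => \sum_(i < tsteps g) \sum_(j < xsteps g)
      value g i j * (itvind (tgrid g i) (tgrid g i.+1) s * itvind (xgrid g j) (xgrid g j.+1) y)).
  apply/funext => s; apply/funext => y; apply: eq_bigr => i _; apply: eq_bigr => j _.
  by rewrite mulrA.
rewrite E; apply => i ilt.
apply: (@elementary_sum (xsteps g) (fun j u v => value g i j *
    (itvind (tgrid g i) (tgrid g i.+1) u * itvind (xgrid g j) (xgrid g j.+1) v))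
  (fun j w => value g i j * rect_noise W (tgrid g i) (tgrid g i.+1)
     (xgrid g j) (xgrid g j.+1) w)) => j jlt.
apply: elementaryZ; apply: elementary_rect.
- exact/tT/ltnW.
- exact: tT.
- exact/xO/ltnW.
- exact: xO.
- exact/ltW/tlt.
- exact/ltW/xlt.
Qed.

Lemma measurable_elementary f X : elementary f X -> measurable_fun setT (fun2 f).
Proof.
move=> [I [c [s [x [sT x1 -> _]]]]]; apply: measurable_sum => i.
by apply: measurable_funM => //; exact: measurable_itvind2.
Qed.

Lemma elementary_support f X u v : elementary f X ->
  ~~ ((0 < u <= T) && (0 < v <= 1)) -> f u v = 0.
Proof.
move=> [I [c [s [x [sT x1 -> _]]]]] H; apply: big1 => i _; rewrite !itvindE.
have := sT i; have := x1 i; rewrite !in_itv/= => /andP[_ h1] /andP[_ h2].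
have E1 : (u <= s i) -> u <= T by move=> h; exact: le_trans h2.
have E2 : (v <= x i) -> v <= 1 by move=> h; exact: le_trans h1.
move: H; case: (0 < u); case: (0 < v); rewrite /= ?andbT ?andbF ?mulr0 ?mul0r ?mulr0//.
rewrite negb_and => /orP[] n.
  by rewrite (negbTE (contra E1 n)) mul0r mulr0.
by rewrite (negbTE (contra E2 n)) !mulr0.
Qed.

Variable H : R.
Hypothesis sheet : fractional_sheet P T H W.

Lemma elementary_gaussian f X : elementary f X -> centered_gaussian P X.
Proof.
move=> [I [c [s [x [sT x1 _ ->]]]]].
have := sheet.1 #|I| (fun k => c (enum_val k)) (fun k => s (enum_val k))
  (fun k => x (enum_val k)) (fun k => sT _) (fun k => x1 _).
congr (centered_gaussian P); apply/funext => w.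
by rewrite [RHS](reindex (@enum_val I I))//; apply: onW_bij; exact: enum_val_bij.
Qed.

Lemma measurable_elementary_noise f X : elementary f X -> measurable_fun setT X.
Proof. by move=> /elementary_gaussian[]. Qed.

Variable rho : R -> R.
Hypothesis mrho : measurable_fun setT rho.
Hypothesis rho0 : forall x, 0 <= rho x.
Hypothesis rhoH : forall l, 0 <= l -> l <= 1 ->
  (\int[@lebesgue_measure R]_x (2 * Num.min (rho x) l)%:E = (l `^ (2 * H))%:E)%E.

(** Both sides are quadratic in the coefficients, with the same Gram matrix by
    [integral_incr_prod]. *)
Lemma elementary_isometry f X : elementary f X ->
  (\int[P]_w ((X w) ^+ 2)%:E = incr_form rho f)%E.
Proof.
move=> eX; have [I [c [s [x [sT x1 fE XE]]]]] := eX; rewrite fE XE /incr_form.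
pose G i j := Num.min (s i) (s j) *
   ((x i `^ (2 * H) + x j `^ (2 * H) - `|x i - x j| `^ (2 * H)) / 2).
rewrite (@integral_sqr_sum _ _ _ _ I _ c G); last 2 first.
- move=> i.
  have := elementary_gaussian (f := fun u v => itvind 0 (s i) u * itvind 0 (x i) v) (X := W (s i) (x i)).
  case=> //; exists unit, (fun=> 1), (fun=> s i), (fun=> x i); split => //.
  + by apply/funext => u; apply/funext => v; rewrite big_const card_unit/= mul1r addr0.
  + by apply/funext => w; rewrite big_const card_unit/= mul1r addr0.
- by move=> i j; have := sheet.2 _ _ _ _ (sT i) (sT j) (x1 i) (x1 j); rewrite unlock.
under [RHS]eq_integral => z _.
  rewrite (_ : incr _ _ _ = \sum_i c i * incr rho (fun u v => itvind 0 (s i) u * itvind 0 (x i) v) z).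
  over.
  by rewrite /incr -sumrB; apply: eq_bigr => i _; rewrite mulrBr.
rewrite (@integral_sqr_sum _ _ _ _ I _ c G)//.
- by move=> i; apply: measurable_incr => //; exact: measurable_itvind2.
- move=> i j; apply: integral_incr_prod => //.
  + by move: (sT i); rewrite in_itv/= => /andP[].
  + by move: (sT j); rewrite in_itv/= => /andP[].
  + by move: (x1 i); rewrite in_itv/=.
  + by move: (x1 j); rewrite in_itv/=.
Qed.

End elementary.

(** * Moments of noise integrals *)

Lemma ae_mono d (T : measurableType d) (R : realType)
    (m : {measure set T -> \bar R}) (A B : T -> Prop) :
  (forall x, A x -> B x) -> {ae m, forall x, A x} -> {ae m, forall x, B x}.
Proof. by move=> AB; apply: filterS. Qed.

Lemma cvg_powR (R : realType) (p : R) (u : nat -> R) (l : R) : 0 < p ->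
  (forall n, 0 <= u n) -> u n @[n --> \oo] --> l ->
  u n `^ p @[n --> \oo] --> l `^ p.
Proof.
move=> p0 u0 ul.
have l0 : 0 <= l.
  by rewrite -(cvg_lim _ ul)//; apply: limr_ge; [exact: cvgP ul|exact: nearW].
have [l_gt0|l_le0] := ltP 0 l.
  have C : {for l, continuous (fun x : R => x `^ p)}.
    apply: differentiable_continuous.
    by apply/derivable1_diffP/derivable_powR; rewrite in_itv/= l_gt0.
  exact: (cvg_comp u (fun x => x `^ p) ul C).
have l00 : l = 0 by apply/eqP; rewrite eq_le l0 l_le0.
rewrite {}l00 in ul *; rewrite powR0 ?gt_eqF//; apply/cvgrPdist_le => e e0.
have e'0 : 0 < e `^ p^-1 by rewrite powR_gt0.
move/cvgrPdist_le : ul => /(_ _ e'0); apply: filterS => n.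
rewrite !sub0r !normrN !ger0_norm ?powR_ge0// => un.
have -> : e = (e `^ p^-1) `^ p by rewrite -powRrM mulVf ?gt_eqF// powRr1// ltW.
by apply: ge0_ler_powR; rewrite ?nnegrE ?(ltW p0) ?(ltW e'0).
Qed.

Lemma integral2_mkcond (R : realType) (D1 D2 : set (measurableTypeR R)) (h : R -> R -> R) :
  (\int[lebesgue_measure]_(s in D1) \int[lebesgue_measure]_(y in D2) (h s y)%:E
   = \int[lebesgue_measure]_s \int[lebesgue_measure]_y (\1_D1 s * \1_D2 y * h s y)%:E)%E.
Proof.
rewrite [LHS]integral_mkcond; apply: eq_integral => s _.
rewrite patchE; case: ifPn => sD.
  rewrite [LHS]integral_mkcond; apply: eq_integral => y _.
  rewrite patchE !indicE sD; case: ifPn => yD; first by rewrite !mul1r.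
  by rewrite mulr0 mul0r.
rewrite (eq_integral (fun=> 0%E)) ?integral0// => y _.
by rewrite !indicE (negbTE sD) !mul0r.
Qed.

Lemma cvg_sqr0 (R : realType) (u : nat -> R) (l : R) :
  ((u n - l) ^+ 2)%:E @[n --> \oo] --> (0 : \bar R)%E -> u n @[n --> \oo] --> l.
Proof.
move=> /cvge0P H; apply/cvgrPdist_le => e e0.
have := H _ (e ^+ 2); rewrite exprn_gt0// => /(_ _ isT).
case=> [n|N _ NH]; first by rewrite lee_fin sqr_ge0.
exists N => // n /= /NH; rewrite /= lee_fin distrC => h.
by rewrite -(ler_pXn2r (n := 2)) ?nnegrE ?(ltW e0)// real_normK ?num_real.
Qed.

Lemma ae_snd_neq (R : realType) (a : R) :
  {ae sfprod (@lebesgue_measure R) (@lebesgue_measure R),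
    forall z : measurableTypeR R * measurableTypeR R, z.2 != a}.
Proof.
pose N : set (measurableTypeR R * measurableTypeR R) := setT `*` [set a].
have m1 : measurable ([set a] : set (measurableTypeR R)) by exact: measurable_set1.
have mN : measurable N by exact: measurableX.
exists N; split => //.
- rewrite /sfprod /N product_measure1E//.
  suff E : lebesgue_measure ([set a] : set (measurableTypeR R)) = 0%E.
    by rewrite [X in (_ * X)%E]E mule0.
  exact: lebesgue_measure_set1.
- by move=> [u v] /= /negP; rewrite negbK => /eqP ->.
Qed.

Section noise_moment.
Context {d : measure_display} {Omega : measurableType d} {R : realType}.
Variable P : probability Omega R.
Variables (T H p K : R) (W : R -> R -> Omega -> R).
Hypothesis p0 : 0 < p.
Hypothesis sheet : fractional_sheet P T H W.
Variable rho : R -> R.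
Hypothesis mrho : measurable_fun setT rho.
Hypothesis rho0 : forall x, 0 <= rho x.
Hypothesis rhoH : forall l, 0 <= l -> l <= 1 ->
  (\int[@lebesgue_measure R]_x (2 * Num.min (rho x) l)%:E = (l `^ (2 * H))%:E)%E.
Hypothesis gaussK : forall (X : Omega -> R) (v : R), centered_gaussian P X ->
    (\int[P]_w ((X w) ^+ 2)%:E <= v%:E)%E ->
    (\int[P]_w (`|X w| `^ p)%:E <= (K * v `^ (p / 2))%:E)%E.
Local Notation mu := (@lebesgue_measure R).
Local Notation mR := (measurableTypeR R).
Local Notation elementary := (elementary T W).

(** Outside of the domain the step functions vanish, except on the line of
    ordinate 1, which belongs to the half-open cells but is a null set. *)
Lemma noise_integral_ae (f fbar : R -> R -> R) (g : nat -> step_fun) :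
  (forall q, step_on T (g q)) ->
  measurable_fun setT (fun2 fbar) ->
  (forall u v, u \in `[0, T] -> v \in `]0, 1[ -> fbar u v = f u v) ->
  (forall u v, ~~ ((u \in `[0, T]) && (v \in `]0, 1[)) -> fbar u v = 0) ->
  (\int[mu]_(s in Itime T) \int[mu]_(y in Ospace)
      ((step_eval (g q) s y - f s y) ^+ 2)%:E @[q --> \oo] --> 0)%E ->
  exists phi : nat -> nat, (forall q, (q <= phi q)%N) /\
   {ae sfprod mu mu, forall z, step_eval (g (phi q)) z.1 z.2 @[q --> \oo] --> fbar z.1 z.2}.
Proof.
move=> gT mfbar fin fout cg.
pose D (z : mR * mR) : R := \1_(Itime T : set mR) z.1 * \1_(Ospace : set mR) z.2.
have mD : measurable_fun setT D.
  apply: measurable_funM.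
    apply: (measurableT_comp _ measurable_fst).
    by apply: measurable_indic; exact: measurable_itv.
  apply: (measurableT_comp _ measurable_snd).
  by apply: measurable_indic; exact: measurable_itv.
have mg q : measurable_fun setT (fun2 (step_eval (g q))).
  exact: (measurable_elementary (W := W) (elementary_step _ (gT q))).
pose F q (z : mR * mR) : \bar R := (D z * (step_eval (g q) z.1 z.2 - fbar z.1 z.2) ^+ 2)%:E.
have mF q : measurable_fun setT (F q).
  apply/measurable_EFinP; apply: measurable_funM => //; apply: measurable_funX.
  exact: (measurable_funB (mg q) mfbar).
have D0 z : 0 <= D z by rewrite mulr_ge0.
have F0 q z : (0 <= F q z)%E by rewrite lee_fin mulr_ge0 ?sqr_ge0.
have Fint q : (\int[sfprod mu mu]_z F q z = \int[mu]_(s in Itime T) \int[mu]_(y in Ospace)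
      ((step_eval (g q) s y - f s y) ^+ 2)%:E)%E.
  rewrite integral2_mkcond (sfprod_tonelli _ _ (mF q) (F0 q)).
  apply: eq_integral => s _; apply: eq_integral => y _.
  rewrite /F /D/= !indicE; congr EFin.
  have [sT|] := boolP (s \in _); last by rewrite !mul0r.
  have [yO|] := boolP (y \in _); last by rewrite !mulr0 !mul0r.
  by rewrite fin//; move: sT yO; rewrite !inE.
have [|phi [phi_ge aeF]] := ae_cvg0_subseq (m := sfprod mu mu) mF F0.
  by under eq_cvg do rewrite Fint.
exists phi; split => //.
move: aeF (@ae_snd_neq R 1); apply: filterS2 => z cF z1.
have [/andP[zT zO]|zout] := boolP ((z.1 \in `[0, T]) && (z.2 \in `]0, 1[)).
  apply: cvg_sqr0; apply: cvg_trans cF; apply: near_eq_cvg.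
  near=> q; rewrite /F /D !indicE.
  by rewrite !mem_set//= !mul1r.
have gz q : step_eval (g (phi q)) z.1 z.2 = 0.
  apply: (elementary_support (elementary_step W (gT (phi q)))).
  apply: contra zout; rewrite !in_itv/= => /andP[/andP[a1 ->] /andP[-> a2]].
  by rewrite (ltW a1)/= lt_neqAle z1.
rewrite fout//; apply: cvg_near_cst; near=> q; exact: gz.
Unshelve. all: by end_near. Qed.

(** The step functions [g q] are Cauchy for the isometric form.  By lower
    semicontinuity along an almost everywhere convergent subsequence,
    [g q] is close to [fbar] in this form, hence the variance of
    [step_integral (g q) - X0] is eventually at most [v].  This Gaussian variable
    has a [p]-th moment controlled by [v], and Fatou's lemma transfers the bound to
    [Z - X0]. *)
Lemma noise_integral_moment (f fbar f0 : R -> R -> R) (Z X0 : Omega -> R) (v : R) :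
  noise_integral P T W f Z -> elementary f0 X0 ->
  measurable_fun setT (fun2 fbar) ->
  (forall u v, u \in `[0, T] -> v \in `]0, 1[ -> fbar u v = f u v) ->
  (forall u v, ~~ ((u \in `[0, T]) && (v \in `]0, 1[)) -> fbar u v = 0) ->
  (2%:E * incr_form rho (fun s y => (fbar s y - f0 s y)%R) < v%:E)%E ->
  (\int[P]_w (`|Z w - X0 w| `^ p)%:E <= (K * v `^ (p / 2))%:E)%E.
Proof.
move=> [_ mZ [g [gT cg cI]]] eX0 mfbar fin fout Hv.
have [phi [phi_ge aeg]] := noise_integral_ae gT mfbar fin fout cg.
pose G q := step_eval (g q); pose I q := step_integral W (g q).
have eG q : elementary (G q) (I q) by exact: elementary_step.
have mG q : measurable_fun setT (fun2 (G q)) by exact: (measurable_elementary (eG q)).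
have mI q : measurable_fun setT (I q) by exact: (measurable_elementary_noise sheet (eG q)).
have mf0 := measurable_elementary eX0.
have mX0 := measurable_elementary_noise sheet eX0.
have m2 (X : Omega -> R) : measurable_fun setT X -> measurable_fun setT (fun w => ((X w) ^+ 2)%:E).
  by move=> mX; apply/measurable_EFinP; exact: measurable_funX.
have eB f1 f2 X1 X2 : elementary f1 X1 -> elementary f2 X2 ->
    elementary (fun s y => f1 s y - f2 s y) (fun w => X1 w - X2 w).
  move=> e1 e2; have := elementaryD e1 (elementaryZ (-1) e2).
  by congr elementary; [apply/funext => a; apply/funext => b|apply/funext => a]; rewrite mulN1r.
have cI' : (\int[P]_w ((I q w - Z w) ^+ 2)%:E @[q --> \oo] --> 0)%E.
  by move: cI; rewrite unlock.
have ISq q : measurable_fun setT (fun w => ((I q w - Z w) ^+ 2)%:E).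
  by apply: m2; exact: measurable_funB.
(* Cauchy property, read on the integrals through the isometry. *)
have Cau (e : R) : 0 < e -> exists N, forall q r, (N <= q)%N -> (N <= r)%N ->
    (incr_form rho (fun s y => (G q s y - G r s y)%R) <= e%:E)%E.
  move=> e0.
  have I0 q : (0 <= \int[P]_w ((I q w - Z w) ^+ 2)%:E)%E.
    by apply: integral_ge0 => w _; rewrite lee_fin sqr_ge0.
  have [N _ NH] := (cvge0P I0).1 cI' (e / 4) (divr_gt0 e0 (ltr0n _ 4)).
  exists N => q r Nq Nr.
  rewrite -(elementary_isometry sheet mrho rho0 rhoH (eB _ _ _ _ (eG q) (eG r))).
  apply: (@le_trans _ _ (\int[P]_w (2%:E * ((I q w - Z w) ^+ 2)%:E + 2%:E * ((I r w - Z w) ^+ 2)%:E))%E).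
    apply: ge0_le_integral => //.
    - by move=> w _; rewrite lee_fin sqr_ge0.
    - by apply: m2; exact: measurable_funB.
    - by apply: emeasurable_funD; apply: emeasurable_funM.
    - move=> w _; rewrite -!EFinM -EFinD lee_fin.
      apply: le_trans (le_trans _ (sqrD_le_dbl (I q w - Z w) (- (I r w - Z w)))) _.
      + by rewrite opprB addrA subrK.
      + by rewrite sqrrN.
  rewrite ge0_integralD//; last 4 first.
  - by move=> w _; rewrite mule_ge0// lee_fin sqr_ge0.
  - exact: emeasurable_funM.
  - by move=> w _; rewrite mule_ge0// lee_fin sqr_ge0.
  - exact: emeasurable_funM.
  rewrite !ge0_integralZl_EFin//; try by (move=> w _; rewrite lee_fin sqr_ge0).
  apply: (@le_trans _ _ (2%:E * (e / 4)%:E + 2%:E * (e / 4)%:E)%E).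
    by apply: leeD; apply: lee_wpmul2l => //; [exact: NH|exact: NH].
  by rewrite -!EFinM -EFinD lee_fin; lra.
(* The strict inequality leaves room for the error [e] of the approximation. *)
have [e e0 ev] : exists2 e : R, 0 < e &
    (2%:E * e%:E + 2%:E * incr_form rho (fun s y => (fbar s y - f0 s y)%R) <= v%:E)%E.
  have A0 := incr_form_ge0 rho (fun s y => (fbar s y - f0 s y)%R).
  move: A0 Hv; set A := incr_form _ _; case: A => [a||] A0 Hv //.
  - move: Hv; rewrite -EFinM lte_fin => av.
    exists ((v - 2 * a) / 2); first by rewrite divr_gt0// subr_gt0.
    by rewrite -EFinM -EFinD lee_fin mulrC divfK// subrK.
  - by move: Hv; rewrite gt0_muley ?lte_fin// ltNge leey.
have [N NH] := Cau e e0.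
have bound q : (N <= q)%N ->
   (\int[P]_w (`|I q w - X0 w| `^ p)%:E <= (K * v `^ (p / 2))%:E)%E.
  move=> Nq; have eq0 := eB _ _ _ _ (eG q) eX0.
  apply: gaussK; first exact: (elementary_gaussian sheet eq0).
  rewrite (elementary_isometry sheet mrho rho0 rhoH eq0); apply: le_trans ev.
  have -> : (fun s y => G q s y - f0 s y) =
     (fun s y => (G q s y - fbar s y) + (fbar s y - f0 s y)).
    by apply/funext => s; apply/funext => y; rewrite addrA subrK.
  apply: le_trans (incr_formD mrho _ _) _.
  - exact: (measurable_funB (mG q) mfbar).
  - exact: (measurable_funB mfbar mf0).
  apply: leeD => //; apply: lee_wpmul2l => //.
  apply: (incr_form_fatou mrho (F := fun r s y => G q s y - G (phi r) s y)).
  - by move=> r; exact: (measurable_funB (mG q) (mG (phi r))).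
  - exact: (measurable_funB (mG q) mfbar).
  - by move: aeg; apply: ae_mono => z cz; apply: cvgB; [exact: cvg_cst|].
  - exists N => // r /= Nr; exact: (NH _ _ Nq (leq_trans Nr (phi_ge r))).
have [|psi [psi_ge aeI]] := ae_cvg0_subseq (m := P) ISq _ cI'.
  by move=> q w; rewrite lee_fin sqr_ge0.
have mp (X : Omega -> R) : measurable_fun setT X -> measurable_fun setT (fun w => (`|X w| `^ p)%:E).
  move=> mX; apply/measurable_EFinP; apply: (measurableT_comp (measurable_powR p)).
  exact: measurableT_comp.
apply: (ae_fatou_le (m := P) (F := fun q w => (`|I (psi q) w - X0 w| `^ p)%:E)).
- by move=> q; apply: mp; exact: measurable_funB.
- by move=> q w; rewrite lee_fin powR_ge0.
- by apply: mp; exact: measurable_funB.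
- by move=> w; rewrite lee_fin powR_ge0.
- move: aeI; apply: ae_mono => w cw.
  apply: cvg_EFin; first exact: nearW.
  have c1 : `|I (psi q) w - X0 w| @[q --> \oo] --> `|Z w - X0 w|.
    by apply: cvg_norm; apply: cvgB; [exact: cvg_sqr0|exact: cvg_cst].
  by apply: cvg_powR => // q; exact: normr_ge0.
- apply: filterS (nbhs_infty_ge N) => q Nq; exact: bound (leq_trans Nq (psi_ge q)).
Qed.

End noise_moment.

(** * Sums over the modes *)

(** The two arguments of [Num.min] cross at [a = 1 / x].  The increments of
    [Psi a = a x^2 / (1 + a x)], which stays below [x], dominate a quarter of the
    terms on both sides of the crossing. *)
Lemma sum_min_sqr_le (R : realType) (x : R) (N : nat) : 0 < x ->
  \sum_(1 <= a < N) Num.min ((a%:R ^+ 2)^-1) (x ^+ 2) <= 4 * x.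
Proof.
move=> x0.
pose Psi (a : nat) : R := a%:R * x ^+ 2 / (1 + a%:R * x).
have ax0 (a : nat) : 0 < 1 + a%:R * x by rewrite ltr_pwDl// mulr_ge0// ltW.
have S M : \sum_(1 <= a < M.+1) Num.min ((a%:R ^+ 2)^-1) (x ^+ 2) <= 4 * Psi M.
  elim: M => [|M IH]; first by rewrite big_geq// /Psi !mul0r mulr0.
  rewrite big_nat_recr//=; apply: (le_trans (lerD IH (lexx _))).
  rewrite -lerBrDl -mulrBr.
  have -> : Psi M.+1 - Psi M = x ^+ 2 / ((1 + M.+1%:R * x) * (1 + M%:R * x)).
    rewrite /Psi -natr1; have := ax0 M; have := ax0 M.+1; rewrite -natr1 => h1 h2.
    by field; rewrite !gt_eqF.
  have h : 4 * (x ^+ 2 / (1 + M.+1%:R * x) ^+ 2) <=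
      4 * (x ^+ 2 / ((1 + M.+1%:R * x) * (1 + M%:R * x))).
    rewrite ler_wpM2l// ler_wpM2l ?sqr_ge0// expr2.
    rewrite lef_pV2 ?posrE ?mulr_gt0// ler_pM2l// lerD2l ler_wpM2r ?(ltW x0)//.
    by rewrite ler_nat.
  apply: le_trans h; rewrite ge_min.
  have M0 : (0 : R) < M.+1%:R by rewrite ltr0n.
  set y : R := M.+1%:R * x; have y0 : 0 < y by rewrite mulr_gt0.
  have [y1|y1] := leP y 1; apply/orP; [right|left].
    rewrite mulrA ler_pdivlMr ?exprn_gt0//; last by rewrite addr_gt0.
    rewrite mulrC ler_wpM2r ?sqr_ge0// expr2.
    by have : (1 + y) * (1 + y) <= 2 * 2; [apply: ler_pM; lra|lra].
  have -> : x = y / M.+1%:R by rewrite /y mulrAC mulfV ?mul1r// gt_eqF.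
  rewrite expr_div_n.
  have -> : 4 * (y ^+ 2 / M.+1%:R ^+ 2 / (1 + y) ^+ 2) =
    (M.+1%:R ^+ 2)^-1 * (4 * y ^+ 2 / (1 + y) ^+ 2) by ring.
  rewrite ler_peMr ?invr_ge0 ?sqr_ge0// ler_pdivlMr ?exprn_gt0 ?addr_gt0// mul1r.
  by rewrite !expr2; have : (1 + y) * (1 + y) <= (2 * y) * (2 * y); [apply: ler_pM; lra|lra].
case: N => [|N]; first by rewrite big_geq// mulr_ge0// ltW.
apply: (le_trans (S N)); rewrite ler_wpM2l//.
rewrite /Psi ler_pdivrMr// mulrDr mulr1.
by rewrite (_ : x * (N%:R * x) = N%:R * x ^+ 2) ?lerDr ?ltW//; ring.
Qed.

Lemma sum_inv_sqr_tail (R : realType) (M N : nat) : (0 < M)%N ->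
  \sum_(M.+1 <= a < N) (a%:R ^+ 2 : R)^-1 <= M%:R^-1.
Proof.
move=> M0.
have [NM|MN] := leqP N M.+1; first by rewrite big_geq.
have S k : \sum_(M.+1 <= a < M.+1 + k) (a%:R ^+ 2 : R)^-1 <= M%:R^-1 - (M + k)%:R^-1.
  elim: k => [|k IH]; first by rewrite addn0 big_geq// addn0 subrr.
  rewrite addnS big_nat_recr ?leq_addr//= addSn; apply: (le_trans (lerD IH (lexx _))).
  have u0 : (0 : R) < (M + k)%:R by rewrite ltr0n addn_gt0 M0.
  rewrite addnS -natr1; set u : R := (M + k)%:R in u0 *; clearbody u.
  rewrite -addrA lerD2l -subr_ge0.
  have -> : - (u + 1)^-1 - (- u^-1 + (u + 1) ^- 2) = u^-1 / (u + 1) ^+ 2.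
    have u1 : u + 1 != 0 by rewrite gt_eqF// addr_gt0.
    by field; rewrite u1 gt_eqF.
  by rewrite divr_ge0 ?invr_ge0 ?sqr_ge0// ltW.
have := S (N - M.+1)%N; rewrite subnKC 1?ltnW// => h; apply: le_trans h _.
by rewrite gerBl invr_ge0.
Qed.

(** Concavity of the logarithm and the bound [1 + z <= expR z]. *)
Lemma powR_decrement (R : realType) (c x : R) : 0 < c -> 1 < x ->
  c * x `^ (- 1 - c) <= (x - 1) `^ (- c) - x `^ (- c).
Proof.
move=> c0 x1; have x0 : 0 < x by lra.
have E : (x - 1) `^ (- c) = x `^ (- c) * (1 - x^-1) `^ (- c).
  rewrite -powRM ?(ltW x0) ?subr_ge0 ?invf_le1 ?(ltW x1)//.
  by congr (_ `^ _); field; rewrite gt_eqF.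
rewrite E -{2}[x `^ (- c)]mulr1 -mulrBr.
rewrite powRD; last by rewrite (gt_eqF x0) implybT.
rewrite powR_inv1 ?(ltW x0)// [x^-1 * _]mulrC mulrCA ler_wpM2l ?powR_ge0//.
rewrite lerBrDl /powR subr_eq0 eq_sym invr_eq1 (gt_eqF x1).
apply: le_trans (expR_ge1Dx _); rewrite lerD2l mulNr -mulrN ler_wpM2l ?(ltW c0)//.
rewrite lerNr; apply: le_ln1Dx.
by rewrite ltrN2 invf_lt1.
Qed.

(** The terms with [a <= n] are all equal to [n^(-1-c)] and sum up to at most
    [n^(-c)]; beyond [n] the terms are [a^(-1-c)] and telescope by
    [powR_decrement]. *)
Lemma sum_weight_le (R : realType) (c : R) (n N : nat) : 0 < c -> c <= 1 -> (0 < n)%N ->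
  \sum_(1 <= a < N) ((a%:R ^+ 2)^-1 * (Num.min 1 (a%:R / n%:R)) ^+ 2 *
     (Num.max a%:R n%:R) `^ (1 - c)) <= (1 + c^-1) * n%:R `^ (- c) :> R.
Proof.
move=> c0 c1 n0; have n0' : (0 : R) < n%:R by rewrite ltr0n.
pose Phi (a : nat) : R := if (a <= n)%N then a%:R * n%:R `^ (- 1 - c)
  else n%:R `^ (- c) + c^-1 * (n%:R `^ (- c) - a%:R `^ (- c)).
have nn : n%:R * n%:R `^ (- 1 - c) = n%:R `^ (- c) :> R.
  rewrite powRD; last by rewrite (gt_eqF n0') implybT.
  by rewrite powR_inv1 ?(ltW n0')// mulrA divff ?gt_eqF// mul1r.
have S M : \sum_(1 <= a < M.+1) ((a%:R ^+ 2)^-1 * (Num.min 1 (a%:R / n%:R)) ^+ 2 *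
     (Num.max a%:R n%:R) `^ (1 - c)) <= Phi M.
  elim: M => [|M IH]; first by rewrite big_geq// /Phi leq0n mul0r.
  rewrite big_nat_recr//=; apply: (le_trans (lerD IH (lexx _))).
  have M0 : (0 : R) < M.+1%:R by rewrite ltr0n.
  have [Mn|nM] := leqP M.+1 n.
    have Mn' : M.+1%:R <= n%:R :> R by rewrite ler_nat.
    have dM : M.+1%:R - M%:R = 1 :> R by rewrite -natr1; ring.
    rewrite /Phi Mn (ltnW Mn) -lerBrDl -mulrBl dM mul1r.
    rewrite min_r ?ler_pdivrMr ?mul1r// max_r// expr_div_n mulrA mulVf ?expf_neq0 ?gt_eqF// mul1r.
    rewrite -powR_mulrn ?(ltW n0')// -powRN -powRD; last by rewrite (gt_eqF n0') implybT.
    by rewrite (_ : - 2%:R + (1 - c) = - 1 - c)//; ring.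
  have nM' : n%:R <= M.+1%:R :> R by rewrite ler_nat ltnW.
  rewrite min_l ?ler_pdivlMr ?mul1r// expr1n mulr1 max_l//.
  rewrite -powR_mulrn ?(ltW M0)// -powRN -powRD; last by rewrite (gt_eqF M0) implybT.
  rewrite (_ : - 2%:R + (1 - c) = - 1 - c); last by ring.
  have M1 : (1 : R) < M.+1%:R by rewrite ltr1n ltnS (leq_trans n0)// -ltnS.
  have := powR_decrement c0 M1; rewrite -[in M.+1%:R - 1]natr1 addrK => D.
  have {}D : M.+1%:R `^ (- 1 - c) <= c^-1 * (M%:R `^ (- c) - M.+1%:R `^ (- c)).
    by rewrite ler_pdivlMl.
  apply: (le_trans (lerD (lexx _) D)); rewrite {2}/Phi leqNgt nM/=.
  have -> : Phi M = n%:R `^ (- c) + c^-1 * (n%:R `^ (- c) - M%:R `^ (- c)).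
    rewrite /Phi; case: leqP => // Mn.
    have -> : M = n by apply/eqP; rewrite eqn_leq Mn.
    by rewrite nn subrr mulr0 addr0.
  by rewrite -addrA -mulrDr addrA subrK.
have P0 M : Phi M <= (1 + c^-1) * n%:R `^ (- c).
  rewrite mulrDl mul1r /Phi; case: ifP => Mn.
    apply: (@le_trans _ _ (n%:R `^ (- c))).
      by rewrite -nn ler_wpM2r ?powR_ge0// ler_nat.
    by rewrite lerDl mulr_ge0 ?powR_ge0// invr_ge0 ltW.
  by rewrite lerD2l ler_wpM2l ?invr_ge0 ?(ltW c0)// gerBl powR_ge0.
case: N => [|N]; first by rewrite big_geq// mulr_ge0 ?powR_ge0// addr_ge0// invr_ge0 ltW.
exact: le_trans (S N) (P0 N).
Qed.

Lemma sin_lipschitz (R : realType) (x y : R) : `|sin x - sin y| <= `|x - y|.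
Proof.
wlog xy : x y / x <= y.
  by move=> W; have [/W//|/ltW/W] := leP x y; rewrite distrC [`|y - x|]distrC.
have [|c _ E] := @MVT_segment R sin cos x y xy.
  by apply: continuous_subspaceT; exact: continuous_sin.
rewrite distrC E normrM distrC ler_piMl//; exact: cos_max.
Qed.

(** * Cell averages *)

Section cells.
Context {R : realType}.
Local Notation mu := (@lebesgue_measure R).
Local Notation mR := (measurableTypeR R).

Definition cell_avg (k : R) (g : R -> R) (j : nat) : R :=
  k^-1 * \int[mu]_(u in `]j%:R * k, j.+1%:R * k]) g u.

Definition cavg (k : R) (n : nat) (g : R -> R) (y : R) : R :=
  \sum_(j < n) cell_avg k g j * itvind (j%:R * k) (j.+1%:R * k) y.

Lemma in_cell_uniq (k : R) (i j : nat) (y : R) : 0 < k ->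
  j%:R * k < y -> y <= j.+1%:R * k ->
  itvind (i%:R * k) (i.+1%:R * k) y = (i == j)%:R.
Proof.
move=> k0 jy yj; rewrite itvindE; congr (nat_of_bool _)%:R; apply/idP/eqP.
  move=> /andP[iy yi]; apply/eqP; rewrite eqn_leq; apply/andP; split.
    have := lt_le_trans iy yj; rewrite ltr_pM2r// ltr_nat ltnS.
    by [].
  by have := lt_le_trans jy yi; rewrite ltr_pM2r// ltr_nat ltnS.
by move=> ->; rewrite jy yj.
Qed.

Lemma sum_cell (k : R) (n j : nat) (F : nat -> R) (y : R) : 0 < k -> (j < n)%N ->
  j%:R * k < y -> y <= j.+1%:R * k ->
  \sum_(i < n) F i * itvind (i%:R * k) (i.+1%:R * k) y = F j.
Proof.
move=> k0 jn jy yj.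
rewrite (bigD1 (Ordinal jn))//= (in_cell_uniq _ k0 jy yj) eqxx mulr1.
rewrite big1 ?addr0// => i ij.
have ij' : (i == j :> nat) = false by apply: contraNF ij => /eqP e; exact/eqP/val_inj.
by rewrite (in_cell_uniq _ k0 jy yj) ij' mulr0.
Qed.

Lemma cell_exists (k : R) (n : nat) (y : R) : 0 < y -> y <= n%:R * k ->
  exists2 j, (j < n)%N & (j%:R * k < y) && (y <= j.+1%:R * k).
Proof.
move=> y0; elim: n => [|n IH] yn; first by move: yn; rewrite mul0r leNgt y0.
have [yn'|ny] := leP y (n%:R * k).
  by have [j jn H] := IH yn'; exists j => //; exact: ltnW.
by exists n => //; rewrite ny yn.
Qed.

Lemma sum_cell_out (k : R) (n : nat) (F : nat -> R) (y : R) : 0 < k ->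
  ~~ (0 < y <= n%:R * k) -> \sum_(i < n) F i * itvind (i%:R * k) (i.+1%:R * k) y = 0.
Proof.
move=> k0 H; apply: big1 => i _; rewrite itvindE.
suff -> : (i%:R * k < y) && (y <= i.+1%:R * k) = false by rewrite mulr0.
apply: contraNF H => /andP[iy yi]; apply/andP; split.
  by apply: le_lt_trans iy; rewrite mulr_ge0// ltW.
by apply: (le_trans yi); rewrite ler_wpM2r ?(ltW k0)// ler_nat.
Qed.

Lemma cell_measure (k : R) (j : nat) : 0 < k ->
  mu (`]j%:R * k, j.+1%:R * k]%classic : set mR) = k%:E.
Proof.
move=> k0; rewrite lebesgue_measure_itv/= lte_fin ltr_pM2r// ltr_nat leqnn.
by rewrite -EFinB -mulrBl -natr1 addrAC subrr add0r mul1r.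
Qed.

Lemma cell_integral_cst (k a : R) (j : nat) : 0 < k ->
  (\int[mu]_(u in `](j%:R * k)%R, (j.+1%:R * k)%R]) a%:E = (a * k)%:E)%E.
Proof.
move=> k0; rewrite (integral_cst mu _ a%:E)//.
by rewrite [X in (_ * X)%E](cell_measure j k0).
Qed.

Lemma cell_integrable (k : R) (j : nat) (g : R -> R) (M : R) : 0 < k ->
  measurable_fun setT g -> (forall y, `|g y| <= M) ->
  mu.-integrable `]j%:R * k, j.+1%:R * k] (EFin \o g).
Proof.
move=> k0 mg gM; apply: measurable_bounded_integrable => //.
- by rewrite [X in (X < _)%E](cell_measure j k0) ltry.
- exact: measurable_funTS.
- exists M; split; first exact: num_real.
  by move=> x Mx y _; apply: le_trans (gM y) (ltW Mx).
Qed.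

Lemma cell_avg_near (k : R) (j : nat) (g : R -> R) (M c D : R) : 0 < k ->
  measurable_fun setT g -> (forall y, `|g y| <= M) ->
  (forall y, j%:R * k < y -> y <= j.+1%:R * k -> `|g y - c| <= D) ->
  `|cell_avg k g j - c| <= D.
Proof.
move=> k0 mg gM H.
have ig := cell_integrable j k0 mg gM.
have ic a : mu.-integrable `]j%:R * k, j.+1%:R * k] (EFin \o (cst a : R -> R)).
  by apply: (@cell_integrable k j (cst a) `|a|) => //.
have Ic a : \int[mu]_(u in `]j%:R * k, j.+1%:R * k]) (cst a u) = a * k.
  by rewrite /Rintegral (cell_integral_cst _ _ k0).
have up : \int[mu]_(u in `]j%:R * k, j.+1%:R * k]) g u <= (c + D) * k.
  rewrite -[leRHS]Ic; apply: le_Rintegral => //.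
  move=> u; rewrite /= in_itv/= => /andP[ju uj].
  by have := H u ju uj; rewrite ler_norml => /andP[_ ]; rewrite lerBlDl.
have lo : (c - D) * k <= \int[mu]_(u in `]j%:R * k, j.+1%:R * k]) g u.
  rewrite -[leLHS]Ic; apply: le_Rintegral => //.
  move=> u; rewrite /= in_itv/= => /andP[ju uj].
  by have := H u ju uj; rewrite ler_norml => /andP[+ _]; rewrite lerBrDl.
rewrite /cell_avg; set I := \int[mu]_(u in _) _ in up lo *.
have k1 : k^-1 * I * k = I by rewrite mulrAC mulVf ?mul1r// gt_eqF.
rewrite ler_norml -(ler_pM2r k0 (- D)) -(ler_pM2r k0 _ D) !mulrBl k1.
by move: up lo; rewrite mulrDl mulrBl mulNr; lra.
Qed.

Lemma cavg_cell (k : R) (n j : nat) (g : R -> R) (y : R) : 0 < k -> (j < n)%N ->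
  j%:R * k < y -> y <= j.+1%:R * k -> cavg k n g y = cell_avg k g j.
Proof. by move=> k0 jn jy yj; exact: (sum_cell (cell_avg k g) k0 jn jy yj). Qed.

Lemma cavg_out (k : R) (n : nat) (g : R -> R) (y : R) : 0 < k ->
  ~~ (0 < y <= n%:R * k) -> cavg k n g y = 0.
Proof. exact: sum_cell_out. Qed.

Lemma measurable_cavg k n g : measurable_fun setT (cavg k n g).
Proof.
apply: measurable_sum => j; apply: measurable_funM => //.
exact: measurable_itvind.
Qed.

Lemma cavg_bounded (k : R) (n : nat) (g : R -> R) (M : R) (y : R) : 0 < k ->
  measurable_fun setT g -> (forall y, `|g y| <= M) -> `|cavg k n g y| <= M.
Proof.
move=> k0 mg gM.
have M0 : 0 <= M := le_trans (normr_ge0 _) (gM 0).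
have [/andP[y0 yn]|] := boolP (0 < y <= n%:R * k); last first.
  by move=> H; rewrite (cavg_out _ k0 H) normr0.
have [j jn /andP[jy yj]] := cell_exists y0 yn.
rewrite (cavg_cell _ k0 jn jy yj) -[cell_avg _ _ _]subr0.
by apply: (cell_avg_near k0 mg gM) => u _ _; rewrite subr0.
Qed.

Lemma cavg_osc (k : R) (n j : nat) (g : R -> R) (M D y : R) : 0 < k -> (j < n)%N ->
  measurable_fun setT g -> (forall y, `|g y| <= M) ->
  j%:R * k < y -> y <= j.+1%:R * k ->
  (forall u, j%:R * k < u -> u <= j.+1%:R * k -> `|g u - g y| <= D) ->
  `|g y - cavg k n g y| <= D.
Proof.
move=> k0 jn mg gM jy yj H; rewrite (cavg_cell _ k0 jn jy yj) distrC.
exact: (cell_avg_near k0 mg gM).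
Qed.

(** On a cell, the average is the best constant approximation in mean
    square, in particular better than 0. *)
Lemma cavg_sqr_le (k : R) (n j : nat) (g : R -> R) (M : R) : 0 < k -> (j < n)%N ->
  measurable_fun setT g -> (forall y, `|g y| <= M) ->
  (\int[mu]_(y in `](j%:R * k)%R, (j.+1%:R * k)%R]) ((g y - cavg k n g y) ^+ 2)%:E
   <= \int[mu]_(y in `](j%:R * k)%R, (j.+1%:R * k)%R]) ((g y) ^+ 2)%:E)%E.
Proof.
move=> k0 jn mg gM; set a := cell_avg k g j.
have M0 : 0 <= M := le_trans (normr_ge0 _) (gM 0).
rewrite (eq_integral (fun y : mR => ((g y - a) ^+ 2)%:E)); last first.
  move=> y; rewrite inE/= in_itv/= => /andP[jy yj].
  by rewrite (cavg_cell _ k0 jn jy yj).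
have ig := cell_integrable j k0 mg gM.
have mg2 : measurable_fun setT (fun y => g y ^+ 2) by exact: measurable_funX.
have ig2 : mu.-integrable `]j%:R * k, j.+1%:R * k] (EFin \o (fun y => g y ^+ 2)).
  apply: (@cell_integrable k j _ (M ^+ 2)) => // y.
  by rewrite normrX; apply: lerXn2r; rewrite ?nnegrE.
have ic b : mu.-integrable `]j%:R * k, j.+1%:R * k] (EFin \o (cst b : R -> R)).
  by apply: (@cell_integrable k j (cst b) `|b|) => //.
have Ia : \int[mu]_(u in `]j%:R * k, j.+1%:R * k]) g u = k * a.
  by rewrite /a /cell_avg mulrA divff ?mul1r// gt_eqF.
have iag : mu.-integrable `]j%:R * k, j.+1%:R * k] (fun y => (- 2 * a)%:E * (EFin \o g) y)%E.
  exact: integrableZl.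
rewrite (eq_integral (fun y : mR => (((g y) ^+ 2)%:E + (- 2 * a)%:E * (g y)%:E) + (a ^+ 2)%:E)%E); last first.
  by move=> y _; rewrite -EFinM -!EFinD; congr EFin; ring.
rewrite (integralD _ (integrableD _ ig2 iag) (ic (a ^+ 2)))//.
rewrite (integralD _ ig2 iag)// integralZl//.
have -> : (\int[mu]_(y in `](j%:R * k)%R, (j.+1%:R * k)%R]) (g y)%:E = (k * a)%:E)%E.
  by rewrite -Ia fineK//; exact: integrable_fin_num.
have -> : (\int[mu]_(y in `](j%:R * k)%R, (j.+1%:R * k)%R]) (a ^+ 2)%:E = (a ^+ 2 * k)%:E)%E.
  exact: cell_integral_cst.
rewrite -addeA -EFinM -EFinD geeDl// lee_fin.
have -> : - 2 * a * (k * a) + a ^+ 2 * k = - (a ^+ 2 * k) by ring.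
by rewrite oppr_le0 mulr_ge0 ?sqr_ge0// ltW.
Qed.

Lemma integral_cells (k : R) (n : nat) (h : R -> R) : 0 < k ->
  measurable_fun setT h -> (forall y, 0 <= h y) ->
  (forall y, ~~ (0 < y <= n%:R * k) -> h y = 0) ->
  (\int[mu]_y (h y)%:E =
   \sum_(j < n) \int[mu]_(y in `](j%:R * k)%R, (j.+1%:R * k)%R]) (h y)%:E)%E.
Proof.
move=> k0 mh h0 hout.
rewrite (eq_integral (fun y : mR => \sum_(j < n) ((h y)%:E * (itvind (j%:R * k) (j.+1%:R * k) y)%:E)%E)%R); last first.
  move=> y _.
  rewrite -(big_mkord xpredT (fun j => ((h y)%:E * (itvind (j%:R * k) (j.+1%:R * k) y)%:E)%E)).
  rewrite big_mkord (eq_bigr (fun j : 'I_n => (h y * itvind (j%:R * k) (j.+1%:R * k) y)%:E)).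
    rewrite sumEFin; congr EFin.
    have [/andP[y0 yn]|] := boolP (0 < y <= n%:R * k).
      have [j jn /andP[jy yj]] := cell_exists y0 yn.
      by rewrite (sum_cell (fun=> h y) k0 jn jy yj).
    by move=> H; rewrite (sum_cell_out (fun=> h y) k0 H) hout.
  by move=> j _; rewrite EFinM.
rewrite ge0_integral_sum//.
- apply: eq_bigr => j _; rewrite [RHS]integral_mkcond; apply: eq_integral => y _.
  by rewrite patchE /itvind indicE; case: ifP => _; rewrite ?mule1 ?mule0.
- move=> j; apply: emeasurable_funM; first exact/measurable_EFinP.
  by apply/measurable_EFinP; exact: measurable_itvind.
- by move=> j y _; rewrite mule_ge0// lee_fin// itvindE.
Qed.

Lemma increment_le_sup (g : R -> R) (M r : R) : measurable_fun setT g ->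
  (forall y, `|g y| <= M) -> (forall y, ~~ (0 < y <= 1) -> g y = 0) ->
  0 <= r -> r <= 1 ->
  (\int[mu]_y ((g (y + r)%R - g y) ^+ 2)%:E <= (8 * M ^+ 2)%:E)%E.
Proof.
move=> mg gM gout r0 r1.
have M0 : 0 <= M := le_trans (normr_ge0 _) (gM 0).
apply: (@le_trans _ _ (\int[mu]_y ((4 * M ^+ 2)%:E * (itvind (-1) 1 y)%:E))%E).
  apply: ge0_le_integral => //.
  - by move=> y _; rewrite lee_fin sqr_ge0.
  - apply/measurable_EFinP; apply: measurable_funX; apply: measurable_funB => //.
    by apply: (measurableT_comp mg); exact: measurable_funD.
  - by apply: emeasurable_funM => //; apply/measurable_EFinP; exact: measurable_itvind.
  - move=> y _; rewrite -EFinM lee_fin itvindE.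
    have [y1|y1] := ltP (-1) y; have [y2|y2] := leP y 1; rewrite /= ?mulr1 ?mulr0.
    + have : `|g (y + r) - g y| <= 2 * M.
        by apply: (le_trans (ler_normB _ _)); have := gM (y + r); have := gM y; lra.
      move=> H; have := ler_pM (normr_ge0 _) (normr_ge0 _) H H.
      by rewrite -expr2 real_normK ?num_real// => H'; apply: le_trans H' _; rewrite le_eqVlt; apply/orP; left; apply/eqP; ring.
    + rewrite (gout y) ?(gout (y + r)) ?subrr ?expr0n//; apply/negP => /andP[]; lra.
    + rewrite (gout y) ?(gout (y + r)) ?subrr ?expr0n//; apply/negP => /andP[]; lra.
    + by exfalso; lra.
rewrite ge0_integralZl_EFin//; last 3 first.
- by move=> y _; rewrite lee_fin itvindE.
- by apply/measurable_EFinP; exact: measurable_itvind.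
- by rewrite mulr_ge0// sqr_ge0.
rewrite integral_itvind; last by lra.
by rewrite -EFinM lee_fin le_eqVlt; apply/orP; left; apply/eqP; ring.
Qed.

(** On the domain, the points [y] and [y + r] lie in the same cell except if
    [y] is within [r] to the left of one of the [n + 1] cell ends; there, the
    increment is only bounded by [2 * M]. *)
Lemma increment_le_cells (n : nat) (g : R -> R) (M B r : R) : (0 < n)%N ->
  measurable_fun setT g -> 0 <= B ->
  (forall y, `|g y| <= M) -> (forall y, ~~ (0 < y <= 1) -> g y = 0) ->
  (forall j y z, (j < n)%N -> j%:R * n%:R^-1 < y -> y <= z -> z <= j.+1%:R * n%:R^-1 ->
     (g z - g y) ^+ 2 <= B * (z - y)) ->
  0 <= r -> r <= 1 ->
  (\int[mu]_y ((g (y + r)%R - g y) ^+ 2)%:E <= ((B + 8 * n%:R * M ^+ 2) * r)%:E)%E.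
Proof.
move=> n0 mg B0 gM gout gB r0 r1.
have M0 : 0 <= M := le_trans (normr_ge0 _) (gM 0).
have n0' : (0 : R) < n%:R by rewrite ltr0n.
set h : R := n%:R^-1.
have h0 : 0 < h by rewrite invr_gt0.
have nh : n%:R * h = 1 by rewrite /h divff// gt_eqF.
(* Pointwise bound: the oscillation inside cells plus the exceptional set. *)
pose bd (y : R) : \bar R := ((B * r)%:E * (itvind 0 1 y)%:E +
   (4 * M ^+ 2)%:E * \sum_(j <- iota 0 n.+1) (itvind (j%:R * h - r) (j%:R * h) y)%:E)%E.
have mi a b : measurable_fun setT (fun y => (itvind a b y)%:E : \bar R).
  by apply/measurable_EFinP; exact: measurable_itvind.
have i0 (a b y : R) : (0 <= (itvind a b y)%:E)%E by rewrite lee_fin itvindE.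
have mS : measurable_fun setT (fun y => \sum_(j <- iota 0 n.+1) (itvind (j%:R * h - r) (j%:R * h) y)%:E : \bar R)%E.
  by apply: emeasurable_sum.
have S0 y : (0 <= \sum_(j <- iota 0 n.+1) (itvind (j%:R * h - r) (j%:R * h) y)%:E)%E.
  by apply: sume_ge0.
have Br0 : 0 <= B * r by rewrite mulr_ge0.
have M20 : 0 <= 4 * M ^+ 2 by rewrite mulr_ge0// sqr_ge0.
have m1 : measurable_fun setT (fun y => (B * r)%:E * (itvind 0 1 y)%:E)%E.
  exact: (emeasurable_funM (measurable_cst _) (mi 0 1)).
have m2 := emeasurable_funM (measurable_cst (4 * M ^+ 2)%:E) mS.
apply: (@le_trans _ _ (\int[mu]_y bd y)%E).
  apply: ge0_le_integral => //.
  - by move=> y _; rewrite lee_fin sqr_ge0.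
  - apply/measurable_EFinP; apply: measurable_funX; apply: measurable_funB => //.
    by apply: (measurableT_comp mg); exact: measurable_funD.
  - exact: emeasurable_funD m1 m2.
  move=> y _; rewrite /bd.
  have [/hasP[j jn jy]|H] := boolP (has (fun j => (j%:R * h - r < y) && (y <= j%:R * h)) (iota 0 n.+1)).
    have s1 : (1 <= \sum_(j <- iota 0 n.+1) (itvind (j%:R * h - r) (j%:R * h) y)%:E)%E.
      rewrite (big_rem j)//= itvindE jy leeDl//; exact: sume_ge0.
    apply: (@le_trans _ _ (4 * M ^+ 2)%:E); last first.
      apply: lee_paddl; first by rewrite mule_ge0.
      by rewrite -[leLHS]mule1; apply: lee_wpmul2l.
    have : `|g (y + r) - g y| <= 2 * M.
      by apply: (le_trans (ler_normB _ _)); have := gM (y + r); have := gM y; lra.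
    move=> H; have := ler_pM (normr_ge0 _) (normr_ge0 _) H H.
    rewrite -expr2 real_normK ?num_real// lee_fin => H'; apply: le_trans H' _.
    by rewrite le_eqVlt; apply/orP; left; apply/eqP; ring.
  have Hj j : (j <= n)%N -> j%:R * h - r < y -> y <= j%:R * h -> False.
    move=> jn a1 a2; move/negP: H; apply; apply/hasP; exists j; last by rewrite a1 a2.
    by rewrite mem_iota add0n ltnS.
  have [y0|y0] := leP y 0.
    have : y <= - r by rewrite leNgt; apply/negP => yr; apply: (Hj 0%N) => //; rewrite mul0r// sub0r.
    move=> yr; rewrite (gout y) ?(gout (y + r)) ?subrr ?expr0n; last 2 first.
    - by apply/negP => /andP[]; lra.
    - by apply/negP => /andP[]; lra.
    by rewrite adde_ge0// mule_ge0.
  have [y1|y1] := leP y 1; last first.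
    rewrite (gout y) ?(gout (y + r)) ?subrr ?expr0n; last 2 first.
    - by apply/negP => /andP[]; lra.
    - by apply/negP => /andP[]; lra.
    by rewrite adde_ge0// mule_ge0.
  have [j jn /andP[jy yj]] : exists2 j, (j < n)%N & (j%:R * h < y) && (y <= j.+1%:R * h).
    by apply: cell_exists => //; rewrite nh.
  have yr : y + r <= j.+1%:R * h.
    by rewrite leNgt; apply/negP => yr; apply: (Hj j.+1) => //; rewrite ltrBlDr.
  apply: lee_paddr; first by rewrite mule_ge0.
  rewrite itvindE y0 y1/= mule1 lee_fin.
  have := gB j y (y + r) jn jy; rewrite lerDl r0 => /(_ isT yr) H'.
  by apply: le_trans H' _; rewrite addrC addKr.
rewrite /bd ge0_integralD//; last 2 first.
- by move=> y _; rewrite mule_ge0.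
- by move=> y _; rewrite mule_ge0.
rewrite (@ge0_integralZl_EFin _ _ _ mu _ measurableT (fun y : mR => (itvind 0 1 y)%:E))//; last exact: mi.
rewrite (@ge0_integralZl_EFin _ _ _ mu _ measurableT (fun y : mR => \sum_(j <- iota 0 n.+1) (itvind (j%:R * h - r) (j%:R * h) y)%:E)%E)//.
rewrite (@ge0_integral_sum _ _ _ mu _ measurableT _
  (fun j y => (itvind (j%:R * h - r) (j%:R * h) y)%:E) (fun j => mi _ _)); last first.
  by move=> j y _; exact: i0.
rewrite [X in ((B * r)%:E * X)%E](integral_itvind ler01) subr0 mule1.
rewrite (eq_bigr (fun=> r%:E)); last first.
  by move=> j _; rewrite integral_itvind ?gerBl// opprB addrC subrK.
rewrite sumEFin big_const_seq count_predT size_iota iter_addr_0 -(mulr_natl r n.+1).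
rewrite -EFinM -EFinD lee_fin (mulrDl B) lerD2l.
have -> : 8 * n%:R * M ^+ 2 * r = 4 * M ^+ 2 * ((2 * n%:R) * r) by ring.
apply: ler_wpM2l => //; apply: ler_wpM2r => //; rewrite -natrM ler_nat mul2n -addnn -addn1 leq_add2l//.
Qed.

Variable rho : R -> R.
Hypothesis mrho : measurable_fun setT rho.
Hypothesis rho0 : forall x, 0 <= rho x.
Hypothesis rho1 : forall x, rho x <= 1.
Variable c : R.
Hypothesis rhoH : forall l, 0 <= l -> l <= 1 ->
  (\int[mu]_x (2 * Num.min (rho x) l)%:E = (l `^ c)%:E)%E.

(** The space factor of [incr_form] on tensor products. *)
Definition space_form (g : R -> R) : \bar R :=
  (\int[mu]_th \int[mu]_y ((g (y + rho th)%R - g y) ^+ 2)%:E)%E.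

(** For a step [r] below [K^-1] the bound linear in [r] of
    [increment_le_cells] is used, above it the constant bound of
    [increment_le_sup].  Together they read [4 M^2 K * (2 * Num.min r K^-1)], whose
    integral is known from the choice of [rho]. *)
Lemma space_form_le (n : nat) (g : R -> R) (M B K : R) : (0 < n)%N ->
  measurable_fun setT g -> 0 <= B -> 1 <= K ->
  (forall y, `|g y| <= M) -> (forall y, ~~ (0 < y <= 1) -> g y = 0) ->
  (forall j y z, (j < n)%N -> j%:R * n%:R^-1 < y -> y <= z -> z <= j.+1%:R * n%:R^-1 ->
     (g z - g y) ^+ 2 <= B * (z - y)) ->
  B + 8 * n%:R * M ^+ 2 <= 8 * M ^+ 2 * K ->
  (space_form g <= (4 * M ^+ 2 * K `^ (1 - c))%:E)%E.
Proof.
move=> n0 mg B0 K1 gM gout gB HK.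
have K0 : 0 < K by lra.
have M20 : 0 <= M ^+ 2 by exact: sqr_ge0.
have mG : measurable_fun setT (fun z : mR * mR => ((g (z.2 + rho z.1) - g z.2) ^+ 2)%:E).
  apply/measurable_EFinP; apply: measurable_funX; apply: measurable_funB.
    apply: (measurableT_comp mg); apply: measurable_funD; first exact: measurable_snd.
    exact: (measurableT_comp mrho measurable_fst).
  exact: (measurableT_comp mg measurable_snd).
apply: (@le_trans _ _ (\int[mu]_th ((4 * M ^+ 2 * K)%:E * (2 * Num.min (rho th) K^-1)%:E))%E).
  apply: ge0_le_integral => //.
  - by move=> th _; apply: integral_ge0 => y _; rewrite lee_fin sqr_ge0.
  - apply: (measurable_fun_fubini_tonelli_F (m2 := mu) _ mG).
    by move=> z; rewrite lee_fin sqr_ge0.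
  - apply: emeasurable_funM => //; apply/measurable_EFinP; apply: measurable_funM => //.
    exact: measurable_minr.
  - move=> th _; rewrite -EFinM.
    have [rK|Kr] := leP (rho th) K^-1.
      apply: le_trans (increment_le_cells n0 mg B0 gM gout gB (rho0 th) (rho1 th)) _.
      rewrite lee_fin; apply: (le_trans (ler_wpM2r (rho0 th) HK)).
      by rewrite le_eqVlt; apply/orP; left; apply/eqP; ring.
    apply: le_trans (increment_le_sup mg gM gout (rho0 th) (rho1 th)) _.
    by rewrite lee_fin le_eqVlt; apply/orP; left; apply/eqP; field; rewrite gt_eqF.
rewrite ge0_integralZl_EFin//; last 3 first.
- by move=> th _; rewrite lee_fin mulr_ge0// le_min rho0 invr_ge0 ltW.
- apply/measurable_EFinP; apply: measurable_funM => //; exact: measurable_minr.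
- by apply: mulr_ge0; [exact: mulr_ge0|exact: ltW].
rewrite rhoH ?invr_ge0 ?(ltW K0) ?invf_le1//.
rewrite -EFinM lee_fin -(mulrA _ K) ler_wpM2l//; first by apply: mulr_ge0.
rewrite powRD; last by rewrite (gt_eqF K0) implybT.
rewrite (powRr1 (ltW K0)) ler_wpM2l ?(ltW K0)//.
by rewrite -(powR_inv1 (ltW K0)) -powRrM mulN1r.
Qed.

End cells.

(** * Eigenfunctions *)

Section eigenfunctions.
Context {R : realType}.
Local Notation mu := (@lebesgue_measure R).
Local Notation mR := (measurableTypeR R).

Lemma sqrt_lambda (a : nat) : Num.sqrt (lambda a) = a%:R * pi :> R.
Proof. by rewrite /lambda sqrtr_sqr ger0_norm// mulr_ge0// pi_ge0. Qed.

Lemma sqr_sqrt2 : Num.sqrt 2 ^+ 2 = 2 :> R.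
Proof. by rewrite sqr_sqrtr. Qed.

Lemma measurable_sin : measurable_fun setT (@sin R : mR -> mR).
Proof. by apply: continuous_measurable_fun; exact: continuous_sin. Qed.

Lemma measurable_eigf (a : nat) : measurable_fun setT (@eigf R a).
Proof.
apply: measurable_funM => //; apply: (measurableT_comp measurable_sin).
exact: measurable_funM.
Qed.

Lemma eigf_bounded (a : nat) (x : R) : `|eigf a x| <= Num.sqrt 2.
Proof.
rewrite /eigf normrM ger0_norm ?sqrtr_ge0// ler_piMr ?sqrtr_ge0//.
by rewrite ler_norml sin_geN1 sin_le1.
Qed.

Lemma eigf_lipschitz (a : nat) (x y : R) :
  `|eigf a x - eigf a y| <= Num.sqrt 2 * (a%:R * pi) * `|x - y|.
Proof.
rewrite /eigf -mulrBr normrM (ger0_norm (sqrtr_ge0 2)) -mulrA.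
apply: ler_wpM2l; first exact: sqrtr_ge0.
apply: le_trans (sin_lipschitz _ _) _.
by rewrite -mulrBr normrM sqrt_lambda (ger0_norm (mulr_ge0 _ (pi_ge0 _))).
Qed.

(** The indicator function is that of a union of half-open cells, so that
    [eigz a] and its cell averages vanish outside of the same set. *)
Definition eigz (a : nat) (y : R) : R := itvind 0 1 y * eigf a y.

Lemma eigzE (a : nat) (y : R) : 0 < y -> y <= 1 -> eigz a y = eigf a y.
Proof. by move=> y0 y1; rewrite /eigz itvindE y0 y1 mul1r. Qed.

Lemma eigz_out (a : nat) (y : R) : ~~ (0 < y <= 1) -> eigz a y = 0.
Proof. by move=> /negbTE H; rewrite /eigz itvindE H mul0r. Qed.

Lemma measurable_eigz (a : nat) : measurable_fun setT (eigz a).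
Proof. by apply: measurable_funM; [exact: measurable_itvind|exact: measurable_eigf]. Qed.

Lemma eigz_bounded (a : nat) (y : R) : `|eigz a y| <= Num.sqrt 2.
Proof.
have [/andP[y0 y1]|H] := boolP (0 < y <= 1).
  by rewrite eigzE// eigf_bounded.
by rewrite eigz_out// normr0 sqrtr_ge0.
Qed.

Lemma cavg_const (n j : nat) (g : R -> R) (y z : R) : (0 < n)%N -> (j < n)%N ->
  j%:R * n%:R^-1 < y -> y <= z -> z <= j.+1%:R * n%:R^-1 ->
  cavg n%:R^-1 n g z = cavg n%:R^-1 n g y.
Proof.
move=> n0 jn jy yz zj.
have h0 : 0 < n%:R^-1 :> R by rewrite invr_gt0 ltr0n.
rewrite (cavg_cell _ h0 jn jy (le_trans yz zj)).
by rewrite (cavg_cell _ h0 jn (lt_le_trans jy yz) zj).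
Qed.

Lemma cell_unit (n j : nat) (y : R) : (0 < n)%N -> (j < n)%N ->
  j%:R * n%:R^-1 < y -> y <= j.+1%:R * n%:R^-1 -> (0 < y) /\ (y <= 1).
Proof.
move=> n0 jn jy yj.
have h0 : 0 < n%:R^-1 :> R by rewrite invr_gt0 ltr0n.
split; first by apply: le_lt_trans jy; rewrite mulr_ge0// ltW.
apply: (le_trans yj); rewrite ler_pdivrMr ?ltr0n// mul1r ler_nat.
exact: jn.
Qed.

Variable rho : R -> R.
Hypothesis mrho : measurable_fun setT rho.
Hypothesis rho0 : forall x, 0 <= rho x.
Hypothesis rho1 : forall x, rho x <= 1.
Variable c : R.
Hypothesis c0 : 0 < c.
Hypothesis c1 : c <= 1.
Hypothesis rhoH : forall l, 0 <= l -> l <= 1 ->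
  (\int[mu]_x (2 * Num.min (rho x) l)%:E = (l `^ c)%:E)%E.

(** A function constant on cells has no oscillation inside the cells ([B = 0]), so
    only the number [n] of jumps matters. *)
Lemma space_form_cavg (a n : nat) : (0 < n)%N ->
  (space_form rho (cavg n%:R^-1 n (eigz a)) <= (8 * n%:R `^ (1 - c))%:E)%E.
Proof.
move=> n0.
have h0 : 0 < n%:R^-1 :> R by rewrite invr_gt0 ltr0n.
have nh : n%:R * n%:R^-1 = 1 :> R by rewrite divff// pnatr_eq0 -lt0n.
have -> : 8 * n%:R `^ (1 - c) = 4 * Num.sqrt 2 ^+ 2 * n%:R `^ (1 - c) :> R.
  by rewrite sqr_sqrt2; congr (_ * _); lra.
apply: (space_form_le mrho rho0 rho1 rhoH n0 (B := 0)) => //.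
- exact: measurable_cavg.
- by rewrite ler1n.
- move=> y; apply: cavg_bounded => //; first exact: measurable_eigz.
  exact: eigz_bounded.
- by move=> y H; apply: cavg_out => //; rewrite nh.
- by move=> j y z jn jy yz zj; rewrite (cavg_const _ n0 jn jy yz zj) subrr expr0n mul0r.
- by rewrite add0r sqr_sqrt2 le_eqVlt; apply/orP; left; apply/eqP; ring.
Qed.

(** The error of the average is at most [M], of order [Num.min 1 (a / n)].
    Inside a cell, its squared increment is at most [2 * M] times the Lipschitz
    bound, which is proportional to [a]; so the relevant frequency is
    [Num.max a n]. *)
Lemma space_form_osc (a n : nat) : (0 < n)%N -> (0 < a)%N ->
  (space_form rho (fun y => (eigz a y - cavg n%:R^-1 n (eigz a) y)%R)
   <= (256 * Num.min 1 (a%:R / n%:R) ^+ 2 * Num.max a%:R n%:R `^ (1 - c))%:E)%E.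
Proof.
move=> n0 a0.
have h0 : 0 < n%:R^-1 :> R by rewrite invr_gt0 ltr0n.
have n0' : 0 < n%:R :> R by rewrite ltr0n.
have a0' : 0 < a%:R :> R by rewrite ltr0n.
have nh : n%:R * n%:R^-1 = 1 :> R by rewrite divff// pnatr_eq0 -lt0n.
have s0 : 0 <= Num.sqrt 2 :> R by exact: sqrtr_ge0.
have p0 : 0 < pi :> R by exact: pi_gt0.
have p4 : pi < 4 :> R by have := pihalf_lt2 R; lra.
pose q : R := a%:R / n%:R.
have q0 : 0 < q by exact: divr_gt0.
pose M : R := Num.sqrt 2 * Num.min 2 (pi * q).
have M0 : 0 <= M by rewrite mulr_ge0// le_min ler0n mulr_ge0// ltW.
pose B : R := 2 * M * (Num.sqrt 2 * (a%:R * pi)).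
pose mx : R := Num.max a%:R n%:R.
have mxa : a%:R <= mx by rewrite le_max lexx.
have mxn : n%:R <= mx by rewrite le_max lexx orbT.
have n1 : 1 <= n%:R :> R by rewrite ler1n.
have me := measurable_eigz a.
have mc : measurable_fun setT (cavg n%:R^-1 n (eigz a)) := measurable_cavg _ _ _.
have osc y z : 0 < y -> y <= 1 -> 0 < z -> z <= 1 ->
    `|eigz a y - eigz a z| <= Num.sqrt 2 * (a%:R * pi) * `|y - z|.
  by move=> *; rewrite !eigzE// eigf_lipschitz.
have osc2 y z : `|eigz a y - eigz a z| <= 2 * Num.sqrt 2.
  by apply: (le_trans (ler_normB _ _)); have := eigz_bounded a y; have := eigz_bounded a z; lra.
have gM y : `|eigz a y - cavg n%:R^-1 n (eigz a) y| <= M.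
  have [/andP[y0 y1]|H] := boolP (0 < y <= 1); last first.
    by rewrite eigz_out// (cavg_out _ h0) ?nh// subrr normr0.
  have [j jn /andP[jy yj]] : exists2 j, (j < n)%N & (j%:R * n%:R^-1 < y) && (y <= j.+1%:R * n%:R^-1).
    by apply: cell_exists => //; rewrite nh.
  apply: (cavg_osc h0 jn me (eigz_bounded a) jy yj) => u ju uj.
  have [u0 u1] := cell_unit n0 jn ju uj.
  rewrite /M; case: (leP 2 (pi * q)) => _; first by rewrite mulrC osc2.
  apply: le_trans (osc _ _ u0 u1 y0 y1) _.
  rewrite -mulrA; apply: ler_wpM2l => //.
  rewrite (mulrC a%:R) -mulrA; apply: ler_wpM2l; first exact: ltW.
  apply: ler_wpM2l; first exact: ltW.
  move: jy yj ju uj; rewrite -(natr1 j) mulrDl mul1r ler_norml.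
  by move=> *; apply/andP; split; lra.
have M2 : M ^+ 2 <= 32 * Num.min 1 q ^+ 2.
  rewrite /M exprMn sqr_sqrt2.
  have -> : 32 * Num.min 1 q ^+ 2 = 2 * (4 * Num.min 1 q) ^+ 2 by ring.
  apply: ler_wpM2l => //; apply: lerXn2r; rewrite ?nnegrE.
  - by rewrite le_min ler0n mulr_ge0// ltW.
  - by rewrite mulr_ge0// le_min ler01 ltW.
  have pq : pi * q <= 4 * q by rewrite ler_wpM2r// ltW.
  by case: (leP 2 (pi * q)) => h1; case: (leP 1 q) => h2; lra.
apply: (@le_trans _ _ (4 * M ^+ 2 * (2 * mx) `^ (1 - c))%:E).
  apply: (space_form_le mrho rho0 rho1 rhoH n0 (B := B)) => //.
  - exact: measurable_funB.
  - by rewrite /B; apply: mulr_ge0; [exact: mulr_ge0|apply: mulr_ge0 => //; rewrite mulr_ge0// ltW].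
  - lra.
  - by move=> y H; rewrite eigz_out// (cavg_out _ h0) ?nh// subrr.
  - move=> j y z jn jy yz zj.
    have d1 := gM z; have d2 := gM y.
    have e1 : (eigz a z - cavg n%:R^-1 n (eigz a) z) - (eigz a y - cavg n%:R^-1 n (eigz a) y)
      = eigz a z - eigz a y by rewrite (cavg_const _ n0 jn jy yz zj); ring.
    have d3 : `|eigz a z - eigz a y| <= 2 * M.
      by rewrite -e1; apply: (le_trans (ler_normB _ _)); lra.
    have [y0 y1] := cell_unit n0 jn jy (le_trans yz zj).
    have [z0 z1] := cell_unit n0 jn (lt_le_trans jy yz) zj.
    have d4 := osc z y z0 z1 y0 y1.
    rewrite e1 -real_normK ?num_real// expr2.
    apply: (le_trans (ler_pM (normr_ge0 _) (normr_ge0 _) d3 d4)).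
    by rewrite ger0_norm ?subr_ge0// mulrA.
  (* If [2 <= pi * q] then [M] is of order 1 and [mx >= a] suffices; otherwise
     [M] is of order [q] and [q * mx >= q * n = a] is needed. *)
  - have k1 : B <= 8 * M ^+ 2 * mx.
      rewrite /B.
      have -> : 8 * M ^+ 2 * mx = 2 * M * (4 * M * mx) by ring.
      apply: ler_wpM2l; first exact: mulr_ge0.
      have -> : 4 * M * mx = Num.sqrt 2 * (4 * Num.min 2 (pi * q) * mx) by rewrite /M; ring.
      apply: ler_wpM2l => //.
      case: (leP 2 (pi * q)) => _.
        apply: (@le_trans _ _ (a%:R * 8)); first by apply: ler_wpM2l; lra.
        by lra.
      rewrite mulrC.
      have -> : 4 * (pi * q) * mx = pi * (4 * (q * mx)) by ring.
      apply: ler_wpM2l; first exact: ltW.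
      have : q * n%:R <= q * mx by apply: ler_wpM2l => //; exact: ltW.
      rewrite /q mulfVK ?gt_eqF// -/q => H.
      by lra.
    have : 8 * M ^+ 2 * n%:R <= 8 * M ^+ 2 * mx.
      by apply: ler_wpM2l => //; apply: mulr_ge0 => //; exact: sqr_ge0.
    by move=> H; rewrite [8 * n%:R * _]mulrAC [_ * (2 * mx)]mulrCA; lra.
rewrite lee_fin powRM//; last by apply: le_trans mxa; exact: ltW.
have c2 : 2 `^ (1 - c) <= 2 :> R.
  by rewrite -[leRHS](powRr1 (ler0n R 2)); apply: ler_powR; rewrite ?ler1n// gerBl ltW.
rewrite mulrA; apply: ler_wpM2r; first exact: powR_ge0.
rewrite -/q.
have := ler_pM (sqr_ge0 M) (powR_ge0 2 (1 - c)) M2 c2.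
by lra.
Qed.

End eigenfunctions.

(** * Time factors *)

Section timefactor.
Context {R : realType}.
Local Notation mu := (@lebesgue_measure R).
Local Notation mR := (measurableTypeR R).

Lemma integral_derivative (F f : R -> R) (a b : R) : a <= b ->
  (forall x : R, is_derive x 1 (F : R -> R^o) (f x)) -> continuous f ->
  (\int[mu]_(x in `[a, b]) (f x)%:E = (F b - F a)%:E)%E.
Proof.
rewrite le_eqVlt => /predU1P[->|ab] dF cf.
  by rewrite set_itv1 integral_set1 subrr.
have cF : continuous F.
  move=> x; have := dF x => dFx.
  have := @ex_derive _ _ _ _ _ _ _ dFx => /derivable1_diffP.
  exact: differentiable_continuous.
rewrite (continuous_FTC2 (F := F) ab) ?EFinB//.
- by apply: continuous_subspaceT.
- split.
  + by move=> x _; exact: (@ex_derive _ _ _ _ _ _ _ (dF x)).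
  + by apply: cvg_at_right_filter; exact: cF.
  + by apply: cvg_at_left_filter; exact: cF.
- by move=> x _; rewrite derive1E; exact: (@derive_val _ _ _ _ _ _ _ (dF x)).
Qed.

Definition timef (E : spde) (t : R) (a : nat) (s : R) : R :=
  \1_`]0, t[ s * phi E a (t - s).

Lemma measurable_phi (E : spde) (a : nat) : measurable_fun setT (phi E a : mR -> mR).
Proof.
case: E => /=.
  by apply: (measurableT_comp (@measurable_expR R)); exact: measurable_funM.
apply: measurable_funM => //; apply: (measurableT_comp measurable_sin).
exact: measurable_funM.
Qed.

Lemma measurable_timef E t a : measurable_fun setT (timef E t a).
Proof.
apply: measurable_funM; first exact: measurable_indic.
apply: (measurableT_comp (measurable_phi E a)).
exact: measurable_funB.
Qed.

Lemma timef_in E t a s : 0 < s -> s < t -> timef E t a s = phi E a (t - s).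
Proof.
by move=> s0 st; rewrite /timef indicE mem_set ?mul1r//= in_itv/= s0 st.
Qed.

Lemma timef_out E t a s : ~~ ((0 < s) && (s < t)) -> timef E t a s = 0.
Proof.
move=> H; rewrite /timef indicE memNset ?mul0r//=; rewrite in_itv/=.
exact/negP.
Qed.

Lemma lambda_gt0 (a : nat) : (0 < a)%N -> 0 < lambda a :> R.
Proof. by move=> a0; rewrite exprn_gt0// mulr_gt0 ?pi_gt0// ltr0n. Qed.

Lemma lambda_ge (a : nat) : a%:R ^+ 2 <= lambda a :> R.
Proof.
rewrite /lambda exprMn ler_peMr ?sqr_ge0// -(expr1n _ 2).
by apply: lerXn2r; rewrite ?nnegrE ?pi_ge0//; have := pi_ge2 R; lra.
Qed.

Lemma phi_bounded E a (t : R) : (0 < a)%N -> 0 <= t -> `|phi E a t| <= 1.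
Proof.
move=> a0 t0; have l0 := lambda_gt0 a0; case: E => /=.
  by rewrite ger0_norm ?expR_ge0// -expR0 ler_expR mulNr oppr_le0 mulr_ge0// ltW.
rewrite normrM normfV sqrt_lambda (@ger0_norm _ (a%:R * pi)) ?mulr_ge0 ?pi_ge0//.
have p1 : 1 <= a%:R * pi :> R.
  apply: (@le_trans _ _ (1 * 1)); first by rewrite mulr1.
  by apply: ler_pM; rewrite ?ler1n//; have := pi_ge2 R; lra.
rewrite ler_pdivrMr ?mul1r; last by lra.
by apply: le_trans p1; rewrite ler_norml sin_geN1 sin_le1.
Qed.

Lemma timef_bounded E t a s : (0 < a)%N -> `|timef E t a s| <= 1.
Proof.
move=> a0; have [/andP[s0 st]|H] := boolP ((0 < s) && (s < t)).
  by rewrite timef_in//; apply: phi_bounded => //; rewrite subr_ge0 ltW.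
by rewrite timef_out// normr0.
Qed.

(** For SHE, the integral of [expR (- 2 * lambda a * s)] is at most
    [(2 * lambda a)^-1]; for SWE, the factor [(lambda a)^-1] is pointwise. *)
Lemma integral_timef_sqr E t T a : (0 < a)%N -> 0 <= t -> t <= T ->
  (\int[mu]_s (timef E t a s ^+ 2)%:E <= ((1 + T) / a%:R ^+ 2)%:E)%E.
Proof.
move=> a0 t0 tT.
have a2 : 0 < a%:R ^+ 2 :> R by rewrite exprn_gt0// ltr0n.
have l0 := lambda_gt0 a0; have la := lambda_ge a.
have T0 : 0 <= T by lra.
case: E; last first.
  apply: (@le_trans _ _ (\int[mu]_s ((a%:R ^+ 2)^-1%:E * (itvind 0 t s)%:E))%E).
    apply: ge0_le_integral => //.
    - by move=> s _; rewrite lee_fin sqr_ge0.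
    - by apply/measurable_EFinP; apply: measurable_funX; exact: measurable_timef.
    - by apply: emeasurable_funM => //; apply/measurable_EFinP; exact: measurable_itvind.
    move=> s _; rewrite -EFinM lee_fin.
    have [/andP[s0 st]|H] := boolP ((0 < s) && (s < t)); last first.
      by rewrite timef_out// expr0n mulr_ge0 ?itvindE ?invr_ge0 ?sqr_ge0.
    rewrite timef_in// itvindE s0 (ltW st) mulr1/= expr_div_n sqr_sqrtr ?(ltW l0)//.
    rewrite ler_pdivrMr// [leRHS]mulrC ler_pdivlMr//.
    apply: le_trans la; apply: ler_piMl; first exact: ltW.
    set z := _ * (t - s); rewrite -subr_ge0 (_ : 1 - _ = (1 - sin z) * (1 + sin z)); last by ring.
    by have h1 := sin_geN1 z; have h2 := sin_le1 z; apply: mulr_ge0; lra.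
  rewrite (@ge0_integralZl_EFin _ _ _ mu _ measurableT (fun y : mR => (itvind 0 t y)%:E))//; last 2 first.
  - by move=> y _; rewrite lee_fin itvindE.
  - by apply/measurable_EFinP; exact: measurable_itvind.
  rewrite integral_itvind// -EFinM lee_fin subr0 mulrC ler_wpM2r ?invr_ge0 ?(ltW a2)//.
  by lra.
pose f (s : R) := expR (- (2 * lambda a) * (t - s)).
have cf : continuous f.
  move=> s; apply: continuous_comp; last exact: continuous_expR.
  apply: continuousM; first exact: cst_continuous.
  by apply: continuousB; [exact: cst_continuous|exact: cvg_id].
have dF (s : R) : is_derive s 1 ((fun s => (2 * lambda a)^-1 * f s) : R -> R^o) (f s).
  apply: is_derive_eq.
  rewrite /GRing.scale/= /f; field.
  by rewrite gt_eqF.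
apply: (@le_trans _ _ (\int[mu]_(s in `[0%R, t]) (f s)%:E)%E).
  rewrite [leRHS]integral_mkcond; apply: ge0_le_integral => //.
  - by move=> s _; rewrite lee_fin sqr_ge0.
  - by apply/measurable_EFinP; apply: measurable_funX; exact: measurable_timef.
  - apply/(measurable_restrictT _ _).1 => //; apply/measurable_EFinP.
    by apply: measurable_funTS; exact: continuous_measurable_fun.
  - move=> s _; rewrite patchE; case: ifPn => [_|].
      have [/andP[s0 st]|H] := boolP ((0 < s) && (s < t)); last first.
        by rewrite timef_out// expr0n lee_fin expR_ge0.
      by rewrite timef_in// lee_fin /= -expRM_natl /f -mulr_natl le_eqVlt; apply/orP; left; apply/eqP; congr expR; ring.
    rewrite notin_setE/= in_itv/= => /negP H; rewrite timef_out ?expr0n//.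
    by apply: contra H => /andP[s0 st]; rewrite !ltW.
rewrite (integral_derivative t0 dF cf) lee_fin /f subrr mulr0 expR0 mulr1.
apply: (@le_trans _ _ ((2 * lambda a)^-1)).
  by rewrite gerBl mulr_ge0 ?expR_ge0// invr_ge0 mulr_ge0// ltW.
apply: (@le_trans _ _ (1 / a%:R ^+ 2)); last by rewrite ler_wpM2r ?invr_ge0 ?(ltW a2)//; lra.
by rewrite mul1r lef_pV2 ?posrE//; [lra|rewrite mulr_gt0].
Qed.

Lemma integral_cavg_osc (k M : R) (n : nat) (g : R -> R) (D : nat -> R) : 0 < k ->
  measurable_fun setT g -> (forall y, `|g y| <= M) ->
  (forall y, ~~ (0 < y <= n%:R * k) -> g y = 0) ->
  (forall j y z, (j < n)%N -> j%:R * k < y -> y <= z -> z <= j.+1%:R * k ->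
     `|g y - g z| <= D j) ->
  (\int[mu]_y ((g y - cavg k n g y) ^+ 2)%:E <= (k * \sum_(j < n) D j ^+ 2)%:E)%E.
Proof.
move=> k0 mg gM gout gD.
have mc : measurable_fun setT (cavg k n g) := measurable_cavg _ _ _.
rewrite (@integral_cells _ k n (fun y => (g y - cavg k n g y) ^+ 2))//; last 3 first.
- by apply: measurable_funX; exact: measurable_funB.
- by move=> y; exact: sqr_ge0.
- by move=> y H; rewrite gout// (cavg_out _ k0 H) subrr expr0n.
rewrite mulr_sumr -sumEFin; apply: lee_sum => j _.
apply: (@le_trans _ _ (\int[mu]_(y in `](j%:R * k)%R, (j.+1%:R * k)%R]) (D j ^+ 2)%:E)%E).
  apply: ge0_le_integral => //.
  - by move=> y _; rewrite lee_fin sqr_ge0.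
  - apply: measurable_funTS; apply/measurable_EFinP; apply: measurable_funX.
    exact: measurable_funB.
  move=> y; rewrite /= in_itv/= => /andP[jy yj]; rewrite lee_fin.
  have H : `|g y - cavg k n g y| <= D j.
    apply: (cavg_osc k0 (ltn_ord j) mg gM jy yj) => u ju uj.
    have [yu|uy] := leP y u; first by rewrite distrC; exact: gD.
    by apply: gD => //; exact: ltW.
  rewrite -real_normK ?num_real//; apply: lerXn2r => //; rewrite nnegrE//.
  exact: le_trans H.
by rewrite (cell_integral_cst _ _ k0) mulrC.
Qed.

Lemma integral_cavg_le (k M : R) (n : nat) (g : R -> R) : 0 < k ->
  measurable_fun setT g -> (forall y, `|g y| <= M) ->
  (forall y, ~~ (0 < y <= n%:R * k) -> g y = 0) ->
  (\int[mu]_y ((g y - cavg k n g y) ^+ 2)%:E <= \int[mu]_y (g y ^+ 2)%:E)%E.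
Proof.
move=> k0 mg gM gout.
have mc : measurable_fun setT (cavg k n g) := measurable_cavg _ _ _.
rewrite (@integral_cells _ k n (fun y => (g y - cavg k n g y) ^+ 2))//; last 3 first.
- by apply: measurable_funX; exact: measurable_funB.
- by move=> y; exact: sqr_ge0.
- by move=> y H; rewrite gout// (cavg_out _ k0 H) subrr expr0n.
rewrite (@integral_cells _ k n (fun y => g y ^+ 2))//; last 3 first.
- exact: measurable_funX.
- by move=> y; exact: sqr_ge0.
- by move=> y H; rewrite gout// expr0n.
by apply: lee_sum => j _; exact: (cavg_sqr_le k0 (ltn_ord j) mg gM).
Qed.

(** The square of [time_rate E k] bounds, up to a constant and uniformly in the
    mode, the mean square error of the cell averages of a time factor. *)
Definition time_rate (E : spde) (k : R) : R :=
  match E with SHE => k `^ 2^-1 | SWE => k end.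

(** The time factor of SWE is continuous where it is cut at [s = t], because
    [phi SWE a 0 = 0]. *)
Lemma timef_shift_SWE (t : R) (a : nat) (y z : R) : (0 < a)%N -> 0 < y -> y <= z ->
  `|timef SWE t a y - timef SWE t a z| <= z - y.
Proof.
move=> a0 y0 yz.
have E s : 0 < s -> timef SWE t a s = phi SWE a (Num.max (t - s) 0).
  move=> s0; have [st|ts] := ltP s t.
    by rewrite timef_in// max_l// subr_ge0 ltW.
  rewrite timef_out ?s0 ?(leNgt t s) -?leNgt//= max_r ?subr_le0//.
  by rewrite mulr0 sin0 mul0r.
rewrite !E//; last exact: lt_le_trans yz.
rewrite /phi -mulrBl normrM normfV sqrt_lambda.
have ap : 0 < a%:R * pi :> R by rewrite mulr_gt0 ?ltr0n ?pi_gt0.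
rewrite (ger0_norm (ltW ap)) ler_pdivrMr//.
apply: le_trans (sin_lipschitz _ _) _.
rewrite -mulrBr normrM (ger0_norm (ltW ap)) mulrC ler_wpM2r ?(ltW ap)//.
rewrite ler_norml; case: (leP (t - y) 0); case: (leP (t - z) 0) => *; apply/andP; split; lra.
Qed.

(** The time factor of SHE jumps from 1 to 0 at [s = t] and its Lipschitz
    constant is of order [lambda a], but it is the difference of two
    nondecreasing functions with values in [[0, 1]].  The sum of their
    increments over a cell is at most 2, and at most 2 in total over all cells, so
    the squares sum up to at most 4. *)
Lemma timef_SHE_osc (t k : R) (a n : nat) : (0 < a)%N -> 0 < k ->
  exists2 D : nat -> R, (forall j y z, (j < n)%N -> j%:R * k < y -> y <= z -> z <= j.+1%:R * k ->
     `|timef SHE t a y - timef SHE t a z| <= D j) & \sum_(j < n) D j ^+ 2 <= 4.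
Proof.
move=> a0 k0; have l0 := lambda_gt0 a0.
pose m1 (s : R) := expR (- lambda a * Num.max (t - s) 0).
pose m2 (s : R) : R := (t <= s)%R%:R.
have m1h y z : y <= z -> m1 y <= m1 z.
  move=> yz; rewrite /m1 ler_expR !mulNr lerN2 ler_wpM2l ?(ltW l0)//.
  by case: (leP (t - y) 0); case: (leP (t - z) 0) => *; lra.
have m2h y z : y <= z -> m2 y <= m2 z.
  by move=> yz; rewrite /m2 ler_nat; case: (leP t y) => // ty; rewrite (le_trans ty yz).
have m10 y : 0 <= m1 y by exact: expR_ge0.
have m11 y : m1 y <= 1.
  by rewrite -expR0 ler_expR mulNr oppr_le0 mulr_ge0 ?(ltW l0)// le_max lexx orbT.
have m20 y : 0 <= m2 y by rewrite /m2 ler0n.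
have m21 y : m2 y <= 1 by rewrite /m2; case: (t <= y)%R.
have E s : 0 < s -> timef SHE t a s = m1 s - m2 s.
  move=> s0; rewrite /m1 /m2; have [st|ts] := ltP s t.
    by rewrite timef_in// max_l ?subr_ge0 ?ltW// subr0.
  rewrite timef_out ?s0 ?(leNgt t s) -?leNgt//= max_r ?subr_le0//.
  by rewrite mulr0 expR0 subrr.
pose d (j : nat) := (m1 (j.+1%:R * k) - m1 (j%:R * k)) + (m2 (j.+1%:R * k) - m2 (j%:R * k)).
exists d.
  move=> j y z jn jy yz zj.
  have y0 : 0 < y by apply: le_lt_trans jy; rewrite mulr_ge0// ltW.
  rewrite !E//; last exact: lt_le_trans yz.
  have := m1h _ _ (ltW jy); have := m1h _ _ yz; have := m1h _ _ zj.
  have := m2h _ _ (ltW jy); have := m2h _ _ yz; have := m2h _ _ zj.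
  by move=> *; rewrite /d ler_norml; apply/andP; split; lra.
apply: (@le_trans _ _ (\sum_(j < n) 2 * d j)).
  apply: ler_sum => j _; rewrite expr2.
  have jj : j%:R * k <= j.+1%:R * k by rewrite ler_wpM2r ?(ltW k0)// ler_nat.
  have := m1h _ _ jj; have := m2h _ _ jj; have := m10 (j%:R * k); have := m11 (j.+1%:R * k).
  have := m20 (j%:R * k); have := m21 (j.+1%:R * k).
  by move=> *; rewrite ler_wpM2r /d //; lra.
have -> : \sum_(j < n) 2 * d j =
    2 * ((m1 (n%:R * k) + m2 (n%:R * k)) - (m1 (0%:R * k) + m2 (0%:R * k))).
  rewrite -mulr_sumr; congr (2 * _).
  rewrite -(telescope_sumr (fun j => m1 (j%:R * k) + m2 (j%:R * k)) (leq0n n)) big_mkord.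
  by apply: eq_bigr => j _; rewrite /d; ring.
have := m10 (0%:R * k); have := m11 (n%:R * k).
have := m20 (0%:R * k); have := m21 (n%:R * k).
by move=> *; lra.
Qed.

(** High modes are small in mean square; low modes are regular: for SHE the
    squared oscillations have a bounded sum, so the error is of order [k]; for SWE
    each of the [m] cells contributes [k * k^2]. *)
Lemma integral_timef_cavg E (T t : R) (a m : nat) : (0 < a)%N -> (0 < m)%N ->
  0 < T -> 0 <= t -> t <= T ->
  (\int[mu]_s ((timef E t a s - cavg (T / m%:R) m (timef E t a) s) ^+ 2)%:E
   <= ((4 + T) * Num.min (a%:R ^- 2) (time_rate E (T / m%:R) ^+ 2))%:E)%E.
Proof.
move=> a0 m0 T0 t0 tT.
have m0' : 0 < m%:R :> R by rewrite ltr0n.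
have a2 : 0 < a%:R ^+ 2 :> R by rewrite exprn_gt0// ltr0n.
set k := T / m%:R.
have k0 : 0 < k by exact: divr_gt0.
have mk : m%:R * k = T by rewrite /k mulrC divfK// gt_eqF.
have gout s : ~~ (0 < s <= m%:R * k) -> timef E t a s = 0.
  rewrite mk => H; apply: timef_out; apply: contra H => /andP[s0 st].
  by rewrite s0 (le_trans (ltW st) tT).
have mg := measurable_timef E t a.
have gM s : `|timef E t a s| <= 1 by exact: timef_bounded.
rewrite minr_pMr; last by lra.
rewrite EFin_min le_min; apply/andP; split.
  apply: le_trans (integral_cavg_le k0 mg gM gout) _.
  apply: le_trans (integral_timef_sqr E a0 t0 tT) _.
  by rewrite lee_fin ler_wpM2r ?invr_ge0 ?(ltW a2)//; lra.
case: E gout mg gM => gout mg gM.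
  have [D HD D4] := timef_SHE_osc t m a0 k0.
  apply: le_trans (integral_cavg_osc k0 mg gM gout HD) _.
  rewrite lee_fin /= -powR_mulrn ?powR_ge0// -powRrM mulVf ?pnatr_eq0// powRr1 ?(ltW k0)//.
  by rewrite mulrC ler_wpM2r ?(ltW k0)//; lra.
apply: le_trans (integral_cavg_osc k0 mg gM gout (D := fun=> k) _) _.
  move=> j y z jn jy yz zj.
  have y0 : 0 < y by apply: le_lt_trans jy; rewrite mulr_ge0// ltW.
  apply: le_trans (timef_shift_SWE t a0 y0 yz) _.
  by move: jy zj; rewrite -(natr1 j) mulrDl mul1r; lra.
rewrite lee_fin sumr_const card_ord -(mulr_natl (k ^+ 2) m) mulrA (mulrC k) mk /=.
by rewrite ler_wpM2r ?sqr_ge0//; lra.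
Qed.

End timefactor.

(** * The noise error of a mode *)

Section wz_form.
Context {R : realType}.
Local Notation mu := (@lebesgue_measure R).
Local Notation mR := (measurableTypeR R).
Variable rho : R -> R.
Hypothesis mrho : measurable_fun setT rho.
Hypothesis rho0 : forall x, 0 <= rho x.
Hypothesis rho1 : forall x, rho x <= 1.
Variable c : R.
Hypothesis c0 : 0 < c.
Hypothesis c1 : c <= 1.
Hypothesis rhoH : forall l, 0 <= l -> l <= 1 ->
  (\int[mu]_x (2 * Num.min (rho x) l)%:E = (l `^ c)%:E)%E.

Definition wz_mode (E : spde) (T t : R) (m n a : nat) (s y : R) : R :=
  timef E t a s * eigz a y
  - cavg (T / m%:R) m (timef E t a) s * cavg n%:R^-1 n (eigz a) y.

Lemma measurable_tensor (psi g : R -> R) : measurable_fun setT psi ->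
  measurable_fun setT g -> measurable_fun setT (fun2 (fun s y => psi s * g y)).
Proof.
move=> mp mg; apply: measurable_funM.
  exact: (measurableT_comp mp measurable_fst).
exact: (measurableT_comp mg measurable_snd).
Qed.

Lemma measurable_wz_mode E T t m n a : measurable_fun setT (fun2 (wz_mode E T t m n a)).
Proof.
by apply: measurable_funB; apply: measurable_tensor;
  [exact: measurable_timef|exact: measurable_eigz|exact: measurable_cavg|exact: measurable_cavg].
Qed.

Lemma space_form_ge0 (g : R -> R) : (0 <= space_form rho g)%E.
Proof.
by apply: integral_ge0 => th _; apply: integral_ge0 => y _; rewrite lee_fin sqr_ge0.
Qed.

(** The two terms correspond to the averages in space and in time; in each of them
    the form of a tensor product factorizes. *)
Lemma wz_mode_form E (T t : R) (m n a : nat) : (0 < a)%N -> (0 < m)%N -> (0 < n)%N ->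
  0 < T -> 0 <= t -> t <= T ->
  (incr_form rho (wz_mode E T t m n a) <=
   (512 * (1 + T) * (a%:R ^- 2 * Num.min 1 (a%:R / n%:R) ^+ 2 * Num.max a%:R n%:R `^ (1 - c))
    + 16 * (4 + T) * n%:R `^ (1 - c) * Num.min (a%:R ^- 2) (time_rate E (T / m%:R) ^+ 2))%:E)%E.
Proof.
move=> a0 m0 n0 T0 t0 tT.
set psi := timef E t a; set Pp := cavg (T / m%:R) m psi.
pose g : R -> R := eigz a; set Pg := cavg n%:R^-1 n g.
have mp : measurable_fun setT psi by exact: measurable_timef.
have mPp : measurable_fun setT Pp by exact: measurable_cavg.
have mg : measurable_fun setT g by exact: measurable_eigz.
have mPg : measurable_fun setT Pg by exact: measurable_cavg.
have m1 := measurable_tensor mp (measurable_funB mg mPg).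
have m2 := measurable_tensor (measurable_funB mp mPp) mPg.
(* Replace first the eigenfunction, then the time factor, by its average. *)
have -> : wz_mode E T t m n a = fun s y => psi s * (g \- Pg) y + (psi \- Pp) s * Pg y.
  by apply/funext => s; apply/funext => y; rewrite /wz_mode /= -/psi -/Pp -[eigz a]/g -/Pg; ring.
apply: le_trans (incr_formD mrho m1 m2) _.
rewrite (incr_form_tensor mrho mp (measurable_funB mg mPg)).
rewrite (incr_form_tensor mrho (measurable_funB mp mPp) mPg).
rewrite [leRHS]EFinD; apply: leeD.
  have -> : 512 * (1 + T) * (a%:R ^- 2 * Num.min 1 (a%:R / n%:R) ^+ 2 * Num.max a%:R n%:R `^ (1 - c))
    = 2 * ((1 + T) / a%:R ^+ 2 * (256 * Num.min 1 (a%:R / n%:R) ^+ 2 * Num.max a%:R n%:R `^ (1 - c))) by ring.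
  rewrite EFinM; apply: lee_wpmul2l => //; rewrite EFinM; apply: lee_pmul => //.
  - by apply: integral_ge0 => s _; rewrite lee_fin sqr_ge0.
  - exact: space_form_ge0.
  - exact: integral_timef_sqr.
  - by have := space_form_osc mrho rho0 rho1 c0 rhoH n0 a0.
have -> : 16 * (4 + T) * n%:R `^ (1 - c) * Num.min (a%:R ^- 2) (time_rate E (T / m%:R) ^+ 2)
    = 2 * ((4 + T) * Num.min (a%:R ^- 2) (time_rate E (T / m%:R) ^+ 2) * (8 * n%:R `^ (1 - c))) by ring.
rewrite EFinM; apply: lee_wpmul2l => //; rewrite EFinM; apply: lee_pmul => //.
- by apply: integral_ge0 => s _; rewrite lee_fin sqr_ge0.
- exact: space_form_ge0.
- exact: integral_timef_cavg.
- by have := space_form_cavg mrho rho0 rho1 rhoH a n0.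
Qed.

Definition wz_rate (E : spde) (T : R) (m n : nat) : R :=
  n%:R `^ (- c) + time_rate E (T / m%:R) * n%:R `^ (1 - c).

Lemma time_rate_gt0 E (k : R) : 0 < k -> 0 < time_rate E k.
Proof. by case: E => //= k0; exact: powR_gt0. Qed.

(** The space term is summed by [sum_weight_le]; for the time term,
    [sum_min_sqr_le] turns the squared rate of one mode into the rate itself. *)
Lemma sum_wz_mode_form E (T t : R) (m n N : nat) : (0 < m)%N -> (0 < n)%N ->
  0 < T -> 0 <= t -> t <= T ->
  (\sum_(a < N) incr_form rho (wz_mode E T t m n a.+1) <=
   (512 * (4 + T) * (1 + c^-1) * wz_rate E T m n)%:E)%E.
Proof.
move=> m0 n0 T0 t0 tT.
set x := time_rate E (T / m%:R).
have k0 : 0 < T / m%:R by rewrite divr_gt0// ltr0n.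
have x0 : 0 < x by exact: time_rate_gt0.
pose w1 (a : nat) := (a%:R ^- 2 * Num.min 1 (a%:R / n%:R) ^+ 2 * Num.max a%:R n%:R `^ (1 - c)) : R.
pose w2 (a : nat) := Num.min (a%:R ^- 2) (x ^+ 2) : R.
apply: (@le_trans _ _ (\sum_(a < N) (512 * (1 + T) * w1 a.+1 + 16 * (4 + T) * n%:R `^ (1 - c) * w2 a.+1)%:E)%E).
  by apply: lee_sum => a _; exact: wz_mode_form.
rewrite sumEFin lee_fin big_split/= -!mulr_sumr.
have s1 : \sum_(a < N) w1 a.+1 <= (1 + c^-1) * n%:R `^ (- c).
  by have := sum_weight_le N.+1 c0 c1 n0; rewrite big_add1 big_mkord.
have s2 : \sum_(a < N) w2 a.+1 <= 4 * x.
  by have := sum_min_sqr_le N.+1 x0; rewrite big_add1 big_mkord.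
have ci : 0 < c^-1 by rewrite invr_gt0.
have p1 : 0 <= n%:R `^ (- c) :> R by exact: powR_ge0.
have p2 : 0 <= n%:R `^ (1 - c) :> R by exact: powR_ge0.
rewrite /wz_rate -/x [leRHS]mulrDr; apply: lerD.
  rewrite -[leRHS]mulrA; apply: ler_pM.
  - by apply: mulr_ge0; [exact: ler0n|lra].
  - by apply: sumr_ge0 => a _; rewrite /w1 !mulr_ge0 ?powR_ge0 ?invr_ge0 ?sqr_ge0.
  - by apply: ler_wpM2l; [exact: ler0n|lra].
  - exact: s1.
apply: (@le_trans _ _ (16 * (4 + T) * n%:R `^ (1 - c) * (4 * x))).
  by apply: ler_wpM2l s2; apply: mulr_ge0 p2; apply: mulr_ge0; [exact: ler0n|lra].
have -> : 16 * (4 + T) * n%:R `^ (1 - c) * (4 * x) = (64 * (4 + T)) * (x * n%:R `^ (1 - c)) by ring.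
apply: ler_wpM2r; first by rewrite mulr_ge0// ltW.
apply: (@le_trans _ _ (512 * (4 + T) * 1)); first by lra.
apply: ler_wpM2l; last by lra.
by apply: mulr_ge0; [exact: ler0n|lra].
Qed.

End wz_form.

(** * Orthonormality of the eigenfunctions *)

Section orthonormality.
Context {R : realType}.
Local Notation mu := (@lebesgue_measure R).
Local Notation mR := (measurableTypeR R).

Lemma sin_natpi (n : nat) : sin (n%:R * pi) = 0 :> R.
Proof.
elim: n => [|n IH]; first by rewrite mul0r sin0.
by rewrite -natr1 mulrDl mul1r sinDpi IH oppr0.
Qed.

Lemma eigz_orthonormal (a b : nat) : (0 < a)%N -> (0 < b)%N ->
  (\int[mu]_x (eigz a x * eigz b x)%:E = ((a == b)%:R : R)%:E)%E.
Proof.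
move=> a0 b0.
pose p : R := (a%:R - b%:R) * pi; pose q : R := (a%:R + b%:R) * pi.
have sp : sin p = 0 by rewrite /p mulrBl sinB !sin_natpi mul0r mulr0 subrr.
have sq : sin q = 0 by rewrite /q mulrDl sinD !sin_natpi mul0r mulr0 addr0.
have q0 : q != 0.
  apply: mulf_neq0; last by rewrite gt_eqF// pi_gt0.
  by rewrite -natrD pnatr_eq0 addn_eq0 -!leqn0 leqNgt a0.
pose f (x : R) := cos (p * x) - cos (q * x).
have cf : continuous f.
  move=> x; apply: continuousB; apply: continuous_comp; try exact: continuous_cos;
    by apply: continuousM; [exact: cst_continuous|exact: cvg_id].
have -> : (\int[mu]_x (eigz a x * eigz b x)%:E = \int[mu]_(x in `[0%R, 1%R]) (f x)%:E)%E.
  rewrite [RHS]integral_mkcond; apply: eq_integral => x _; rewrite patchE; case: ifPn.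
    rewrite inE/= in_itv/= => /andP[x0 x1].
    have fE : f x = eigf a x * eigf b x.
      have px : p * x = a%:R * pi * x - b%:R * pi * x by rewrite /p; ring.
      have qx : q * x = a%:R * pi * x + b%:R * pi * x by rewrite /q; ring.
      rewrite /f px qx cosB cosD /eigf !sqrt_lambda.
      by have := @sqr_sqrt2 R; set s2 := Num.sqrt 2 => H; rewrite mulrACA -expr2 H; ring.
    congr EFin; rewrite fE; have [x00|x00] := ltP 0 x; first by rewrite !eigzE.
    have -> : x = 0 by apply/eqP; rewrite eq_le x00 x0.
    by rewrite /eigz /eigf !mulr0 sin0 !mulr0.
  rewrite notin_setE/= in_itv/= => /negP H; rewrite eigz_out ?mul0r//.
  by apply: contra H => /andP[x0 x1]; rewrite ltW.
have [ab|ab] := eqVneq a b; last first.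
  have p0 : p != 0.
    apply: mulf_neq0; last by rewrite gt_eqF// pi_gt0.
    by rewrite subr_eq0 eqr_nat.
  have dF (x : R) : is_derive x 1 ((fun x => p^-1 * sin (p * x) - q^-1 * sin (q * x)) : R -> R^o) (f x).
    apply: is_derive_eq; rewrite /GRing.scale/= /f; field; by rewrite p0 q0.
  rewrite (integral_derivative ler01 dF cf) !mulr1 sp sq !mulr0 sin0.
  by rewrite !mulr0 !subrr.
have p0 : p = 0 by rewrite /p ab subrr mul0r.
have dF (x : R) : is_derive x 1 ((fun x => x - q^-1 * sin (q * x)) : R -> R^o) (f x).
  apply: is_derive_eq; rewrite /GRing.scale/= /f p0 mul0r cos0; field; exact: q0.
rewrite (integral_derivative ler01 dF cf) !mulr1 sq !mulr0 sin0.
by rewrite !mulr0 !subr0.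
Qed.

Lemma parseval_tonelli (d : measure_display) (Z : measurableType d)
    (m : {sigma_finite_measure set Z -> \bar R}) (cf : nat -> Z -> R) (N : nat) :
  (forall a, measurable_fun setT (cf a)) ->
  (\int[mu]_x \int[m]_z ((\sum_(a < N) eigz a.+1 x * cf a z) ^+ 2)%:E
   = \sum_(a < N) \int[m]_z (cf a z ^+ 2)%:E)%E.
Proof.
move=> mcf.
rewrite (fubini_tonelli (m1 := mu) (m2 := m) (fun z : mR * Z => ((\sum_(a < N) eigz a.+1 z.1 * cf a z.2) ^+ 2)%:E)); last 2 first.
- apply/measurable_EFinP; apply: measurable_funX; apply: measurable_sum => a.
  apply: measurable_funM; first exact: (measurableT_comp (measurable_eigz _) measurable_fst).
  exact: (measurableT_comp (mcf a) measurable_snd).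
- by move=> z; rewrite lee_fin sqr_ge0.
rewrite (eq_integral (fun z => \sum_(a < N) (cf a z ^+ 2)%:E)%E).
  rewrite ge0_integral_sum// => a.
    by apply/measurable_EFinP; exact: measurable_funX.
  by move=> z _; rewrite lee_fin sqr_ge0.
move=> z _ /=.
rewrite (eq_integral (fun x : mR => ((\sum_(a < N) cf a z * eigz a.+1 x) ^+ 2)%:E)); last first.
  by move=> x _; congr ((_ ^+ 2)%:E); apply: eq_bigr => a _; rewrite mulrC.
rewrite (@integral_sqr_sum _ _ R mu 'I_N (fun (a : 'I_N) => eigz a.+1 : mR -> R) (fun a => cf a z) (fun a b => (a == b)%:R)).
- rewrite -sumEFin; apply: eq_bigr => a _; rewrite (bigD1 a)//= eqxx mulr1 big1 ?addr0 ?expr2// => b ba.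
  by rewrite eq_sym (negbTE ba) mulr0.
- by move=> a; exact: measurable_eigz.
- by move=> a b; rewrite eigz_orthonormal.
Qed.

End orthonormality.

(** * Convergence of the Green series *)

Section green_series.
Context {R : realType}.
Local Notation mR := (measurableTypeR R).

Lemma cvg_series_inv_sqr (u : nat -> R) (C : R) :
  (forall a, `|u a| <= C / a.+1%:R ^+ 2) -> cvgn (series u).
Proof.
move=> uC; apply: normed_cvg.
have C0 : 0 <= C.
  have := le_trans (normr_ge0 _) (uC 0%N); by rewrite expr1n divr1.
apply: (@series_le_cvg _ _ (fun a => C / a.+1%:R ^+ 2)) => //.
- by move=> a; exact: normr_ge0.
- by move=> a; rewrite divr_ge0// sqr_ge0.
apply: nondecreasing_is_cvgn.
  apply/nondecreasing_seqP => N; rewrite /series/= big_nat_recr//= lerDl.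
  by rewrite divr_ge0// sqr_ge0.
exists (2 * C) => _ [N _ <-]; rewrite /series/= -mulr_sumr mulrC ler_wpM2r//.
rewrite -(@big_add1 _ _ _ 0%N N.+1 xpredT (fun a => a%:R ^- 2)).
case: N => [|N]; first by rewrite big_nil.
rewrite big_ltn// expr1n invr1.
have := @sum_inv_sqr_tail R 1 N.+2 isT.
by rewrite invr1; lra.
Qed.

Lemma sin_mulrn_eq0 (z : R) (n : nat) : sin z = 0 -> sin (n%:R * z) = 0.
Proof.
move=> sz; elim: n => [|n IH]; first by rewrite mul0r sin0.
by rewrite -natr1 mulrDl mul1r sinD IH sz mul0r mulr0 addr0.
Qed.

(** Abel summation: multiplied by [2 * sin (th / 2)], the sines telescope into
    cosines, and the remaining series is absolutely convergent.  If
    [sin (th / 2) = 0] all terms vanish. *)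
Lemma cvg_series_sin_div (th : R) :
  cvgn (series (fun a => sin (a.+1%:R * th) / a.+1%:R)).
Proof.
pose z := th / 2.
have thE : th = 2 * z by rewrite /z mulrC divfK.
have [sz|sz] := eqVneq (sin z) 0.
  apply: (@cvg_series_inv_sqr _ 0) => a.
  rewrite thE mulrA -natrM (sin_mulrn_eq0 _ sz) mul0r normr0.
  by rewrite mul0r.
pose c (a : nat) := cos (a%:R * th + z).
pose e (a : nat) : R := c a.+1 * (a.+2%:R^-1 - a.+1%:R^-1).
pose v (a : nat) : R := (2 * sin z)^-1 * (c 0%N - c a / a.+1%:R + series e a).
have -> : series (fun a => sin (a.+1%:R * th) / a.+1%:R) = v.
  apply/funext => N; rewrite /series/= /v.
  have s2 : 2 * sin z != 0 by rewrite mulf_neq0.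
  apply: (mulfI s2); rewrite mulVKf// mulr_sumr.
  elim: N => [|N IH].
    by rewrite /series/= !big_nil divr1 subrr add0r.
  rewrite big_nat_recr//= IH /series/= big_nat_recr//= /e.
  have key : 2 * sin z * sin (N.+1%:R * th) = c N - c N.+1.
    rewrite /c.
    have -> : N%:R * th + z = N.+1%:R * th - z by rewrite -(natr1 N) thE; ring.
    by rewrite cosB cosD; ring.
  rewrite mulrA key.
  by set S := \sum_(_ <= _ < _) _; ring.
apply: is_cvgMr.
have ce : cvgn (series e).
  apply: (@cvg_series_inv_sqr _ 1) => a; rewrite /e normrM.
  have a1 : 0 < a.+1%:R :> R by rewrite ltr0n.
  have a2 : 0 < a.+2%:R :> R by rewrite ltr0n.
  have -> : a.+2%:R^-1 - a.+1%:R^-1 = - (a.+2%:R * a.+1%:R)^-1 :> R.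
    by move: a2; rewrite -(natr1 a.+1) => a2; field; rewrite !gt_eqF.
  rewrite normrN [X in _ * X]ger0_norm ?invr_ge0 ?mulr_ge0//.
  apply: ler_pM => //.
  - by rewrite ler_norml cos_geN1 cos_le1.
  - rewrite lef_pV2 ?posrE ?mulr_gt0 ?exprn_gt0// expr2 ler_pM2r// ler_nat.
    by [].
have c0 : (fun a => c a / a.+1%:R) @ \oo --> (0 : R).
  apply/cvgr0Pnorm_le => eps e0.
  have H : (fun a => a.+1%:R^-1 : R) @ \oo --> (0 : R) := cvg_harmonic.
  move/cvgr0Pnorm_le : H => /(_ _ e0); apply: filterS => a H.
  apply: le_trans H; rewrite normrM ler_piMl//.
  by rewrite ler_norml cos_geN1 cos_le1.
apply: is_cvgD => //; apply: is_cvgB; first exact: is_cvg_cst.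
by apply/cvg_ex; exists 0.
Qed.

(** A product of three sines is a combination of sines, which reduces the Green
    series of SWE, only conditionally convergent, to [cvg_series_sin_div]. *)
Lemma phi_eigf_SWE (a : nat) (tau x y : R) : (0 < a)%N ->
  phi SWE a tau * eigf a x * eigf a y =
  (2 * pi)^-1 * (sin (a%:R * (pi * (tau + x - y))) / a%:R
    + sin (a%:R * (pi * (tau - x + y))) / a%:R
    - sin (a%:R * (pi * (tau - x - y))) / a%:R
    - sin (a%:R * (pi * (tau + x + y))) / a%:R).
Proof.
move=> a0; rewrite /phi /eigf !sqrt_lambda.
pose A := a%:R * pi * tau; pose B := a%:R * pi * x; pose C := a%:R * pi * y.
have -> : a%:R * (pi * (tau + x - y)) = A + B - C by rewrite /A /B /C; ring.
have -> : a%:R * (pi * (tau - x + y)) = A - B + C by rewrite /A /B /C; ring.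
have -> : a%:R * (pi * (tau - x - y)) = A - B - C by rewrite /A /B /C; ring.
have -> : a%:R * (pi * (tau + x + y)) = A + B + C by rewrite /A /B /C; ring.
rewrite -/A -/B -/C.
have -> : sin A / (a%:R * pi) * (Num.sqrt 2 * sin B) * (Num.sqrt 2 * sin C) =
    Num.sqrt 2 ^+ 2 * (sin A * sin B * sin C) / (a%:R * pi) by ring.
rewrite sqr_sqrt2 !(sinB, sinD, cosB, cosD).
have p0 : (pi : R) != 0 by rewrite gt_eqF// pi_gt0.
have a0' : (a%:R : R) != 0 by rewrite pnatr_eq0 -lt0n.
clearbody A B C; move: (pi) p0 => P p0.
by field; rewrite a0' p0.
Qed.

Definition green_term (E : spde) (tau x y : R) (a : nat) : R :=
  phi E a tau * eigf a x * eigf a y.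

Lemma cvg_green_term (E : spde) (tau x y : R) : 0 < tau ->
  cvgn (series (fun a => green_term E tau x y a.+1)).
Proof.
move=> tau0; case: E.
  apply: (@cvg_series_inv_sqr _ (2 / tau)) => a.
  rewrite /green_term /phi normrM (normrM (expR _)) -mulrA.
  have l0 : 0 < lambda a.+1 :> R by exact: lambda_gt0.
  have lt : 0 < lambda a.+1 * tau by exact: mulr_gt0.
  have e1 : expR (- lambda a.+1 * tau) <= (lambda a.+1 * tau)^-1.
    rewrite mulNr expRN lef_pV2 ?posrE ?expR_gt0//.
    by apply: le_trans (expR_ge1Dx _); lra.
  have e2 : `|eigf a.+1 x| * `|eigf a.+1 y| <= 2.
    rewrite -(@sqr_sqrt2 R) expr2; apply: ler_pM => //; exact: eigf_bounded.
  rewrite (ger0_norm (expR_ge0 _)).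
  apply: (le_trans (ler_pM (expR_ge0 _) _ e1 e2)); first exact: mulr_ge0.
  have a2 : 0 < a.+1%:R ^+ 2 :> R by rewrite exprn_gt0.
  rewrite [leLHS]mulrC -[leRHS]mulrA -invfM; apply: ler_wpM2l => //.
  rewrite lef_pV2 ?posrE//; last exact: mulr_gt0.
  by rewrite mulrC ler_pM2r//; exact: lambda_ge.
pose s (th : R) := fun a : nat => sin (a.+1%:R * th) / a.+1%:R.
have -> : (fun a => green_term SWE tau x y a.+1) =
    (2 * pi)^-1 *: (s (pi * (tau + x - y)) + s (pi * (tau - x + y))
                 - s (pi * (tau - x - y)) - s (pi * (tau + x + y))).
  by apply/funext => a; rewrite /green_term phi_eigf_SWE.
apply: is_cvg_seriesZ.
by do 2 (apply: is_cvg_seriesB; last exact: cvg_series_sin_div);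
  apply: is_cvg_seriesD; exact: cvg_series_sin_div.
Qed.

Lemma cvg_green (E : spde) (tau x y : R) : 0 < tau ->
  (fun N => \sum_(a < N) green_term E tau x y a.+1) @ \oo --> green E tau x y.
Proof.
move=> tau0; have H := @cvg_green_term E tau x y tau0.
have E1 : (fun N => \sum_(a < N) green_term E tau x y a.+1)
    = series (fun a => green_term E tau x y a.+1).
  by apply/funext => N; rewrite /series/= big_mkord.
rewrite E1 /green.
suff -> : limn (fun N => \sum_(1 <= a < N) phi E a tau * eigf a x * eigf a y) =
   limn (series (fun a => green_term E tau x y a.+1)) by exact: H.
apply/cvg_lim => //; rewrite -cvg_shiftS.
have -> : [sequence \sum_(1 <= a < n.+1) phi E a tau * eigf a x * eigf a y]_n
   = series (fun a => green_term E tau x y a.+1) by apply/funext => N; rewrite /series/= big_add1.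
exact: H.
Qed.

End green_series.

(** * The kernel *)

Section kernel.
Context {R : realType}.
Local Notation mu := (@lebesgue_measure R).
Local Notation mR := (measurableTypeR R).
Local Notation mu2 := (sfprod mu mu).

Definition kernel_sum (E : spde) (t : R) (N : nat) (x : R) (s y : R) : R :=
  \sum_(a < N) eigz a.+1 x * (timef E t a.+1 s * eigz a.+1 y).

(** The Green function extended by 0, so that the integrals over the domains
    depending on [t] become integrals over the plane.  It is a pointwise limit of the
    partial sums, hence measurable. *)
Definition kernel (E : spde) (t : R) (x : R) (s y : R) : R :=
  \1_`]0, 1[ x * \1_`]0, t[ s * \1_`]0, 1[ y * green E (t - s) x y.

Lemma eigz_ends (a : nat) (y : R) : ~~ (0 < y < 1) -> eigz a y = 0.
Proof.
move=> H; have [/andP[y0 y1]|] := boolP (0 < y <= 1); last exact: eigz_out.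
have -> : y = 1 by apply/eqP; rewrite eq_le y1 leNgt; apply: contra H => ->; rewrite y0.
by rewrite /eigz /eigf sqrt_lambda mulr1 sin_natpi !mulr0.
Qed.

Lemma cvg_kernel_sum E t x s y :
  kernel_sum E t N x s y @[N --> \oo] --> kernel E t x s y.
Proof.
have z0 : (forall N, kernel_sum E t N x s y = 0) -> kernel E t x s y = 0 ->
    kernel_sum E t N x s y @[N --> \oo] --> kernel E t x s y.
  by move=> H ->; under eq_fun do rewrite H; exact: cvg_cst.
have i0 (b : R) z : ~~ (0 < z < b) -> \1_`]0, b[ z = 0 :> R.
  by move=> H; rewrite indicE memNset//= in_itv/=; exact/negP.
have [xI|xI] := boolP (0 < x < 1); last first.
  apply: z0; last by rewrite /kernel (i0 1 x xI) !mul0r.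
  by move=> N; apply: big1 => a _; rewrite (eigz_ends _ xI) mul0r.
have [yI|yI] := boolP (0 < y < 1); last first.
  apply: z0; last by rewrite /kernel (i0 1 y yI) mulr0 mul0r.
  by move=> N; apply: big1 => a _; rewrite (eigz_ends _ yI) !mulr0.
have [sI|sI] := boolP (0 < s < t); last first.
  apply: z0; last by rewrite /kernel (i0 t s sI) mulr0 !mul0r.
  by move=> N; apply: big1 => a _; rewrite timef_out// mul0r mulr0.
have i1 (b : R) z : 0 < z < b -> \1_`]0, b[ z = 1 :> R.
  by move=> H; rewrite indicE mem_set//= in_itv/= H.
rewrite /kernel !i1// !mul1r.
have -> : (fun N => kernel_sum E t N x s y) =
    (fun N => \sum_(a < N) green_term E (t - s) x y a.+1).
  move: xI yI sI => /andP[x0 x1] /andP[y0 y1] /andP[s0 s1].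
  apply/funext => N; apply: eq_bigr => a _.
  by rewrite /green_term timef_in// !eigzE// ?ltW// mulrCA mulrA.
by apply: cvg_green; rewrite subr_gt0; case/andP: sI.
Qed.

Definition fun3 (f : R -> R -> R -> R) (z : mR * (mR * mR)) : R := f z.1 z.2.1 z.2.2.

Lemma measurable_kernel_sum E t N : measurable_fun setT (fun3 (kernel_sum E t N)).
Proof.
apply: measurable_sum => a; apply: measurable_funM.
  exact: (measurableT_comp (measurable_eigz _) measurable_fst).
have := measurable_tensor (measurable_timef E t a.+1) (measurable_eigz a.+1).
by move/measurableT_comp; apply; exact: measurable_snd.
Qed.

Lemma measurable_kernel E t : measurable_fun setT (fun3 (kernel E t)).
Proof.
apply: (measurable_fun_cvg (measurable_kernel_sum E t)) => z _.
exact: cvg_kernel_sum.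
Qed.

Lemma measurable_fun3 (f : R -> R -> R -> R) (x : R) :
  measurable_fun setT (fun3 f) -> measurable_fun setT (fun2 (f x)).
Proof. by move=> mf; exact: (measurableT_comp mf (measurable_pair1 x)). Qed.

Lemma integral_tensor_sqr (psi g : R -> R) : measurable_fun setT psi ->
  measurable_fun setT g ->
  (\int[mu2]_z ((psi z.1 * g z.2) ^+ 2)%:E =
   \int[mu]_s (psi s ^+ 2)%:E * \int[mu]_y (g y ^+ 2)%:E)%E.
Proof.
move=> mp mg; rewrite sfprod_tonelli; last 2 first.
- by apply/measurable_EFinP; apply: measurable_funX; exact: measurable_tensor mp mg.
- by move=> z; rewrite lee_fin sqr_ge0.
have mg2 : measurable_fun setT (fun y => (g y ^+ 2)%:E : \bar R).
  by apply/measurable_EFinP; exact: measurable_funX.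
have mp2 : measurable_fun setT (fun y => (psi y ^+ 2)%:E : \bar R).
  by apply/measurable_EFinP; exact: measurable_funX.
have J0 : (0 <= \int[mu]_y (g y ^+ 2)%:E)%E.
  by apply: integral_ge0 => y _; rewrite lee_fin sqr_ge0.
transitivity (\int[mu]_s ((psi s ^+ 2)%:E * \int[mu]_y (g y ^+ 2)%:E))%E; last first.
  by rewrite ge0_integralZr// => s _; rewrite lee_fin sqr_ge0.
apply: eq_integral => s _ /=.
transitivity (\int[mu]_y ((psi s ^+ 2)%:E * (g y ^+ 2)%:E))%E.
  by apply: eq_integral => y _; rewrite -EFinM exprMn.
by rewrite ge0_integralZl// ?lee_fin ?sqr_ge0// => y _; rewrite lee_fin sqr_ge0.
Qed.

Lemma sum_inv_sqr_from (M N : nat) :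
  \sum_(a < N) (M <= a)%N%:R / a.+1%:R ^+ 2 <= 2 / M.+1%:R :> R.
Proof.
suff : \sum_(a < N) (M <= a)%N%:R / a.+1%:R ^+ 2 <=
    2 * (M.+1%:R^-1 - (maxn M N).+1%:R^-1) :> R.
  move=> H; apply: le_trans H _; rewrite ler_wpM2l// gerBl invr_ge0.
  exact: ler0n.
elim: N => [|N IH]; first by rewrite big_ord0 maxn0 subrr mulr0.
rewrite big_ord_recr/=; have [MN|NM] := leqP M N; last first.
  rewrite mul0r addr0 (maxn_idPl NM).
  by move: IH; rewrite (maxn_idPl (ltnW NM)).
rewrite (maxn_idPr (leqW MN)); move: IH; rewrite (maxn_idPr MN) => IH.
have a1 : 0 < N.+1%:R :> R by rewrite ltr0n.
have a2 : N.+2%:R = N.+1%:R + 1 :> R by rewrite natr1.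
have a3 : 1 <= N.+1%:R :> R by rewrite ler1n.
rewrite a2; set q : R := N.+1%:R in IH a1 a3 *.
have key : 1 / q ^+ 2 <= 2 * (q^-1 - (q + 1)^-1).
  have -> : 2 * (q^-1 - (q + 1)^-1) = 2 / (q * (q + 1)) by field; rewrite !gt_eqF//; lra.
  rewrite ler_pdivrMr ?exprn_gt0// mulrAC ler_pdivlMr ?mulr_gt0//; last by lra.
  nra.
have -> : (true%:R : R) = 1 by [].
by apply: (le_trans (lerD IH key)); rewrite -mulrDr addrA subrK.
Qed.

Variables (E : spde) (T t : R).
Hypothesis t0 : 0 <= t.
Hypothesis tT : t <= T.

Lemma integral_mode_sqr (a : nat) : (0 < a)%N ->
  (\int[mu2]_z ((timef E t a z.1 * eigz a z.2) ^+ 2)%:E <= ((1 + T) / a%:R ^+ 2)%:E)%E.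
Proof.
move=> a0; rewrite (integral_tensor_sqr (measurable_timef E t a) (measurable_eigz a)).
have -> : (\int[mu]_y (eigz a y ^+ 2)%:E = 1)%E.
  by have := @eigz_orthonormal R a a a0 a0; rewrite eqxx.
by rewrite mule1; exact: integral_timef_sqr.
Qed.

Lemma kernel_sum_l2 (M N : nat) : (M <= N)%N ->
  (\int[mu]_x \int[mu2]_z ((kernel_sum E t N x z.1 z.2 - kernel_sum E t M x z.1 z.2)%R ^+ 2)%:E
   <= (2 * (1 + T) / M.+1%:R)%:E)%E.
Proof.
move=> MN.
pose cf (a : nat) (z : mR * mR) : R := (M <= a)%N%:R * (timef E t a.+1 z.1 * eigz a.+1 z.2).
have mcf a : measurable_fun setT (cf a).
  apply: measurable_funM => //.
  exact: (measurable_tensor (measurable_timef E t a.+1) (measurable_eigz a.+1)).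
have D x z : kernel_sum E t N x z.1 z.2 - kernel_sum E t M x z.1 z.2 =
    \sum_(a < N) eigz a.+1 x * cf a z.
  have H a : (M <= a)%N%:R * (eigz a.+1 x * (timef E t a.+1 z.1 * eigz a.+1 z.2))
     = eigz a.+1 x * cf a z by rewrite /cf mulrCA.
  rewrite /kernel_sum -(eq_bigr _ (fun (a : 'I_N) _ => H a)).
  rewrite -!(big_mkord xpredT (fun a => eigz a.+1 x * (timef E t a.+1 z.1 * eigz a.+1 z.2))).
  rewrite -(big_mkord xpredT (fun a => (M <= a)%N%:R * (eigz a.+1 x * (timef E t a.+1 z.1 * eigz a.+1 z.2)))).
  rewrite (big_cat_nat _ MN)//= [in RHS](big_cat_nat (n := M))//=.
  have -> : \sum_(0 <= a < M) (M <= a)%N%:R * (eigz a.+1 x * (timef E t a.+1 z.1 * eigz a.+1 z.2)) = 0.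
    rewrite big_nat_cond big1// => a /andP[/andP[_ aM] _].
    by rewrite leqNgt aM mul0r.
  rewrite addrAC subrr !add0r.
  by apply: eq_big_nat => a /andP[Ma _]; rewrite Ma mul1r.
under eq_integral => x _ do under eq_integral => z _ do rewrite D.
rewrite (parseval_tonelli mu2 N mcf).
apply: (@le_trans _ _ (\sum_(a < N) ((1 + T) * ((M <= a)%N%:R / a.+1%:R ^+ 2))%:E)%E).
  apply: lee_sum => a _; rewrite /cf; case: (M <= a)%N.
    under eq_integral => z _ do rewrite mul1r.
    by rewrite mul1r; exact: integral_mode_sqr.
  under eq_integral => z _ do rewrite mul0r expr0n.
  by rewrite integral0 mul0r mulr0.
rewrite sumEFin lee_fin -mulr_sumr.
have := sum_inv_sqr_from M N; have T1 : 0 <= 1 + T by rewrite addr_ge0// (le_trans t0).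
move=> H; apply: (le_trans (ler_wpM2l T1 H)).
by rewrite mulrA (mulrC (1 + T)).
Qed.

(** Parseval in [x] bounds the distance between two partial sums by the tail of
    [\sum_a a^(-2)]; Fatou's lemma extends the bound to the pointwise limit. *)
Lemma kernel_l2 (M : nat) :
  (\int[mu]_x \int[mu2]_z ((kernel E t x z.1 z.2 - kernel_sum E t M x z.1 z.2)%R ^+ 2)%:E
   <= (2 * (1 + T) / M.+1%:R)%:E)%E.
Proof.
have mS N := measurable_kernel_sum E t N.
have mK := measurable_kernel E t.
have e (f g : R -> R -> R -> R) : measurable_fun setT (fun3 f) -> measurable_fun setT (fun3 g) ->
  (\int[mu]_x \int[mu2]_z ((f x z.1 z.2 - g x z.1 z.2)%R ^+ 2)%:E =
   \int[sfprod mu mu2]_z ((fun3 f z - fun3 g z)%R ^+ 2)%:E)%E.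
  move=> mf mg; rewrite sfprod_tonelli//; last by move=> z; rewrite lee_fin sqr_ge0.
  by apply/measurable_EFinP; apply: measurable_funX; exact: measurable_funB.
rewrite e//.
apply: (ae_fatou_le (F := fun N z => ((fun3 (kernel_sum E t N) z - fun3 (kernel_sum E t M) z) ^+ 2)%:E)).
- by move=> N; apply/measurable_EFinP; apply: measurable_funX; exact: measurable_funB.
- by move=> N z; rewrite lee_fin sqr_ge0.
- by apply/measurable_EFinP; apply: measurable_funX; exact: measurable_funB.
- by move=> z; rewrite lee_fin sqr_ge0.
- apply: aeW => z; apply: cvg_EFin; first by near=> q.
  by apply: cvgM; apply: cvgB; (try exact: cvg_cst); exact: cvg_kernel_sum.
- exists M => // N /= MN; rewrite -e//; exact: kernel_sum_l2.
Unshelve. all: by end_near. Qed.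

Lemma kernel_sqr_l1 :
  (\int[mu]_x \int[mu2]_z (kernel E t x z.1 z.2 ^+ 2)%:E <= (2 * (1 + T))%:E)%E.
Proof.
have := kernel_l2 0; rewrite divr1.
under eq_integral => x _ do under eq_integral => z _ do rewrite /kernel_sum big_ord0 subr0.
by [].
Qed.

End kernel.

(** * Sections and products *)

Section products.
Context {d1 d2 : measure_display} {X : measurableType d1} {Z : measurableType d2}
  {R : realType}.
Variables (m1 : {sigma_finite_measure set X -> \bar R})
  (m2 : {sigma_finite_measure set Z -> \bar R}).

Lemma ae_sfprod_fst (A : X -> Prop) : {ae m1, forall x, A x} ->
  {ae sfprod m1 m2, forall z, A z.1}.
Proof.
move=> [B [mB B0 AB]]; exists (B `*` setT); split.
- exact: measurableX.
- rewrite /sfprod product_measure1E//.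
  by suff E : m1 B = 0%E by rewrite [Y in (Y * _)%E]E mul0e.
- by move=> z /= nA; split => //; apply: AB.
Qed.

Lemma measurable_fubini_section (f : X * Z -> \bar R) : measurable_fun setT f ->
  measurable_fun setT (fubini_F m2 f).
Proof.
move=> mf.
rewrite (_ : fubini_F m2 f = fun x => (fubini_F m2 f^\+%E x - fubini_F m2 f^\-%E x)%E); last first.
  apply/funext => x; rewrite /fubini_F [LHS]integralE.
  by congr (_ - _)%E; apply: eq_integral => z _; rewrite ?funeposE ?funenegE.
by apply: emeasurable_funB; apply: measurable_fun_fubini_tonelli_F => //;
  [exact: measurable_funepos|exact: measurable_funeneg].
Qed.

Lemma measurable_Rintegral_section (F : X * Z -> R) : measurable_fun setT F ->
  measurable_fun setT (fun x => \int[m2]_z F (x, z)).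
Proof.
move=> mF; apply: (measurableT_comp (fine_measurable measurableT)).
exact: (@measurable_fubini_section (EFin \o F) ((measurable_EFinP _ _).2 mF)).
Qed.

Lemma Rintegral_sfprod (F : X * Z -> R) :
  (sfprod m1 m2).-integrable setT (EFin \o F) ->
  \int[m1]_x \int[m2]_z F (x, z) = \int[sfprod m1 m2]_z F z.
Proof.
move=> iF; rewrite /Rintegral; congr fine.
have iF' : (m1 \x m2)%E.-integrable setT (EFin \o F) by exact: iF.
rewrite -[RHS](integral12_prod_meas1 iF').
have mF : measurable_fun setT F by apply/measurable_EFinP; case/integrableP: iF.
apply: ae_eq_integral => //.
- apply/measurable_EFinP; exact: measurable_Rintegral_section.
- by apply: measurable_fubini_section; exact/measurable_EFinP.
have := ae_integrable1 iF'; apply: ae_mono => x ix _.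
by rewrite /fubini_F fineK//; exact: integrable_fin_num.
Qed.

End products.

Section integrals.
Context {d : measure_display} {X : measurableType d} {R : realType}.
Variable m : {measure set X -> \bar R}.

Lemma integrable_mul_sqr (f g : X -> R) : measurable_fun setT f ->
  measurable_fun setT g -> (\int[m]_x (f x ^+ 2)%:E < +oo)%E ->
  (\int[m]_x (g x ^+ 2)%:E < +oo)%E ->
  m.-integrable setT (fun x => (f x * g x)%:E).
Proof.
move=> mf mg.
have f0 : (0 <= \int[m]_x (f x ^+ 2)%:E)%E by apply: integral_ge0 => x _; rewrite lee_fin sqr_ge0.
have g0 : (0 <= \int[m]_x (g x ^+ 2)%:E)%E by apply: integral_ge0 => x _; rewrite lee_fin sqr_ge0.
case E1 : (\int[m]_x (f x ^+ 2)%:E)%E f0 => [a| |]// a0 _.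
case E2 : (\int[m]_x (g x ^+ 2)%:E)%E g0 => [b| |]// b0 _.
rewrite !lee_fin in a0 b0.
have le1 : (\int[m]_x (f x ^+ 2)%:E <= a%:E)%E by rewrite E1.
have le2 : (\int[m]_x (g x ^+ 2)%:E <= b%:E)%E by rewrite E2.
apply/integrableP; split; first by apply/measurable_EFinP; exact: measurable_funM.
exact: le_lt_trans (integral_cauchy_schwarz mf mg a0 b0 le1 le2) (ltry _).
Qed.

Lemma Rintegral_cauchy_schwarz (f g : X -> R) (a b : R) : measurable_fun setT f ->
  measurable_fun setT g -> 0 <= a -> 0 <= b ->
  (\int[m]_x (f x ^+ 2)%:E <= a%:E)%E ->
  (\int[m]_x (g x ^+ 2)%:E <= b%:E)%E ->
  `|\int[m]_x (f x * g x)| <= Num.sqrt a * Num.sqrt b.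
Proof.
move=> mf mg a0 b0 fa gb.
have ifg : m.-integrable setT (fun x => (f x * g x)%:E).
  by apply: integrable_mul_sqr => //; [exact: le_lt_trans fa (ltry _)|exact: le_lt_trans gb (ltry _)].
rewrite -lee_fin; apply: le_trans (integral_cauchy_schwarz mf mg a0 b0 fa gb).
apply: (@le_trans _ _ (\int[m]_x `|f x * g x|)%:E).
  by rewrite lee_fin; exact: le_normr_Rintegral.
rewrite /Rintegral fineK//.
apply: integrable_fin_num => //.
by have := integrable_abse ifg.
Qed.

Lemma Rintegral_sum (I : finType) (F : I -> X -> R) :
  (forall i, m.-integrable setT (EFin \o F i)) ->
  \int[m]_x (\sum_i F i x) = \sum_i \int[m]_x F i x.
Proof.
move=> iF; rewrite /Rintegral.
under eq_integral => x _ do rewrite -sumEFin.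
rewrite (integral_sum measurableT iF).
transitivity (fine (\sum_i (fine (\int[m]_x (F i x)%:E))%:E)%E).
  by congr fine; apply: eq_bigr => i _; rewrite fineK//; exact: (integrable_fin_num measurableT (iF i)).
by rewrite sumEFin.
Qed.

End integrals.

(** * Projection on the functions constant on cells *)

Section projection.
Context {R : realType}.
Local Notation mu := (@lebesgue_measure R).
Local Notation mR := (measurableTypeR R).
Local Notation mu2 := (sfprod mu mu).
Variables (k h : R) (m n : nat).
Hypothesis k0 : 0 < k.
Hypothesis h0 : 0 < h.

Definition cell2 (i j : nat) (z : mR * mR) : R :=
  itvind (i%:R * k) (i.+1%:R * k) z.1 * itvind (j%:R * h) (j.+1%:R * h) z.2.

Definition cell_coef (f : R -> R -> R) (i j : nat) : R :=
  (k * h)^-1 * \int[mu2]_z (f z.1 z.2 * cell2 i j z).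

Definition proj (f : R -> R -> R) (s y : R) : R :=
  \sum_(i < m) \sum_(j < n) cell_coef f i j * cell2 i j (s, y).

Lemma measurable_cell2 i j : measurable_fun setT (cell2 i j).
Proof. exact: measurable_itvind2. Qed.

Lemma cell_le (j : nat) (l : R) : 0 < l -> j%:R * l <= j.+1%:R * l.
Proof. by move=> l0; rewrite ler_wpM2r ?(ltW l0)// ler_nat. Qed.

Lemma cell_length (j : nat) (l : R) : j.+1%:R * l - j%:R * l = l.
Proof. by rewrite -(natr1 j) mulrDl mul1r addrAC subrr add0r. Qed.

Lemma integral_cell2_sqr i j : (\int[mu2]_z (cell2 i j z ^+ 2)%:E = (k * h)%:E)%E.
Proof.
rewrite (integral_tensor_sqr (measurable_itvind _ _) (measurable_itvind _ _)).
under eq_integral => s _ do rewrite itvind_sqr.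
under [X in (_ * X)%E]eq_integral => s _ do rewrite itvind_sqr.
by rewrite !integral_itvind ?cell_le// !cell_length -EFinM.
Qed.

Lemma integrable_cell2 (f : R -> R -> R) i j : measurable_fun setT (fun2 f) ->
  (\int[mu2]_z (f z.1 z.2 ^+ 2)%:E < +oo)%E ->
  mu2.-integrable setT (fun z => (f z.1 z.2 * cell2 i j z)%:E).
Proof.
move=> mf fi; apply: (integrable_mul_sqr (f := fun2 f)) => //.
- exact: measurable_cell2.
- by rewrite integral_cell2_sqr ltry.
Qed.

Lemma cell_coefB (f g : R -> R -> R) i j : measurable_fun setT (fun2 f) ->
  measurable_fun setT (fun2 g) ->
  (\int[mu2]_z (f z.1 z.2 ^+ 2)%:E < +oo)%E ->
  (\int[mu2]_z (g z.1 z.2 ^+ 2)%:E < +oo)%E ->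
  cell_coef f i j - cell_coef g i j = cell_coef (fun s y => f s y - g s y) i j.
Proof.
move=> mf mg fi gi; rewrite /cell_coef -mulrBr; congr (_ * _).
rewrite -RintegralB//; try exact: integrable_cell2.
by apply: eq_Rintegral => z _; rewrite mulrBl.
Qed.

Lemma cell_coef_le (f : R -> R -> R) (a : R) i j : measurable_fun setT (fun2 f) ->
  0 <= a -> (\int[mu2]_z (f z.1 z.2 ^+ 2)%:E <= a%:E)%E ->
  `|cell_coef f i j| <= (k * h)^-1 * (Num.sqrt a * Num.sqrt (k * h)).
Proof.
move=> mf a0 fa; rewrite /cell_coef normrM ger0_norm ?invr_ge0 ?(ltW (mulr_gt0 k0 h0))//.
apply: ler_wpM2l; first by rewrite invr_ge0 mulr_ge0// ltW.
apply: (Rintegral_cauchy_schwarz (m := mu2) (f := fun2 f) mf (measurable_cell2 i j)) => //.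
- by rewrite mulr_ge0// ltW.
- by rewrite integral_cell2_sqr.
Qed.

Lemma cell_coef_tensor (psi g : R -> R) (M : R) i j : measurable_fun setT psi ->
  measurable_fun setT g -> (forall s, `|psi s| <= M) -> (forall y, `|g y| <= M) ->
  (\int[mu2]_z ((psi z.1 * g z.2) ^+ 2)%:E < +oo)%E ->
  cell_coef (fun s y => psi s * g y) i j = cell_avg k psi i * cell_avg h g j.
Proof.
move=> mp mg pM gM fi.
have restr (l : R) (e : R -> R) q : \int[mu]_(u in `]q%:R * l, q.+1%:R * l]) e u =
    \int[mu]_u (e u * itvind (q%:R * l) (q.+1%:R * l) u).
  rewrite Rintegral_mkcond; apply: eq_Rintegral => u _.
  by rewrite patchE /itvind indicE; case: ifP => _; rewrite ?mulr1 ?mulr0.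
have icell (l : R) (e : R -> R) q : 0 < l -> measurable_fun setT e -> (forall s, `|e s| <= M) ->
    mu.-integrable setT (EFin \o (fun u => e u * itvind (q%:R * l) (q.+1%:R * l) u)).
  move=> l0 me eM; have := cell_integrable q l0 me eM.
  have [H _] := @integrable_mkcond _ mR R mu `]q%:R * l, q.+1%:R * l]%classic (EFin \o e) (measurable_itv _).
  move=> /H.
  congr (mu.-integrable setT); apply/funext => u; rewrite patchE /itvind /= indicE.
  by case: ifP => _; rewrite ?mulr1 ?mulr0.
have mf := measurable_tensor mp mg.
rewrite /cell_coef -(Rintegral_sfprod (integrable_cell2 i j mf fi)) /cell_avg !restr.
rewrite invfM mulrACA; congr (_ * _).
rewrite -RintegralZr//; last exact: icell.
apply: eq_Rintegral => s _ /=; rewrite -RintegralZl//; last exact: icell.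
by apply: eq_Rintegral => y _; rewrite /cell2/=; ring.
Qed.

Lemma proj_tensor (psi g : R -> R) (M : R) s y : measurable_fun setT psi ->
  measurable_fun setT g -> (forall s, `|psi s| <= M) -> (forall y, `|g y| <= M) ->
  (\int[mu2]_z ((psi z.1 * g z.2) ^+ 2)%:E < +oo)%E ->
  proj (fun s y => psi s * g y) s y = cavg k m psi s * cavg h n g y.
Proof.
move=> mp mg pM gM fi; rewrite /proj /cavg mulr_suml; apply: eq_bigr => i _.
rewrite mulr_sumr; apply: eq_bigr => j _.
by rewrite (cell_coef_tensor i j mp mg pM gM fi) /cell2/= mulrACA.
Qed.

Lemma cell_coef_sum (N : nat) (c : nat -> R) (f : nat -> R -> R -> R) i j :
  (forall a, measurable_fun setT (fun2 (f a))) ->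
  (forall a, (\int[mu2]_z (f a z.1 z.2 ^+ 2)%:E < +oo)%E) ->
  cell_coef (fun s y => \sum_(a < N) c a * f a s y) i j =
  \sum_(a < N) c a * cell_coef (f a) i j.
Proof.
move=> mf fi; rewrite /cell_coef.
transitivity ((k * h)^-1 * \int[mu2]_z (\sum_(a < N) c a * (f a z.1 z.2 * cell2 i j z))).
  by congr (_ * _); apply: eq_Rintegral => z _; rewrite mulr_suml; apply: eq_bigr => a _; rewrite mulrA.
have ifa a := integrable_cell2 i j (mf a) (fi a).
rewrite (Rintegral_sum (m := mu2) (F := fun (a : 'I_N) z => c a * (f a z.1 z.2 * cell2 i j z))).
  rewrite mulr_sumr; apply: eq_bigr => a _; rewrite (RintegralZl (c a) measurableT (ifa a)).
  by rewrite mulrCA.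
move=> a; have := integrableZl measurableT (c a) (ifa a).
by apply: eq_integrable => // z _; rewrite /= EFinM.
Qed.

Lemma measurable_proj (f : R -> R -> R -> R) : measurable_fun setT (fun3 f) ->
  measurable_fun setT (fun3 (fun x => proj (f x))).
Proof.
move=> mf; apply: measurable_sum => i; apply: measurable_sum => j.
apply: measurable_funM; last first.
  exact: (measurableT_comp (measurable_cell2 i j) measurable_snd).
apply: measurable_funM => //.
apply: (measurableT_comp _ measurable_fst (f := fun x => \int[mu2]_z (f x z.1 z.2 * cell2 i j z))).
apply: (@measurable_Rintegral_section _ _ _ _ R mu2 (fun w => fun3 f w * cell2 i j w.2)).
by apply: measurable_funM => //; exact: (measurableT_comp (measurable_cell2 i j) measurable_snd).
Qed.

End projection.

(** * Projection of the kernel *)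

Lemma ae_mono2 (d : measure_display) (X : measurableType d) (R : realType)
    (m : {measure set X -> \bar R}) (A B C : X -> Prop) :
  (forall x, A x -> B x -> C x) ->
  {ae m, forall x, A x} -> {ae m, forall x, B x} -> {ae m, forall x, C x}.
Proof. by move=> ABC aA aB; move: aA aB; apply: filterS2. Qed.

Lemma ae_mono3 (d : measure_display) (X : measurableType d) (R : realType)
    (m : {measure set X -> \bar R}) (A B C D : X -> Prop) :
  (forall x, A x -> B x -> C x -> D x) ->
  {ae m, forall x, A x} -> {ae m, forall x, B x} -> {ae m, forall x, C x} ->
  {ae m, forall x, D x}.
Proof. by move=> ABC aA aB aC; move: aA aB aC; apply: filterS3. Qed.

Section kernel_projection.
Context {R : realType}.
Local Notation mu := (@lebesgue_measure R).
Local Notation mR := (measurableTypeR R).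
Local Notation mu2 := (sfprod mu mu).

Lemma ae_lt_pinfty (d : measure_display) (X : measurableType d)
    (m : {measure set X -> \bar R}) (f : X -> \bar R) : measurable_fun setT f ->
  (forall x, (0 <= f x)%E) -> (\int[m]_x f x < +oo)%E -> {ae m, forall x, (f x < +oo)%E}.
Proof.
move=> mf f0 fi.
have ifin : m.-integrable setT f.
  by apply: integrable_of_fin_num => //; rewrite ge0_fin_numE// integral_ge0.
have := integrable_ae measurableT ifin; apply: ae_mono => x /(_ I) fx.
by rewrite -ge0_fin_numE.
Qed.

Variables (E : spde) (T t : R) (m n : nat).
Hypothesis T0 : 0 < T.
Hypothesis t0 : 0 <= t.
Hypothesis tT : t <= T.
Hypothesis m0 : (0 < m)%N.
Hypothesis n0 : (0 < n)%N.

Local Notation k := (T / m%:R).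
Local Notation h := (n%:R^-1 : R).

Definition kproj (x : R) : R -> R -> R := proj k h m n (kernel E t x).

Let k0 : 0 < k. Proof. by rewrite divr_gt0// ltr0n. Qed.
Let h0 : 0 < h. Proof. by rewrite invr_gt0 ltr0n. Qed.

Lemma measurable_kproj : measurable_fun setT (fun3 kproj).
Proof. by apply: measurable_proj; exact: measurable_kernel. Qed.

(** A partial sum is a combination of tensor products, on which the projection
    acts by averaging each factor. *)
Lemma proj_kernel_sum (N : nat) (x s y : R) :
  kernel_sum E t N x s y - proj k h m n (kernel_sum E t N x) s y =
  \sum_(a < N) eigz a.+1 x * wz_mode E T t m n a.+1 s y.
Proof.
pose f (a : nat) (s y : R) := timef E t a.+1 s * eigz a.+1 y.
have mf a : measurable_fun setT (fun2 (f a)).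
  exact: measurable_tensor (measurable_timef E t a.+1) (measurable_eigz a.+1).
have fi a : (\int[mu2]_z (f a z.1 z.2 ^+ 2)%:E < +oo)%E.
  by apply: le_lt_trans (integral_mode_sqr E t0 tT (ltn0Sn a)) _; exact: ltry.
have s2 : 1 <= Num.sqrt 2 :> R by rewrite -[leLHS]sqrtr1 ler_sqrt//; lra.
have pf a : proj k h m n (f a) s y = cavg k m (timef E t a.+1) s * cavg h n (eigz a.+1) y.
  apply: (@proj_tensor R k h m n k0 h0 _ _ (Num.sqrt 2)) => //.
  - exact: measurable_timef.
  - exact: measurable_eigz.
  - by move=> u; apply: le_trans s2; exact: timef_bounded.
  - exact: eigz_bounded.
  - exact: fi.
have -> : proj k h m n (kernel_sum E t N x) s y = \sum_(a < N) eigz a.+1 x * proj k h m n (f a) s y.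
  rewrite /proj.
  transitivity (\sum_(i < m) \sum_(j < n) \sum_(a < N) eigz a.+1 x * (cell_coef k h (f a) i j * cell2 k h i j (s, y))).
    apply: eq_bigr => i _; apply: eq_bigr => j _.
    rewrite (cell_coef_sum k0 h0 N (fun a => eigz a.+1 x) i j mf fi) mulr_suml.
    by apply: eq_bigr => a _; rewrite mulrA.
  under eq_bigr => i _ do rewrite exchange_big.
  rewrite exchange_big; apply: eq_bigr => a _.
  rewrite mulr_sumr; apply: eq_bigr => i _; rewrite mulr_sumr.
  by [].
rewrite /kernel_sum -sumrB; apply: eq_bigr => a _.
by rewrite pf -mulrBr.
Qed.

Lemma ae_kernel_sqr : {ae mu, forall x, (\int[mu2]_z (kernel E t x z.1 z.2 ^+ 2)%:E < +oo)%E}.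
Proof.
apply: (@ae_lt_pinfty _ mR mu (fun x => \int[mu2]_z (kernel E t x z.1 z.2 ^+ 2)%:E)%E).
- apply: (measurable_fun_fubini_tonelli_F (m2 := mu2) (fun w => (fun3 (kernel E t) w ^+ 2)%:E)).
    by apply/measurable_EFinP; apply: measurable_funX; exact: measurable_kernel.
  by move=> w; rewrite lee_fin sqr_ge0.
- by move=> x; apply: integral_ge0 => z _; rewrite lee_fin sqr_ge0.
- exact: le_lt_trans (kernel_sqr_l1 E t0 tT) (ltry _).
Qed.

Lemma ae_kernel_sum_sqr : {ae mu, forall x, forall N,
  (\int[mu2]_z (kernel_sum E t N x z.1 z.2 ^+ 2)%:E < +oo)%E}.
Proof.
apply: ae_foralln => N.
apply: (@ae_lt_pinfty _ mR mu (fun x => \int[mu2]_z (kernel_sum E t N x z.1 z.2 ^+ 2)%:E)%E).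
- apply: (measurable_fun_fubini_tonelli_F (m2 := mu2) (fun w => (fun3 (kernel_sum E t N) w ^+ 2)%:E)).
    by apply/measurable_EFinP; apply: measurable_funX; exact: measurable_kernel_sum.
  by move=> w; rewrite lee_fin sqr_ge0.
- by move=> x; apply: integral_ge0 => z _; rewrite lee_fin sqr_ge0.
- have := kernel_sum_l2 E t0 tT (leq0n N).
  have z0 x s y : kernel_sum E t 0 x s y = 0 by rewrite /kernel_sum big_ord0.
  rewrite [X in (X <= _)%E -> _](_ : _ =
    (\int[mu]_x \int[mu2]_z (kernel_sum E t N x z.1 z.2 ^+ 2)%:E)%E); last first.
    by apply: eq_integral => x _; apply: eq_integral => z _; rewrite z0 subr0.
  by move/le_lt_trans; apply; exact: ltry.
Qed.

(** The coefficients of the projection are continuous for the [L^2] norm in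
    [(s, y)], and along a subsequence the partial sums converge in this norm for
    almost every [x]. *)
Lemma kernel_subseq : exists phi : nat -> nat, (forall q, (q <= phi q)%N) /\
  {ae mu, forall x, forall s y,
    kernel_sum E t (phi q) x s y - proj k h m n (kernel_sum E t (phi q) x) s y
      @[q --> \oo] --> kernel E t x s y - kproj x s y}.
Proof.
pose F (N : nat) (x : mR) : \bar R :=
  (\int[mu2]_z ((kernel E t x z.1 z.2 - kernel_sum E t N x z.1 z.2)%R ^+ 2)%:E)%E.
have mK := measurable_kernel E t.
have mS N := measurable_kernel_sum E t N.
have mF N : measurable_fun setT (F N).
  apply: (measurable_fun_fubini_tonelli_F (m2 := mu2) (fun w => ((fun3 (kernel E t) w - fun3 (kernel_sum E t N) w) ^+ 2)%:E)).
    by apply/measurable_EFinP; apply: measurable_funX; exact: measurable_funB.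
  by move=> w; rewrite lee_fin sqr_ge0.
have F0 N x : (0 <= F N x)%E by apply: integral_ge0 => z _; rewrite lee_fin sqr_ge0.
have cF : (\int[mu]_x F N x)%E @[N --> \oo] --> 0%E.
  apply/cvge0P => [N|e e0]; first exact: integral_ge0.
  near=> N; apply: le_trans (kernel_l2 E t0 tT N) _; rewrite lee_fin ler_pdivrMr//.
  rewrite [leRHS]mulrC -ler_pdivrMr//; apply: (@le_trans _ _ N%:R); last by rewrite ler_nat.
  by near: N; exact: nbhs_infty_ger.
have [phi [phige aeF]] := ae_cvg0_subseq mF F0 cF.
exists phi; split => //.
have kh0 : 0 < k * h by exact: mulr_gt0.
apply: ae_mono3 aeF ae_kernel_sqr ae_kernel_sum_sqr => x Fx Kx Sx s y.
have mKx := measurable_fun3 x mK.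
have mSx N := measurable_fun3 x (mS N).
apply: cvgB.
  have cphi : phi q @[q --> \oo] --> \oo.
    apply/cvgnyPge => A; near=> q; apply: leq_trans (phige q).
    by near: q; exists A.
  exact: (cvg_comp _ _ cphi (@cvg_kernel_sum R E t x s y)).
apply: (cvg_big (op := +%R)) => [z|i _]; first exact: add_continuous.
apply: (cvg_big (op := +%R)) => [z|j _]; first exact: add_continuous.
apply: cvgM; last exact: cvg_cst.
apply: cvg_sqr0; apply/cvge0P => [q|e e0]; first by rewrite lee_fin sqr_ge0.
have [H _] := @cvge0P R (fun q => F (phi q) x) (fun q => F0 (phi q) x).
have := H Fx (e * (k * h)) (mulr_gt0 e0 kh0); apply: filterS => q Fq.
rewrite -sqrrN opprB (cell_coefB k0 h0 i j mKx (mSx _) Kx (Sx _)).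
set d := cell_coef _ _ _ _ _.
have dle : `|d| <= (k * h)^-1 * (Num.sqrt (e * (k * h)) * Num.sqrt (k * h)).
  apply: cell_coef_le => //; last by rewrite ltW// mulr_gt0.
  exact: measurable_funB mKx (mSx _).
rewrite lee_fin -real_normK ?num_real//.
apply: (@le_trans _ _ (((k * h)^-1 * (Num.sqrt (e * (k * h)) * Num.sqrt (k * h))) ^+ 2)).
  by apply: lerXn2r; rewrite ?nnegrE// (le_trans _ dle).
rewrite !exprMn !sqr_sqrtr ?(ltW kh0) ?(ltW (mulr_gt0 e0 kh0))//.
rewrite le_eqVlt; apply/orP; left; apply/eqP.
by move: (k * h) kh0 => z z0; field; rewrite gt_eqF.
Unshelve. all: by end_near. Qed.

Variable rho : R -> R.
Hypothesis mrho : measurable_fun setT rho.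
Hypothesis rho0 : forall x, 0 <= rho x.
Hypothesis rho1 : forall x, rho x <= 1.
Variable c : R.
Hypothesis c0 : 0 < c.
Hypothesis c1 : c <= 1.
Hypothesis rhoH : forall l, 0 <= l -> l <= 1 ->
  (\int[mu]_x (2 * Num.min (rho x) l)%:E = (l `^ c)%:E)%E.

Lemma measurable_incr3 (f : R -> R -> R -> R) : measurable_fun setT (fun3 f) ->
  measurable_fun setT (fun w : mR * (mR * (mR * mR)) => (incr rho (f w.1) w.2 ^+ 2)%:E).
Proof.
move=> mf; apply/measurable_EFinP; apply: measurable_funX; apply: measurable_funB.
- apply: (measurableT_comp mf (g := fun w : mR * (mR * (mR * mR)) => (w.1, (w.2.1, w.2.2.2 + rho w.2.2.1)) : mR * (mR * mR))).
  apply: measurable_fun_pair; first exact: measurable_fst.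
  exact: (measurableT_comp (measurable_shift2 mrho) measurable_snd).
- apply: (measurableT_comp mf (g := fun w : mR * (mR * (mR * mR)) => (w.1, (w.2.1, w.2.2.2)) : mR * (mR * mR))).
  apply: measurable_fun_pair; first exact: measurable_fst.
  apply: (measurableT_comp _ measurable_snd (f := fun z : mR * (mR * mR) => (z.1, z.2.2) : mR * mR)).
  apply: measurable_fun_pair; first exact: measurable_fst.
  exact: (measurableT_comp measurable_snd measurable_snd).
Qed.

Lemma measurable_incr_form (f : R -> R -> R -> R) : measurable_fun setT (fun3 f) ->
  measurable_fun setT (fun x : mR => incr_form rho (f x)).
Proof.
move=> mf.
apply: (measurable_fun_fubini_tonelli_F (m2 := sfprod mu mu2) _ (measurable_incr3 mf)).
by move=> w; rewrite lee_fin sqr_ge0.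
Qed.

(** For partial sums, Parseval in [x] turns the integral of the form into the sum
    of the forms of the modes.  Fatou's lemma extends the bound to the kernel. *)
Lemma integral_incr_form_kproj :
  (\int[mu]_x incr_form rho (fun s y => kernel E t x s y - kproj x s y)%R <=
   (512 * (4 + T) * (1 + c^-1) * wz_rate c E T m n)%:E)%E.
Proof.
pose G (N : nat) (x s y : R) := kernel_sum E t N x s y - proj k h m n (kernel_sum E t N x) s y.
pose G' (x s y : R) := kernel E t x s y - kproj x s y.
have mG N : measurable_fun setT (fun3 (G N)).
  apply: measurable_funB; first exact: measurable_kernel_sum.
  by apply: measurable_proj; exact: measurable_kernel_sum.
have mG' : measurable_fun setT (fun3 G').
  by apply: measurable_funB; [exact: measurable_kernel|exact: measurable_kproj].
have e (f : R -> R -> R -> R) : measurable_fun setT (fun3 f) ->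
    (\int[mu]_x incr_form rho (f x) =
     \int[sfprod mu (sfprod mu mu2)]_w (incr rho (f w.1) w.2 ^+ 2)%:E)%E.
  move=> mf; rewrite (sfprod_tonelli mu (sfprod mu mu2) (measurable_incr3 mf))//.
  by move=> w; rewrite lee_fin sqr_ge0.
have [phi [_ aephi]] := kernel_subseq.
rewrite (e G' mG').
apply: (@ae_fatou_le _ _ R (sfprod mu (sfprod mu mu2)) (fun q w => (incr rho (G (phi q) w.1) w.2 ^+ 2)%:E) (fun w => (incr rho (G' w.1) w.2 ^+ 2)%:E)).
- by move=> q; exact: measurable_incr3.
- by move=> q w; rewrite lee_fin sqr_ge0.
- exact: measurable_incr3.
- by move=> w; rewrite lee_fin sqr_ge0.
- have := @ae_sfprod_fst _ _ _ _ R mu (sfprod mu mu2) _ aephi.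
  apply: ae_mono => w Hw; apply: cvg_EFin; first by near=> q.
  by apply: cvgM; apply: cvgB; exact: Hw.
- near=> q; rewrite -(e _ (mG (phi q))) /incr_form.
  have D x z : incr rho (G (phi q) x) z =
      \sum_(a < phi q) eigz a.+1 x * incr rho (wz_mode E T t m n a.+1) z.
    rewrite /incr /G !proj_kernel_sum -sumrB.
    by apply: eq_bigr => a _; rewrite -mulrBr.
  under eq_integral => x _ do under eq_integral => z _ do rewrite D.
  rewrite (parseval_tonelli (sfprod mu mu2) (phi q) (cf := fun a => incr rho (wz_mode E T t m n a.+1))).
    exact: (sum_wz_mode_form mrho rho0 rho1 c0 c1 rhoH E (phi q) m0 n0 T0 t0 tT).
  move=> a; exact: (measurable_incr mrho (measurable_wz_mode _ _ _ _ _ _)).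
Unshelve. all: by end_near. Qed.

End kernel_projection.

(** * Stochastic convolutions as integrals of the kernel *)

Section kernel_integral.
Context {R : realType}.
Local Notation mu := (@lebesgue_measure R).
Local Notation mR := (measurableTypeR R).
Local Notation mu2 := (sfprod mu mu).

Lemma kernel_in E (t x s y : R) : 0 < x < 1 -> 0 < s < t -> 0 < y < 1 ->
  kernel E t x s y = green E (t - s) x y.
Proof.
have i1 (b : R) z : 0 < z < b -> \1_`]0, b[ z = 1 :> R.
  by move=> H; rewrite indicE mem_set//= in_itv/= H.
by move=> xI sI yI; rewrite /kernel !i1// !mul1r.
Qed.

Lemma kernel_out E (t x s y : R) : ~~ [&& 0 < x < 1, 0 < s < t & 0 < y < 1] ->
  kernel E t x s y = 0.
Proof.
have i0 (b : R) z : ~~ (0 < z < b) -> \1_`]0, b[ z = 0 :> R.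
  by move=> H; rewrite indicE memNset//= in_itv/=; exact/negP.
have [xI|H] := boolP (0 < x < 1); last by rewrite /kernel (i0 _ _ H) !mul0r.
have [sI|H] := boolP (0 < s < t); last by rewrite /kernel (i0 _ _ H) mulr0 !mul0r.
have [yI|H] := boolP (0 < y < 1); last by rewrite /kernel (i0 _ _ H) mulr0 !mul0r.
by [].
Qed.

Lemma kernel_integralE E (t x : R) (f : R -> R -> R) (F : R -> R -> R) :
  0 < x < 1 -> measurable_fun setT (fun2 F) ->
  (forall s y, 0 < s < t -> 0 < y < 1 -> F s y = f s y) ->
  mu2.-integrable setT (fun z => (kernel E t x z.1 z.2 * F z.1 z.2)%:E) ->
  \int[mu]_(s in Itime t) \int[mu]_(y in Ospace) (green E (t - s) x y * f s y) =
  \int[mu2]_z (kernel E t x z.1 z.2 * F z.1 z.2).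
Proof.
move=> xI mF Ff iKF.
pose J (s : R) := \int[mu]_y (kernel E t x s y * F s y).
have mKF : measurable_fun setT (fun z : mR * mR => kernel E t x z.1 z.2 * F z.1 z.2).
  exact: measurable_funM (measurable_fun3 x (measurable_kernel E t)) mF.
have mJ : measurable_fun setT J by exact: (measurable_Rintegral_section mu mKF).
rewrite -(Rintegral_sfprod iKF) /= -[RHS]/(\int[mu]_s J s).
have JE s : 0 < s < t -> \int[mu]_(y in Ospace) (green E (t - s) x y * f s y) = J s.
  move=> sI; rewrite Rintegral_mkcond; apply: eq_Rintegral => y _; rewrite patchE.
  case: ifPn; rewrite /Ospace.
    by rewrite inE/= in_itv/= => yI; rewrite kernel_in// Ff.
  rewrite notin_setE/= in_itv/= => /negP yI.
  by rewrite kernel_out ?mul0r// (negbTE yI) !andbF.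
have J0 s : ~~ (0 < s < t) -> J s = 0.
  move=> sI; rewrite /J /Rintegral integral0_eq// => y _.
  by rewrite kernel_out ?mul0r// (negbTE sI) andbF.
rewrite /Rintegral; congr fine; rewrite /Itime.
rewrite (@integral_itv_bndoo _ 0 t _ true false).
  rewrite [LHS]integral_mkcond; apply: eq_integral => s _; rewrite patchE.
  case: ifPn; first by rewrite inE/= in_itv/= => sI; congr EFin; exact: JE.
  by rewrite notin_setE/= in_itv/= => /negP sI; rewrite J0.
apply: (eq_measurable_fun (fun s => (J s)%:E)).
  by move=> s; rewrite inE/= in_itv/= => sI; congr EFin; rewrite -JE.
by apply: measurable_funTS; exact/measurable_EFinP.
Qed.

Context {d : measure_display} {Omega : measurableType d}.

Lemma wz_noiseE (T : R) (m n : nat) (W : R -> R -> Omega -> R) (s y : R) w :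
  wz_noise T m n W s y w = \sum_(i < m) \sum_(j < n)
    ((T / m%:R * n%:R^-1)^-1 * rect_noise W (i%:R * (T / m%:R)) (i.+1%:R * (T / m%:R))
      (j%:R * n%:R^-1) (j.+1%:R * n%:R^-1) w) * cell2 (T / m%:R) n%:R^-1 i j (s, y).
Proof.
apply: eq_bigr => i _; apply: eq_bigr => j _.
by rewrite /cell2/= /itvind -mulrA.
Qed.

(** The Wong-Zakai noise is constant on the cells, so its convolution with the
    kernel only involves the cell averages of the kernel: it is the noise integral
    of the projection. *)
Lemma conv_wz_elementary E (T t x : R) (m n : nat) (W : R -> R -> Omega -> R)
    (Z : Omega -> R) : 0 < T -> (0 < m)%N -> (0 < n)%N -> 0 < x < 1 ->
  (\int[mu2]_z (kernel E t x z.1 z.2 ^+ 2)%:E < +oo)%E ->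
  conv_wz T m n W E t x Z -> elementary T W (kproj E T t m n x) Z.
Proof.
move=> T0 m0 n0 xI Kx ->.
have m0' : 0 < m%:R :> R by rewrite ltr0n.
have n0' : 0 < n%:R :> R by rewrite ltr0n.
set k := T / m%:R; set h : R := n%:R^-1.
have k0 : 0 < k by exact: divr_gt0.
have h0 : 0 < h by rewrite invr_gt0.
have mk : m%:R * k = T by rewrite /k mulrC divfK// gt_eqF.
have nh : n%:R * h = 1 by rewrite /h divff// gt_eqF.
pose r i j w := rect_noise W (i%:R * k) (i.+1%:R * k) (j%:R * h) (j.+1%:R * h) w.
have mK := measurable_fun3 x (measurable_kernel E t).
have iK i j := integrable_cell2 k0 h0 i j mK Kx.
set Z' := (X in elementary _ _ _ X).
have -> : Z' = fun w => \sum_(i < m) \sum_(j < n) cell_coef k h (kernel E t x) i j * r i j w.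
  apply/funext => w; rewrite /Z'.
  pose F (s y : R) := \sum_(i < m) \sum_(j < n) ((k * h)^-1 * r i j w) * cell2 k h i j (s, y).
  have FE (z : mR * mR) : kernel E t x z.1 z.2 * F z.1 z.2 =
      \sum_(i < m) \sum_(j < n) ((k * h)^-1 * r i j w) * (kernel E t x z.1 z.2 * cell2 k h i j z).
    rewrite /F mulr_sumr; apply: eq_bigr => i _; rewrite mulr_sumr; apply: eq_bigr => j _.
    by rewrite mulrCA -surjective_pairing.
  have iKc i j : mu2.-integrable setT (EFin \o (fun z => ((k * h)^-1 * r i j w) * (kernel E t x z.1 z.2 * cell2 k h i j z))).
    have := integrableZl measurableT ((k * h)^-1 * r i j w) (iK i j).
    by apply: eq_integrable => // z _; rewrite /= EFinM.
  have iKs i : mu2.-integrable setT (EFin \o (fun z => \sum_(j < n) ((k * h)^-1 * r i j w) * (kernel E t x z.1 z.2 * cell2 k h i j z))).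
    have := integrable_sum measurableT (index_enum 'I_n) (P := xpredT) (fun j _ => iKc i j).
    by apply: eq_integrable => // z _; rewrite /= -sumEFin.
  rewrite (@kernel_integralE E t x _ F xI); last 3 first.
  - apply: measurable_sum => i; apply: measurable_sum => j; apply: measurable_funM => //.
    exact: measurable_cell2.
  - by move=> s y _ _; rewrite wz_noiseE.
  - have := integrable_sum measurableT (index_enum 'I_m) (P := xpredT) (fun i _ => iKs i).
    by apply: eq_integrable => // z _; rewrite FE /= -sumEFin.
  under eq_Rintegral => z _ do rewrite FE.
  rewrite (Rintegral_sum (fun i : 'I_m => iKs i)); apply: eq_bigr => i _.
  rewrite (Rintegral_sum (fun j : 'I_n => iKc i j)); apply: eq_bigr => j _.
  by rewrite (RintegralZl _ measurableT (iK i j)) /cell_coef mulrAC.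
apply: (@elementary_sum _ _ _ T W m (fun i s y => \sum_(j < n) cell_coef k h (kernel E t x) i j * cell2 k h i j (s, y))
   (fun i w => \sum_(j < n) cell_coef k h (kernel E t x) i j * r i j w)) => i im.
apply: (@elementary_sum _ _ _ T W n (fun j s y => cell_coef k h (kernel E t x) i j * cell2 k h i j (s, y))
   (fun j w => cell_coef k h (kernel E t x) i j * r i j w)) => j jn.
apply: elementaryZ.
apply: (elementary_rect W); rewrite ?cell_le// in_itv/=.
- rewrite mulr_ge0 ?(ltW k0)//= -mk ler_wpM2r ?(ltW k0)// ler_nat ltnW//.
- rewrite mulr_ge0 ?(ltW k0)//= -mk ler_wpM2r ?(ltW k0)// ler_nat//.
- rewrite mulr_ge0 ?(ltW h0)//= -[leRHS]nh ler_wpM2r ?(ltW h0)// ler_nat ltnW//.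
- rewrite mulr_ge0 ?(ltW h0)//= -[leRHS]nh ler_wpM2r ?(ltW h0)// ler_nat//.
Qed.

End kernel_integral.

(** * A pathwise Gronwall inequality *)

Section gronwall.
Context {R : realType}.
Local Notation mu := (@lebesgue_measure R).
Local Notation mR := (measurableTypeR R).

Definition upto (t s : R) : R := \1_`]-oo, 0]%classic (s - t).

Lemma uptoE (t s : R) : upto t s = (s <= t)%R%:R.
Proof. by rewrite /upto indicE mem_setE in_itv/= subr_le0. Qed.

Lemma upto_ge0 t s : 0 <= upto t s.
Proof. by rewrite uptoE. Qed.

Lemma measurable_upto (d : measure_display) (X : measurableType d) (f g : X -> R) :
  measurable_fun setT f -> measurable_fun setT g ->
  measurable_fun setT (fun x => upto (f x) (g x)).
Proof.
move=> mf mg; apply: (measurableT_comp (f := \1_`]-oo, 0]%classic : R -> R)).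
  exact: measurable_indic.
exact: measurable_funB.
Qed.

Lemma integral_expR_tail (beta s T : R) : 0 < beta -> s <= T ->
  (\int[mu]_t ((\1_`[0%R, T]%classic t * upto t s * expR (- beta * t))%:E)
   <= (beta^-1 * expR (- beta * s))%:E)%E.
Proof.
move=> b0 sT.
have dF (x : R) : is_derive x 1 ((fun x => - (beta^-1 * expR (- beta * x))) : R -> R^o) (expR (- beta * x)).
  apply: is_derive_eq; rewrite /GRing.scale/=; field; by rewrite gt_eqF.
have cf : continuous (fun x => expR (- beta * x)).
  move=> x; apply: continuous_comp; last exact: continuous_expR.
  by apply: continuousM; [exact: cst_continuous|exact: cvg_id].
apply: (@le_trans _ _ (\int[mu]_(x in `[s, T]) (expR (- beta * x))%:E)%E); last first.
  rewrite (integral_derivative sT dF cf) lee_fin opprK addrC gerBl.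
  by rewrite mulr_ge0 ?expR_ge0// invr_ge0 ltW.
rewrite [leRHS]integral_mkcond; apply: ge0_le_integral => //.
- by move=> t _; rewrite lee_fin mulr_ge0 ?expR_ge0// mulr_ge0 ?upto_ge0.
- apply/measurable_EFinP; apply: measurable_funM.
    apply: measurable_funM; first exact: measurable_indic.
    exact: measurable_upto.
  by apply: continuous_measurable_fun.
- apply/(measurable_restrictT _ _).1 => //; apply/measurable_EFinP.
  by apply: measurable_funTS; exact: continuous_measurable_fun.
- move=> t _; rewrite patchE indicE uptoE mem_setE in_itv/=; case: ifPn.
    by rewrite mem_setE in_itv/= => _; rewrite lee_fin; apply: ler_piMl; [exact: expR_ge0|apply: mulr_ile1; rewrite ?ler0n// lern1 leq_b1].
  rewrite mem_setE in_itv/= negb_and => /orP[/negbTE ->|/negbTE ->].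
    by rewrite mulr0 mul0r.
  by rewrite andbF !mul0r.
Qed.

(** With the weight [expR (- 2 * C1 * t)] the integral term carries the factor
    [C1 / (2 * C1) = 1/2] and is absorbed by the left-hand side, which is finite. *)
Lemma gronwall_path (T C1 : R) (e zeta : R -> \bar R) : 0 < C1 -> 0 <= T ->
  measurable_fun setT e -> measurable_fun setT zeta ->
  (forall s, (0 <= e s)%E) -> (forall s, (0 <= zeta s)%E) ->
  (forall s, s \notin `[0, T] -> e s = 0%E) ->
  (forall t, t \in `[0, T] -> (e t <= zeta t + C1%:E * \int[mu]_s ((upto t s)%:E * e s))%E) ->
  (\int[mu]_s e s < +oo)%E ->
  (\int[mu]_s e s <= (2 * expR (2 * C1 * T))%:E * \int[mu]_s zeta s)%E.
Proof.
move=> C10 T0 me mz e0 z0 eout ele eoo.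
pose beta := 2 * C1.
have b0 : 0 < beta by rewrite mulr_gt0.
pose ex (t : R) := expR (- beta * t).
have mex : measurable_fun setT (EFin \o ex).
  apply/measurable_EFinP; apply: continuous_measurable_fun => x.
  apply: continuous_comp; last exact: continuous_expR.
  by apply: continuousM; [exact: cst_continuous|exact: cvg_id].
have ex0 t : 0 <= ex t by exact: expR_ge0.
have mI : measurable_fun setT (fun t => (\1_`[0%R, T]%classic t : R)%:E).
  by apply/measurable_EFinP; exact: measurable_indic.
pose I := (\int[mu]_s ((ex s)%:E * e s))%E.
have I0 : (0 <= I)%E by apply: integral_ge0 => s _; rewrite mule_ge0// lee_fin.
have mIe : measurable_fun setT (fun s => (ex s)%:E * e s)%E by exact: emeasurable_funM.
have exle1 s : 0 <= s -> ex s <= 1.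
  by move=> s0; rewrite -expR0 ler_expR mulNr oppr_le0 mulr_ge0// ltW.
have Ioo : (I < +oo)%E.
  apply: le_lt_trans eoo; apply: ge0_le_integral => //.
  - by move=> s _; rewrite mule_ge0// lee_fin.
  - move=> s _; have [sI|sI] := boolP (s \in `[0, T]); last by rewrite eout// mule0.
    rewrite -[leRHS]mul1e; apply: lee_wpmul2r => //; rewrite lee_fin exle1//.
    by move: sI; rewrite in_itv/= => /andP[].
pose A (t : R) := (\int[mu]_s ((upto t s)%:E * e s))%E.
have mA2 : measurable_fun setT (fun z : mR * mR => (upto z.1 z.2)%:E * e z.2)%E.
  apply: emeasurable_funM; last exact: (measurableT_comp me measurable_snd).
  by apply/measurable_EFinP; apply: measurable_upto; [exact: measurable_fst|exact: measurable_snd].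
have A20 z : (0 <= (upto z.1 z.2)%:E * e z.2)%E by rewrite mule_ge0// lee_fin upto_ge0.
have mA : measurable_fun setT A.
  exact: (measurable_fun_fubini_tonelli_F (m2 := mu) _ mA2 A20).
have A0 t : (0 <= A t)%E by apply: integral_ge0 => s _; exact: (A20 (t, s)).
have J0 t : (0 <= (\1_`[0%R, T]%classic t * ex t)%:E * A t)%E.
  by rewrite mule_ge0// lee_fin mulr_ge0.
have step : (I <= \int[mu]_s zeta s + (2^-1)%:E * I)%E.
  apply: (@le_trans _ _ (\int[mu]_t (zeta t + C1%:E * ((\1_`[0%R, T]%classic t * ex t)%:E * A t)))%E).
    apply: ge0_le_integral => //.
    - by move=> s _; rewrite mule_ge0// lee_fin.
    - apply: emeasurable_funD => //; apply: emeasurable_funM => //; apply: emeasurable_funM => //.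
      by under eq_fun do rewrite EFinM; exact: emeasurable_funM.
    - move=> s _; have [sI|sI] := boolP (s \in `[0, T]); last first.
        rewrite eout// mule0; apply: adde_ge0 => //.
        by apply: mule_ge0; [rewrite lee_fin ltW|exact: J0].
      have s0 : 0 <= s by move: sI; rewrite in_itv/= => /andP[].
      rewrite indicE mem_setE sI mul1r.
      apply: (@le_trans _ _ ((ex s)%:E * (zeta s + C1%:E * A s))%E).
        by apply: lee_wpmul2l; [rewrite lee_fin|exact: ele].
      rewrite (ge0_muleDr _ (z0 s)); last by apply: mule_ge0; [rewrite lee_fin ltW|exact: A0].
      apply: leeD; last by rewrite muleCA.
      by rewrite -[leRHS]mul1e; apply: lee_wpmul2r => //; rewrite lee_fin exle1.
  have mJ : measurable_fun setT (fun t => ((\1_`[0%R, T]%classic t * ex t)%:E * A t)%E).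
    apply: emeasurable_funM => //.
    by under eq_fun do rewrite EFinM; exact: emeasurable_funM.
  rewrite ge0_integralD//; last 2 first.
  - by move=> t _; rewrite mule_ge0// lee_fin ltW.
  - exact: emeasurable_funM.
  apply: leeD => //; rewrite ge0_integralZl_EFin//; last exact: ltW.
  (* Exchange the integrals; [integral_expR_tail] gives the factor [beta^-1]. *)
  have -> : ((2^-1)%:E = C1%:E * (beta^-1)%:E :> \bar R)%E.
    by rewrite -EFinM; congr EFin; rewrite /beta; field; rewrite gt_eqF.
  rewrite -muleA; apply: lee_wpmul2l; first by rewrite lee_fin ltW.
  rewrite /A.
  pose Q (z : mR * mR) : \bar R := ((\1_`[0%R, T]%classic z.1 * upto z.1 z.2 * ex z.1)%:E * e z.2)%E.
  have mQ : measurable_fun setT Q.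
    apply: emeasurable_funM; last exact: (measurableT_comp me measurable_snd).
    apply/measurable_EFinP; apply: measurable_funM.
      have mIr : measurable_fun setT (\1_`[0%R, T]%classic : mR -> R) by exact: measurable_indic.
      apply: measurable_funM; first exact: (measurableT_comp mIr measurable_fst).
      by apply: measurable_upto; [exact: measurable_fst|exact: measurable_snd].
    by move/measurable_EFinP : mex => mex; exact: (measurableT_comp mex measurable_fst).
  have Q0 z : (0 <= Q z)%E by rewrite mule_ge0// lee_fin mulr_ge0// mulr_ge0// upto_ge0.
  have -> : (\int[mu]_t ((\1_`[0%R, T]%classic t * ex t)%:E * \int[mu]_s ((upto t s)%:E * e s)) =
     \int[mu]_t \int[mu]_s Q (t, s))%E.
    apply: eq_integral => t _; rewrite -ge0_integralZl//; last 3 first.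
    - exact: (measurableT_comp mA2 (measurable_pair1 t)).
    - by move=> s _; exact: (A20 (t, s)).
    - by rewrite lee_fin mulr_ge0.
    by apply: eq_integral => s _; rewrite /Q/= muleA -EFinM mulrAC.
  rewrite (fubini_tonelli (m1 := mu) (m2 := mu) _ mQ Q0).
  rewrite -ge0_integralZl//; last 2 first.
  - by move=> s _; rewrite mule_ge0// lee_fin.
  - by rewrite lee_fin invr_ge0 ltW.
  apply: ge0_le_integral => //.
  - by move=> s _; apply: integral_ge0 => t _; exact: Q0.
  - exact: (measurable_fun_fubini_tonelli_G (m1 := mu) _ mQ Q0).
  - exact: emeasurable_funM.
  move=> s _; have [sI|sI] := boolP (s \in `[0, T]); last first.
    rewrite integral0_eq; last by move=> t _; rewrite /Q/= eout// mule0.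
    by rewrite eout// !mule0.
  rewrite /Q/= ge0_integralZr//; last 2 first.
  - apply/measurable_EFinP; apply: measurable_funM; last by move/measurable_EFinP : mex.
    by apply: measurable_funM; [exact: measurable_indic|exact: measurable_upto].
  - by move=> t _; rewrite lee_fin mulr_ge0// mulr_ge0// upto_ge0.
  rewrite muleA; apply: lee_wpmul2r => //.
  rewrite -EFinM; apply: integral_expR_tail => //.
  by move: sI; rewrite in_itv/= => /andP[].
have I2 : (I <= 2%:E * \int[mu]_s zeta s)%E.
  move: step I0 Ioo; have : (0 <= \int[mu]_s zeta s)%E by exact: integral_ge0.
  case: I => [r| |]//; case: (\int[mu]_s zeta s)%E => [z| |]//.
  - by rewrite -!EFinM -EFinD !lee_fin; lra.
  - by move=> _ _ _ _; rewrite gt0_muley ?lte_fin// leey.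
apply: (@le_trans _ _ ((expR (beta * T))%:E * I)%E); last first.
  rewrite (mulrC 2) EFinM -muleA; apply: lee_wpmul2l; first by rewrite lee_fin expR_ge0.
  exact: I2.
rewrite /I -ge0_integralZl//; last first.
  by move=> s _; rewrite mule_ge0// lee_fin.
apply: ge0_le_integral => //.
- exact: emeasurable_funM.
move=> s _; have [sI|sI] := boolP (s \in `[0, T]); last by rewrite eout// !mule0.
rewrite muleA -EFinM -[leLHS]mul1e; apply: lee_wpmul2r => //.
rewrite lee_fin /ex -expRD -expR0 ler_expR mulNr -mulrBr mulr_ge0 ?(ltW b0)//.
by rewrite subr_ge0; move: sI; rewrite in_itv/= => /andP[].
Qed.

End gronwall.

(** * Moments of the error *)

Section error_moment.
Context {d : measure_display} {Omega : measurableType d} {R : realType}.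
Local Notation mu := (@lebesgue_measure R).
Local Notation mR := (measurableTypeR R).
Variable P : probability Omega R.

Lemma exists_positive_density : exists2 g : R -> R, measurable_fun setT g &
  (forall x, 0 < g x) /\ (\int[mu]_x (g x)%:E = 1)%E.
Proof.
exists (normal_pdf 0 1); first exact: measurable_normal_pdf.
split; last exact: integral_normal_pdf.
move=> x; rewrite normal_pdfE ?oner_eq0// mulr_gt0 ?expR_gt0//.
by rewrite normal_peak_gt0// oner_eq0.
Qed.

Lemma measurable_sqrt : measurable_fun setT (@Num.sqrt R : mR -> mR).
Proof. by apply: continuous_measurable_fun; exact: sqrt_continuous. Qed.

Lemma poweRD_le (a b : \bar R) (q : R) : (0 <= a)%E -> (0 <= b)%E -> 0 <= q ->
  ((a + b) `^ q <= (2 `^ q)%:E * (a `^ q + b `^ q))%E.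
Proof.
move=> a0 b0 q0.
wlog ab : a b a0 b0 / (a <= b)%E.
  move=> H; have [ab|/ltW ba] := leP a b; first exact: H.
  by rewrite addeC (addeC (a `^ q)%E); exact: H.
apply: (@le_trans _ _ ((2%:E * b) `^ q)%E).
  apply: lee_poweR => //; first exact: adde_ge0.
  by rewrite (_ : 2%:E = 1 + 1)%E// ge0_muleDl// mul1e leeD2r.
rewrite poweRM ?lee_fin// poweR_EFin; apply: lee_wpmul2l; first by rewrite lee_fin powR_ge0.
by rewrite leeDr// poweR_ge0.
Qed.

Variables (T K q L C0 S : R) (delta : R -> R -> Omega -> R) (kap : R -> R -> R).
Hypothesis T0 : 0 < T.
Hypothesis K0 : 0 <= K.
Hypothesis q1 : 1 <= q.
Hypothesis L0 : 0 <= L.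
Hypothesis C00 : 0 <= C0.
Hypothesis S0 : 0 < S.
Hypothesis mdelta : measurable_fun setT
  (fun z : mR * mR * Omega => delta z.1.1 z.1.2 z.2).
Hypothesis delta_out : forall t x w, t \notin `[0, T] -> delta t x w = 0.

Definition sq_error (t : R) (w : Omega) : \bar R := (\int[mu]_x (delta t x w ^+ 2)%:E)%E.

Definition sq_error_upto (t : R) (w : Omega) : \bar R :=
  (\int[mu]_s ((upto t s)%:E * sq_error s w))%E.

(** What exceeds in the error the Cauchy-Schwarz bound of the drift difference;
    it is dominated by the difference of the stochastic convolutions.  The latter
    are given for each [x] up to a null set and may fail to be measurable in
    [x], whereas [noise_part] is jointly measurable by construction. *)
Definition noise_part (t x : R) (w : Omega) : R :=
  Num.max 0 (`|delta t x w| - Num.sqrt (kap t x) * (L * Num.sqrt (fine (sq_error_upto t w)))).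

Hypothesis mkap : forall t, t \in `[0, T] -> measurable_fun setT (kap t).
Hypothesis kap0 : forall t x, 0 <= kap t x.
Hypothesis kapC : forall t, t \in `[0, T] -> (\int[mu]_x (kap t x)%:E <= C0%:E)%E.
Hypothesis finite_error : {ae P, forall w, (\int[mu]_s sq_error s w < +oo)%E}.
Hypothesis noise_moment : forall t, t \in `[0, T] -> exists r : R -> R,
  [/\ measurable_fun setT r, forall x, 0 < r x, (\int[mu]_x (r x)%:E <= S%:E)%E &
   {ae mu, forall x, (\int[P]_w (((noise_part t x w) ^+ 2)%:E `^ q) <= (K * r x `^ q)%:E)%E}].

Let C1 := 2 * L ^+ 2 * C0 + 1.

Let q0 : 0 <= q. Proof. exact: le_trans ler01 q1. Qed.

Let C10 : 0 < C1. Proof. by rewrite /C1 ltr_wpDl// !mulr_ge0// sqr_ge0. Qed.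

Lemma sq_error_ge0 t w : (0 <= sq_error t w)%E.
Proof. by apply: integral_ge0 => x _; rewrite lee_fin sqr_ge0. Qed.

Lemma measurable_sq_error :
  measurable_fun setT (fun z : mR * Omega => sq_error z.1 z.2).
Proof.
apply: (measurable_fun_fubini_tonelli_F (m2 := mu)
  (fun z : (mR * Omega) * mR => (delta z.1.1 z.2 z.1.2 ^+ 2)%:E)).
  apply/measurable_EFinP; apply: measurable_funX.
  apply: (measurableT_comp mdelta (g := fun z : (mR * Omega) * mR => ((z.1.1, z.2), z.1.2))).
  apply: measurable_fun_pair.
    apply: measurable_fun_pair; last exact: measurable_snd.
    exact: (measurableT_comp measurable_fst measurable_fst).
  exact: (measurableT_comp measurable_snd measurable_fst).
by move=> z; rewrite lee_fin sqr_ge0.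
Qed.

Lemma sq_error_out t w : t \notin `[0, T] -> sq_error t w = 0%E.
Proof.
by move=> tT; rewrite /sq_error integral0_eq// => x _; rewrite delta_out// expr0n.
Qed.

Lemma sq_error_upto_ge0 t w : (0 <= sq_error_upto t w)%E.
Proof.
by apply: integral_ge0 => s _; rewrite mule_ge0 ?lee_fin ?upto_ge0 ?sq_error_ge0.
Qed.

Lemma measurable_sq_error_upto :
  measurable_fun setT (fun z : mR * Omega => sq_error_upto z.1 z.2).
Proof.
apply: (measurable_fun_fubini_tonelli_F (m2 := mu)
  (fun z : (mR * Omega) * mR => ((upto z.1.1 z.2)%:E * sq_error z.2 z.1.2)%E)).
  apply: emeasurable_funM.
    apply/measurable_EFinP; apply: measurable_upto; last exact: measurable_snd.
    exact: (measurableT_comp measurable_fst measurable_fst).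
  apply: (measurableT_comp measurable_sq_error (g := fun z : (mR * Omega) * mR => (z.2, z.1.2))).
  apply: measurable_fun_pair; first exact: measurable_snd.
  exact: (measurableT_comp measurable_snd measurable_fst).
by move=> z; rewrite mule_ge0 ?lee_fin ?upto_ge0 ?sq_error_ge0.
Qed.

(** The least nonnegative function for which the Gronwall inequality holds with
    constant [C1]; it is measurable by construction. *)
Definition excess (t : R) (w : Omega) : \bar R :=
  maxe 0%E (sq_error t w - C1%:E * sq_error_upto t w)%E.

Lemma excess_ge0 t w : (0 <= excess t w)%E.
Proof. by rewrite /excess le_max lexx. Qed.

Lemma measurable_excess : measurable_fun setT (fun z : mR * Omega => excess z.1 z.2).
Proof.
apply: measurable_maxe; first exact: measurable_cst.
apply: emeasurable_funB; first exact: measurable_sq_error.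
by apply: emeasurable_funM; [exact: measurable_cst|exact: measurable_sq_error_upto].
Qed.

Lemma sq_error_le_excess t w : (sq_error t w <= excess t w + C1%:E * sq_error_upto t w)%E.
Proof.
rewrite /excess; have := sq_error_upto_ge0 t w; have := sq_error_ge0 t w.
case: (sq_error_upto t w) => [a| |]//; last first.
  by rewrite gt0_muley ?lte_fin// addey ?leey// gt_eqF// lt_max ltNyr.
case: (sq_error t w) => [e| |]// _ _; last by rewrite -EFinM /= max_r ?leey.
rewrite -EFinM -EFinB -EFin_max -EFinD lee_fin.
by rewrite -lerBlDr le_max lexx orbT.
Qed.

Lemma measurable_noise_part (t : R) : t \in `[0, T] ->
  measurable_fun setT (fun z : mR * Omega => noise_part t z.1 z.2).
Proof.
move=> tT; apply: measurable_maxr; first exact: measurable_cst.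
apply: measurable_funB.
  apply: (measurableT_comp (@normr_measurable R setT)).
  apply: (measurableT_comp mdelta (g := fun z : mR * Omega => ((t, z.1), z.2))).
  apply: measurable_fun_pair; last exact: measurable_snd.
  by apply: measurable_fun_pair; [exact: measurable_cst|exact: measurable_fst].
apply: measurable_funM.
  apply: (measurableT_comp measurable_sqrt).
  exact: (measurableT_comp (mkap tT) measurable_fst).
apply: measurable_funM => //; apply: (measurableT_comp measurable_sqrt).
apply: (measurableT_comp (fine_measurable measurableT)).
apply: (measurableT_comp measurable_sq_error_upto (g := fun z : mR * Omega => (t, z.2))).
by apply: measurable_fun_pair; [exact: measurable_cst|exact: measurable_snd].
Qed.

(** Split [delta] into its noise part and the drift bound; the square of the latter
    integrates to [L^2 * C0] times the past error. *)
Lemma excess_le (t : R) (w : Omega) : t \in `[0, T] ->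
  (excess t w <= 2%:E * \int[mu]_x ((noise_part t x w) ^+ 2)%:E)%E.
Proof.
move=> tT.
have N0 : (0 <= \int[mu]_x ((noise_part t x w) ^+ 2)%:E)%E.
  by apply: integral_ge0 => x _; rewrite lee_fin sqr_ge0.
rewrite /excess ge_max mule_ge0//=.
have A0 := sq_error_upto_ge0 t w.
case EA : (sq_error_upto t w) A0 => [a| |]// a0; last first.
  by rewrite gt0_muley ?lte_fin//= addeNy leNye.
have a0' : 0 <= a by rewrite -lee_fin.
rewrite leeBlDr//.
have mn : measurable_fun setT (fun x : mR => ((noise_part t x w) ^+ 2)%:E).
  apply/measurable_EFinP; apply: measurable_funX.
  exact: (measurableT_comp (measurable_noise_part tT) (measurable_pair2 w)).
have mk := mkap tT.
have mk' : measurable_fun setT (EFin \o kap t) by exact/measurable_EFinP.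
have La0 : 0 <= 2 * L ^+ 2 * a by rewrite !mulr_ge0// sqr_ge0.
apply: (@le_trans _ _ (\int[mu]_x (2%:E * ((noise_part t x w) ^+ 2)%:E + (2 * L ^+ 2 * a)%:E * (kap t x)%:E))%E).
  apply: ge0_le_integral => //.
  - by move=> x _; rewrite lee_fin sqr_ge0.
  - apply/measurable_EFinP; apply: measurable_funX.
    apply: (measurableT_comp mdelta (g := fun x : mR => ((t, x), w))).
    apply: measurable_fun_pair; last exact: measurable_cst.
    by apply: measurable_fun_pair; [exact: measurable_cst|].
  - by apply: emeasurable_funD; apply: emeasurable_funM.
  move=> x _; rewrite -!EFinM -EFinD lee_fin.
  have : `|delta t x w| <= noise_part t x w + Num.sqrt (kap t x) * (L * Num.sqrt a).
    by rewrite -lerBlDr /noise_part EA/= le_max lexx orbT.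
  have n0 : 0 <= noise_part t x w by rewrite /noise_part le_max lexx.
  have s0 : 0 <= Num.sqrt (kap t x) * (L * Num.sqrt a) by rewrite !mulr_ge0// sqrtr_ge0.
  move=> H; rewrite -real_normK ?num_real//.
  apply: (@le_trans _ _ ((noise_part t x w + Num.sqrt (kap t x) * (L * Num.sqrt a)) ^+ 2)).
    by apply: lerXn2r; rewrite ?nnegrE// addr_ge0.
  apply: le_trans (sqrD_le_dbl _ _) _; rewrite lerD2l.
  by rewrite !exprMn !sqr_sqrtr// le_eqVlt; apply/orP; left; apply/eqP; ring.
rewrite ge0_integralD//; last 4 first.
- by move=> x _; rewrite mule_ge0// lee_fin sqr_ge0.
- exact: emeasurable_funM.
- by move=> x _; rewrite mule_ge0// lee_fin.
- exact: emeasurable_funM.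
rewrite !ge0_integralZl_EFin//; last 2 first.
- by move=> x _; rewrite lee_fin.
- by move=> x _; rewrite lee_fin sqr_ge0.
apply: leeD => //; apply: (@le_trans _ _ ((2 * L ^+ 2 * a)%:E * C0%:E)%E).
  by apply: lee_wpmul2l; [rewrite lee_fin|exact: kapC].
by rewrite -!EFinM lee_fin mulrAC /C1 ler_wpM2r// lerDl.
Qed.

Lemma excess_moment (t : R) : t \in `[0, T] ->
  (\int[P]_w (excess t w `^ q) <= (2 `^ q * K * S `^ q)%:E)%E.
Proof.
move=> tT.
have [r [mr r0 rS aer]] := noise_moment tT.
have mN : measurable_fun setT (fun z : mR * Omega => ((noise_part t z.1 z.2) ^+ 2)%:E).
  by apply/measurable_EFinP; apply: measurable_funX; exact: measurable_noise_part.
have N0 (z : mR * Omega) : (0 <= ((noise_part t z.1 z.2) ^+ 2)%:E)%E by rewrite lee_fin sqr_ge0.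
have := minkowski_integral (m := mu) (P := P) mN N0 mr r0 S0 q1 K0 rS aer => H.
pose I (w : Omega) : \bar R := (\int[mu]_x ((noise_part t x w) ^+ 2)%:E)%E.
have I0 w : (0 <= I w)%E by apply: integral_ge0 => x _; exact: (N0 (x, w)).
have mI : measurable_fun setT I by exact: (measurable_fun_fubini_tonelli_G (m1 := mu) _ mN N0).
have mp (f : Omega -> \bar R) : measurable_fun setT f -> measurable_fun setT (fun w => f w `^ q)%E.
  by move=> mf; exact: (measurableT_comp (measurable_poweR q) mf).
apply: (@le_trans _ _ (\int[P]_w ((2 `^ q)%:E * (I w `^ q)))%E).
  apply: ge0_le_integral => //.
  - by move=> w _; exact: poweR_ge0.
  - by apply: mp; exact: (measurableT_comp measurable_excess (measurable_pair1 t)).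
  - by apply: emeasurable_funM => //; exact: mp.
  move=> w _; rewrite -poweR_EFin -poweRM ?lee_fin//.
  by apply: lee_poweR => //; [exact: excess_ge0|exact: excess_le].
rewrite ge0_integralZl_EFin ?powR_ge0//; last 2 first.
- by move=> w _; exact: poweR_ge0.
- exact: mp.
by rewrite -mulrA EFinM; apply: lee_wpmul2l => //; rewrite lee_fin powR_ge0.
Qed.

(** The profile is bounded below by 1 on [[0, T]], where the moments are uniformly
    bounded, and positive everywhere as [minkowski_integral] requires. *)
Lemma integral_excess_moment :
  (\int[P]_w ((\int[mu]_t excess t w) `^ q) <= (2 `^ q * K * S `^ q * (T + 1) `^ q)%:E)%E.
Proof.
have [g mg [g0 g1]] := exists_positive_density.
pose r (t : R) : R := \1_`[0%R, T]%classic t + g t.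
have mr : measurable_fun setT r by apply: measurable_funD => //; exact: measurable_indic.
have r0 t : 0 < r t by rewrite ltr_wpDl.
have rT : (\int[mu]_t (r t)%:E <= (T + 1)%:E)%E.
  under eq_integral => t _ do rewrite EFinD.
  rewrite ge0_integralD//; last 3 first.
  - by apply/measurable_EFinP; exact: measurable_indic.
  - by move=> t _; rewrite lee_fin ltW.
  - exact/measurable_EFinP.
  rewrite g1 integral_indic// setIT EFinD leeD2r//.
  have E : mu (`[0%R, T]%classic : set mR) = T%:E.
    by rewrite lebesgue_measure_itv/= lte_fin T0 -EFinB subr0.
  by rewrite [leLHS]E.
apply: (minkowski_integral (m := mu) (P := P) measurable_excess _ mr r0 _ q1 _ rT).
- by move=> z; exact: excess_ge0.
- by rewrite addr_gt0.
- by rewrite !mulr_ge0// powR_ge0.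
apply: aeW => t; have [tT|tT] := boolP (t \in `[0, T]).
  apply: le_trans (excess_moment tT) _; rewrite lee_fin ler_peMr//.
    by rewrite !mulr_ge0// powR_ge0.
  rewrite -(powRr0 (r t)) ler_powR// /r indicE mem_setE tT lerDl ltW//.
rewrite integral0_eq; first by rewrite lee_fin !mulr_ge0// powR_ge0.
move=> w _; rewrite /excess sq_error_out// sub0e max_l ?poweR0r ?gt_eqF ?(lt_le_trans ltr01)//.
by rewrite leeNl oppe0 mule_ge0 ?sq_error_upto_ge0// lee_fin ltW.
Qed.

Definition gronwall_const : R :=
  2 `^ q * (2 `^ q * K + (C1 * (2 * expR (2 * C1 * T))) `^ q * (2 `^ q * K * (T + 1) `^ q)).

(** Gronwall's inequality bounds the past error by the integral of [excess],
    which is then inserted into the inequality at time [t]. *)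
Lemma sq_error_moment (t : R) : t \in `[0, T] ->
  (\int[P]_w (sq_error t w `^ q) <= (gronwall_const * S `^ q)%:E)%E.
Proof.
move=> tT.
pose J (w : Omega) : \bar R := (\int[mu]_t excess t w)%E.
pose C2 := C1 * (2 * expR (2 * C1 * T)).
have C20 : 0 <= C2 by rewrite !mulr_ge0 ?expR_ge0// ltW.
have J0 w : (0 <= J w)%E by apply: integral_ge0 => s _; exact: excess_ge0.
have mJ : measurable_fun setT J.
  by apply: (measurable_fun_fubini_tonelli_G (m1 := mu) _ measurable_excess) => z; exact: excess_ge0.
have mp (f : Omega -> \bar R) : measurable_fun setT f -> measurable_fun setT (fun w => f w `^ q)%E.
  by move=> mf; exact: (measurableT_comp (measurable_poweR q) mf).
have me : measurable_fun setT (excess t) := measurableT_comp measurable_excess (measurable_pair1 t).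
have ms (s : R) : measurable_fun setT (sq_error s) := measurableT_comp measurable_sq_error (measurable_pair1 s).
apply: (@le_trans _ _ (\int[P]_w ((2 `^ q)%:E * (excess t w `^ q + (C2 `^ q)%:E * J w `^ q)))%E).
  apply: ae_ge0_le_integral => //.
  - by move=> w _; exact: poweR_ge0.
  - exact: mp.
  - by move=> w _; rewrite mule_ge0 ?lee_fin ?powR_ge0// adde_ge0 ?poweR_ge0// mule_ge0 ?lee_fin ?powR_ge0// poweR_ge0.
  - apply: emeasurable_funM => //; apply: emeasurable_funD; first exact: mp.
    by apply: emeasurable_funM => //; exact: mp.
  move: finite_error; apply: ae_mono => w fw _.
  have mes : measurable_fun setT (fun s : mR => sq_error s w) := measurableT_comp measurable_sq_error (measurable_pair2 w).
  have mxs : measurable_fun setT (fun s : mR => excess s w) := measurableT_comp measurable_excess (measurable_pair2 w).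
  have Itot : (\int[mu]_s sq_error s w <= (2 * expR (2 * C1 * T))%:E * J w)%E.
    apply: (gronwall_path C10 (ltW T0) mes mxs) => //.
    - by move=> s; exact: sq_error_ge0.
    - by move=> s; exact: excess_ge0.
    - by move=> s; exact: sq_error_out.
    - by move=> s _; exact: sq_error_le_excess.
  have le1 : (sq_error t w <= excess t w + C2%:E * J w)%E.
    apply: le_trans (sq_error_le_excess t w) _; apply: leeD2l.
    rewrite /C2 EFinM -muleA; apply: lee_wpmul2l; first by rewrite lee_fin ltW.
    apply: le_trans Itot; apply: ge0_le_integral => //.
    - by move=> s _; rewrite mule_ge0 ?sq_error_ge0 ?lee_fin ?upto_ge0.
    - apply: emeasurable_funM => //; apply/measurable_EFinP; exact: measurable_upto.
    - move=> s _; rewrite -[leRHS]mul1e; apply: lee_wpmul2r; first exact: sq_error_ge0.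
      by rewrite lee_fin uptoE lern1 leq_b1.
  apply: le_trans (lee_poweR q0 (sq_error_ge0 t w) le1) _.
  have -> : ((C2 `^ q)%:E * J w `^ q = (C2%:E * J w) `^ q)%E by rewrite poweRM ?lee_fin// poweR_EFin.
  by apply: poweRD_le; rewrite ?excess_ge0 ?mule_ge0 ?lee_fin.
have p1 : (forall w, (0 <= excess t w `^ q)%E) by move=> w; exact: poweR_ge0.
have p2 : (forall w, (0 <= (C2 `^ q)%:E * J w `^ q)%E).
  by move=> w; rewrite mule_ge0 ?lee_fin ?powR_ge0// poweR_ge0.
have m1 := mp _ me.
have m2 : measurable_fun setT (fun w => (C2 `^ q)%:E * J w `^ q)%E.
  by apply: emeasurable_funM => //; exact: mp.
rewrite ge0_integralZl_EFin ?powR_ge0//; last 2 first.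
- by move=> w _; rewrite adde_ge0.
- exact: emeasurable_funD.
rewrite ge0_integralD// ge0_integralZl_EFin ?powR_ge0//; last 2 first.
- by move=> w _; exact: poweR_ge0.
- exact: mp.
rewrite /gronwall_const -/C2 -mulrA EFinM; apply: lee_wpmul2l; first by rewrite lee_fin powR_ge0.
rewrite mulrDl EFinD; apply: leeD; first exact: excess_moment.
have -> : C2 `^ q * (2 `^ q * K * (T + 1) `^ q) * S `^ q = C2 `^ q * (2 `^ q * K * S `^ q * (T + 1) `^ q) by ring.
rewrite EFinM; apply: lee_wpmul2l; first by rewrite lee_fin powR_ge0.
exact: integral_excess_moment.
Qed.

End error_moment.

(** * The norm of the space domain *)

Section space_norm.
Import HBNNSimple.
Context {R : realType}.
Local Notation mu := (@lebesgue_measure R).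
Local Notation mR := (measurableTypeR R).

Lemma ge0_integral_restr (d : measure_display) (X : measurableType d)
    (m : {measure set X -> \bar R}) (D : set X) (mD : measurable D) (f : X -> \bar R) :
  (forall x, (0 <= f x)%E) -> measurable_fun D f ->
  (\int[mrestr m mD]_x f x = \int[m]_(x in D) f x)%E.
Proof.
move=> f0 mf.
have le (u v : X -> \bar R) : (forall x, (0 <= u x)%E) -> (forall x, (0 <= v x)%E) ->
    (forall x, D x -> u x = v x) ->
    (\int[mrestr m mD]_x u x <= \int[mrestr m mD]_x v x)%E.
  move=> u0 v0 uv; rewrite !ge0_integralTE//; apply: ge_ereal_sup => _ [s su <-].
  have -> : sintegral (mrestr m mD) s = sintegral (mrestr m mD) (proj_nnsfun s mD).
    rewrite -!integralT_nnsfun !integral_restr; try exact/measurable_EFinP.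
    by apply: eq_integral => x xD; rewrite -mrestrict patchE xD.
  apply: ereal_sup_ubound; exists (proj_nnsfun s mD) => //= x.
  rewrite -[X in (X%:E <= _)%E]/(proj_nnsfun s mD x) -mrestrict patchE.
  by case: ifPn => // /set_mem xD; rewrite -uv//; exact: su.
have g0 x : (0 <= (f \_ D) x)%E by rewrite patchE; case: ifP.
transitivity (\int[mrestr m mD]_x (f \_ D) x)%E.
  by apply/eqP; rewrite eq_le !le// => x xD; rewrite patchE mem_set.
rewrite integral_restr; last exact/(measurable_restrictT _ mD).1.
by apply: eq_integral => x xD; rewrite patchE xD.
Qed.

Lemma measurable_Ospace : measurable (Ospace : set mR).
Proof. exact: measurable_itv. Qed.

Lemma ge0_integral_eq0_ae (d : measure_display) (X : measurableType d)
    (m : {measure set X -> \bar R}) (f : X -> \bar R) : measurable_fun setT f ->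
  (forall x, (0 <= f x)%E) -> (\int[m]_x f x = 0)%E -> {ae m, forall x, f x = 0%E}.
Proof.
move=> mf f0 fE.
have E : (\int[m]_x `|f x| = 0)%E.
  by rewrite -fE; apply: eq_integral => x _; rewrite gee0_abs.
have := (ae_eq_integral_abs m measurableT mf).1 E.
by apply: ae_mono => x /(_ I).
Qed.

Definition onO (f : R -> R) (x : R) : R := \1_`]0%R, 1%R[%classic x * f x.

Lemma onO_in f x : 0 < x < 1 -> onO f x = f x.
Proof. by move=> xI; rewrite /onO indicE mem_setE in_itv/= xI mul1r. Qed.

Lemma onO_out f x : ~~ (0 < x < 1) -> onO f x = 0.
Proof. by move=> /negbTE xI; rewrite /onO indicE mem_setE in_itv/= xI mul0r. Qed.

Lemma onO_patch (f : R -> R) : onO f = f \_ Ospace.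
Proof.
apply/funext => x; rewrite patchE /Ospace mem_setE in_itv/=.
by case: ifPn => [/onO_in|/onO_out] ->.
Qed.

Lemma measurable_onO (f : R -> R) : measurable_fun Ospace f -> measurable_fun setT (onO f).
Proof. by move=> mf; rewrite onO_patch; have := (measurable_restrictT f measurable_Ospace).1 mf. Qed.

Lemma L2normE (f : R -> R) : measurable_fun Ospace f ->
  (L2norm f = (\int[mu]_x (onO f x ^+ 2)%:E) `^ 2^-1)%E.
Proof.
move=> mf; rewrite /L2norm Lnorm.unlock; congr (_ `^ _)%E.
have E x : (`|(EFin \o f) x| `^ 2 = (f x ^+ 2)%:E)%E.
  by rewrite /= powR_mulrn// real_normK ?num_real.
rewrite (eq_integral (fun x : mR => (f x ^+ 2)%:E)); last by move=> x _; exact: E.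
rewrite ge0_integral_restr; last 2 first.
- by move=> x; rewrite lee_fin sqr_ge0.
- by apply/measurable_EFinP; exact: measurable_funX.
rewrite integral_mkcond; apply: eq_integral => x _.
by rewrite onO_patch !patchE; case: ifP => //; rewrite expr0n.
Qed.

Lemma ae_muO (A : R -> Prop) : {ae @muO R, forall x, A x} ->
  {ae mu, forall x, 0 < x < 1 -> A x}.
Proof.
move=> [N [mN N0 AN]]; exists (N `&` Ospace); split.
- by apply: measurableI => //; exact: measurable_Ospace.
- exact: N0.
- move=> x /= H; have xI : 0 < x < 1 by apply: contrapT => xI; apply: H => /xI.
  split; last by rewrite /Ospace /= in_itv.
  by apply: AN => /= Ax; apply: H.
Qed.

Context {d : measure_display} {Omega : measurableType d}.
Variable P : probability Omega R.

Lemma measurable_section2 (f : R -> Omega -> R) (w : Omega) :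
  measurable_fun (Ospace `*` [set: Omega]) (fun z : mR * Omega => f z.1 z.2) ->
  measurable_fun Ospace (f^~ w).
Proof.
move=> mf.
have mD : measurable (Ospace `*` [set: Omega] : set (mR * Omega)) by apply: measurableX => //; exact: measurable_Ospace.
have [_ H] := measurable_restrictT (f^~ w) measurable_Ospace; apply: H.
have := measurableT_comp ((measurable_restrictT _ mD).1 mf) (measurable_pair2 w).
set u := (X in measurable_fun _ X -> _); set v := (X in _ -> measurable_fun _ X).
suff -> : u = v by [].
by apply/funext => x; rewrite /u /v /= !patchE in_setX in_setT andbT.
Qed.

(** Both functions are limits in quadratic mean of the same partial sums.  This
    gives equality almost everywhere for the product measure, and Tonelli's
    theorem exchanges the order of [x] and [w]. *)
Lemma expansion_unique (c : Omega -> nat -> R) (om om' : R -> Omega -> R) :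
  expansion P c om -> expansion P c om' ->
  {ae mu, forall x, 0 < x < 1 -> {ae P, forall w, om x w = om' x w}}.
Proof.
move=> [mo ao] [mo' ao'].
pose D (x : R) (w : Omega) : R := onO (fun x => om x w - om' x w) x.
have mD : measurable_fun setT (fun z : mR * Omega => D z.1 z.2).
  have mX : measurable (Ospace `*` [set: Omega] : set (mR * Omega)) by apply: measurableX => //; exact: measurable_Ospace.
  have := (measurable_restrictT _ mX).1 (measurable_funB mo mo').
  set u := (X in measurable_fun _ X -> _); set v := (X in _ -> measurable_fun _ X).
  suff -> : u = v by [].
  apply/funext => -[x w]; rewrite /u /v /D onO_patch /= !patchE.
  by rewrite in_setX in_setT andbT.
have mD2 : measurable_fun setT (fun z : mR * Omega => (D z.1 z.2 ^+ 2)%:E).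
  by apply/measurable_EFinP; exact: measurable_funX.
have D20 (z : mR * Omega) : (0 <= (D z.1 z.2 ^+ 2)%:E)%E by rewrite lee_fin sqr_ge0.
have zero : {ae P, forall w, (\int[mu]_x (D x w ^+ 2)%:E = 0)%E}.
  apply: ae_mono2 ao ao' => w cw cw'.
  pose S N (x : R) := \sum_(1 <= a < N) c w a * eigf a x.
  have mS N : measurable_fun Ospace (S N).
    apply: measurable_funTS; apply: measurable_sum => a.
    by apply: measurable_funM => //; exact: measurable_eigf.
  have mow := measurable_section2 w mo; have mow' := measurable_section2 w mo'.
  pose I N (o : R -> Omega -> R) : \bar R := (\int[mu]_x (onO (fun x => S N x - o x w)%R x ^+ 2)%:E)%E.
  have I0 N o : (0 <= I N o)%E by apply: integral_ge0 => x _; rewrite lee_fin sqr_ge0.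
  have cI (o : R -> Omega -> R) : measurable_fun Ospace (o^~ w) ->
      L2norm (fun x => S N x - o x w) @[N --> \oo] --> 0%E -> I N o @[N --> \oo] --> 0%E.
    move=> mow1 co; apply/cvge0P => // e e0.
    have co' : (I N o `^ 2^-1)%E @[N --> \oo] --> 0%E.
      apply: cvg_trans co; apply: near_eq_cvg; near=> N.
      by rewrite L2normE//; exact: measurable_funB.
    have := (cvge0P (fun N => poweR_ge0 (I N o) 2^-1)).1 co' (Num.sqrt e).
    rewrite sqrtr_gt0 => /(_ e0); apply: filterS => N H.
    have := lee_poweR (r := 2) _ (poweR_ge0 _ _) H.
    rewrite ler0n => /(_ isT); rewrite -poweRrM mulVf// poweRe1// poweR_EFin.
    by rewrite powR_mulrn ?sqrtr_ge0// (sqr_sqrtr (ltW e0)).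
  have c1 := cI om mow cw; have c2 := cI om' mow' cw'.
  apply/eqP; rewrite eq_le; apply/andP; split; last first.
    by apply: integral_ge0 => x _; exact: (D20 (x, w)).
  apply/lee_addgt0Pr => e e0; rewrite add0e.
  have [N [N1 N2]] : exists N, (I N om <= (e / 4)%:E)%E /\ (I N om' <= (e / 4)%:E)%E.
    have e40 : 0 < e / 4 by rewrite divr_gt0.
    have h1 := (cvge0P (I0 ^~ om)).1 c1 _ e40.
    have h2 := (cvge0P (I0 ^~ om')).1 c2 _ e40.
    have [N _ HN] := filterI h1 h2.
    by exists N; have := HN N (leqnn N).
  have mon (o : R -> Omega -> R) : measurable_fun Ospace (o^~ w) ->
     measurable_fun setT (fun x => (onO (fun x => S N x - o x w)%R x ^+ 2)%:E).
    move=> mo1; apply/measurable_EFinP; apply: measurable_funX.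
    by apply: measurable_onO; exact: measurable_funB.
  apply: (@le_trans _ _ (2%:E * I N om + 2%:E * I N om')%E).
    rewrite /I -!ge0_integralZl_EFin//; try exact: mon; try (by move=> x _; rewrite lee_fin sqr_ge0).
    rewrite -ge0_integralD//; last 4 first.
    - by move=> x _; rewrite mule_ge0// lee_fin sqr_ge0.
    - by apply: emeasurable_funM => //; exact: mon.
    - by move=> x _; rewrite mule_ge0// lee_fin sqr_ge0.
    - by apply: emeasurable_funM => //; exact: mon.
    apply: ge0_le_integral => //.
    - by move=> x _; exact: (D20 (x, w)).
    - exact: (measurableT_comp mD2 (measurable_pair2 w)).
    - by apply: emeasurable_funD; apply: emeasurable_funM => //; exact: mon.
    move=> x _; rewrite -!EFinM -EFinD lee_fin /D.
    have [xI|xI] := boolP (0 < x < 1); last by rewrite !onO_out// expr0n/= mulr0 addr0.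
    rewrite !onO_in//.
    have -> : om x w - om' x w = (S N x - om' x w) + - (S N x - om x w) by ring.
    by apply: le_trans (sqrD_le_dbl _ _) _; rewrite sqrrN addrC.
  apply: (@le_trans _ _ (2%:E * (e / 4)%:E + 2%:E * (e / 4)%:E)%E).
    by apply: leeD; apply: lee_wpmul2l.
  by rewrite -!EFinM -EFinD lee_fin; lra.
have mI : measurable_fun setT (fun w => \int[mu]_x (D x w ^+ 2)%:E)%E.
  exact: (measurable_fun_fubini_tonelli_G (m1 := mu) _ mD2 D20).
have : (\int[mu]_x \int[P]_w (D x w ^+ 2)%:E = 0)%E.
  rewrite (fubini_tonelli (m1 := mu) (m2 := P) _ mD2 D20).
  rewrite (ae_eq_integral (cst 0%E))//; first by rewrite integral0.
  by apply: ae_mono zero => w H _; exact: H.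
have mJ : measurable_fun setT (fun x : mR => \int[P]_w (D x w ^+ 2)%:E)%E.
  exact: (measurable_fun_fubini_tonelli_F (m2 := P) _ mD2 D20).
have J0 x : (0 <= \int[P]_w (D x w ^+ 2)%:E)%E.
  by apply: integral_ge0 => w _; exact: (D20 (x, w)).
move=> E0; have := ge0_integral_eq0_ae mJ J0 E0.
apply: ae_mono => x Hx xI.
have mDx : measurable_fun setT (fun w => (D x w ^+ 2)%:E) := measurableT_comp mD2 (measurable_pair1 x).
have := ge0_integral_eq0_ae mDx (fun w => D20 (x, w)) Hx.
apply: ae_mono => w [].
move/eqP; rewrite sqrf_eq0 /D onO_in// subr_eq0 => /eqP; exact.
Unshelve. all: by end_near. Qed.

End space_norm.

(** * The difference of two mild solutions *)

Section mild_difference.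
Context {d : measure_display} {Omega : measurableType d} {R : realType}.
Local Notation mu := (@lebesgue_measure R).
Local Notation mR := (measurableTypeR R).
Local Notation mu2 := (sfprod mu mu).
Variable P : probability Omega R.

Lemma lipschitz_bound (b : R -> R) : lipschitz b ->
  exists2 L, 0 <= L & forall x y, `|b x - b y| <= L * `|x - y|.
Proof.
move=> [M [Mr H]]; exists (`|M| + 1); first by rewrite addr_ge0.
move=> x y; apply: (H (`|M| + 1) _ (x, y)); last by split.
by rewrite ltr_pwDr// ler_norm.
Qed.

(** Mild solutions are only measurable on their domain; extended by 0 they
    are measurable everywhere. *)
Definition extend (T : R) (u : R -> R -> Omega -> R) (s x : R) (w : Omega) : R :=
  \1_`[0%R, T]%classic s * onO (fun x => u s x w) x.

Lemma extend_in (T : R) u s x w : 0 <= s <= T -> 0 < x < 1 -> extend T u s x w = u s x w.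
Proof. by move=> sT xI; rewrite /extend indicE mem_setE in_itv/= sT mul1r onO_in. Qed.

Lemma extend_out (T : R) u s x w : ~~ ((0 <= s <= T) && (0 < x < 1)) ->
  extend T u s x w = 0.
Proof.
rewrite negb_and => /orP[/negbTE H|H]; last by rewrite /extend onO_out// mulr0.
by rewrite /extend indicE mem_setE in_itv/= H mul0r.
Qed.

Lemma measurable_extend (T : R) (u : R -> R -> Omega -> R) :
  measurable_fun (Itime T `*` Ospace `*` [set: Omega])
    (fun z : mR * mR * Omega => u z.1.1 z.1.2 z.2) ->
  measurable_fun setT (fun z : mR * mR * Omega => extend T u z.1.1 z.1.2 z.2).
Proof.
move=> mu'.
have mD : measurable (Itime T `*` Ospace `*` [set: Omega] : set (mR * mR * Omega)).
  apply: measurableX => //; apply: measurableX; last exact: measurable_Ospace.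
  exact: measurable_itv.
have := (measurable_restrictT _ mD).1 mu'.
set f := (X in measurable_fun _ X -> _); set g := (X in _ -> measurable_fun _ X).
suff -> : f = g by [].
apply/funext => -[[s x] w]; rewrite /f /g /extend onO_patch !patchE /= !in_setX in_setT andbT.
rewrite indicE /Itime; by case: (s \in _); rewrite ?mul0r// mul1r.
Qed.

Lemma integral_extend_sqr (T : R) u w :
  measurable_fun setT (fun z : mR * mR => extend T u z.1 z.2 w) ->
  (\int[mu]_(s in Itime T) \int[mu]_(x in Ospace) (u s x w ^+ 2)%:E =
   \int[mu2]_z (extend T u z.1 z.2 w ^+ 2)%:E)%E.
Proof.
move=> mu'; rewrite integral2_mkcond sfprod_tonelli; last 2 first.
- by apply/measurable_EFinP; exact: measurable_funX.
- by move=> z; rewrite lee_fin sqr_ge0.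
apply: eq_integral => s _; apply: eq_integral => x _; congr EFin.
rewrite /extend /onO /Itime /Ospace /= !indicE.
by case: (s \in _); case: (x \in _); rewrite ?(mul1r, mul0r, mulr0) ?expr0n.
Qed.

Variables (T : R) (b : R -> R) (L : R).
Hypothesis T0 : 0 < T.
Hypothesis L0 : 0 <= L.
Hypothesis Lb : forall x y, `|b x - b y| <= L * `|x - y|.

Lemma measurable_lipschitz : measurable_fun setT (b : mR -> mR).
Proof.
apply: continuous_measurable_fun => x; apply/cvgrPdist_le => e e0.
have L1 : 0 < L + 1 by rewrite ltr_wpDl.
near=> y; apply: le_trans (Lb x y) _.
apply: (@le_trans _ _ (L * (e / (L + 1)))).
  apply: ler_wpM2l => //; near: y; apply: cvgr_dist_le; first exact: cvg_id.
  exact: divr_gt0.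
by rewrite mulrA ler_pdivrMr// mulrC ler_wpM2l ?(ltW e0)// lerDl.
Unshelve. all: by end_near. Qed.

Definition drift_density (u : R -> R -> Omega -> R) (w : Omega) (s y : R) : R :=
  \1_`[0%R, T]%classic s * \1_`]0%R, 1%R[%classic y * b (extend T u s y w).

Lemma measurable_drift_density u w :
  measurable_fun setT (fun z : mR * mR => extend T u z.1 z.2 w) ->
  measurable_fun setT (fun2 (drift_density u w)).
Proof.
move=> mu'; apply: measurable_funM.
  by apply: measurable_tensor; exact: measurable_indic.
exact: (measurableT_comp measurable_lipschitz mu').
Qed.

(** Square integrability survives [b], which has linear growth, as the domain has
    finite measure. *)
Lemma drift_density_sqr u w :
  measurable_fun setT (fun z : mR * mR => extend T u z.1 z.2 w) ->
  (\int[mu2]_z (extend T u z.1 z.2 w ^+ 2)%:E < +oo)%E ->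
  (\int[mu2]_z (drift_density u w z.1 z.2 ^+ 2)%:E < +oo)%E.
Proof.
move=> mu' fu.
pose B (z : mR * mR) : R := itvind (-1) T z.1 * itvind 0 1 z.2.
have mB : measurable_fun setT B := measurable_itvind2 _ _ _ _.
have mB2 : measurable_fun setT (fun z => (B z ^+ 2)%:E) by apply/measurable_EFinP; exact: measurable_funX.
have mu2' : measurable_fun setT (fun z : mR * mR => (extend T u z.1 z.2 w ^+ 2)%:E).
  by apply/measurable_EFinP; exact: measurable_funX.
have mF := measurable_drift_density mu'.
apply: (@le_lt_trans _ _ (\int[mu2]_z ((2 * b 0 ^+ 2)%:E * (B z ^+ 2)%:E + (2 * L ^+ 2)%:E * (extend T u z.1 z.2 w ^+ 2)%:E))%E).
  apply: ge0_le_integral => //.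
  - by move=> z _; rewrite lee_fin sqr_ge0.
  - by apply/measurable_EFinP; exact: measurable_funX mF.
  - by apply: emeasurable_funD; apply: emeasurable_funM.
  move=> z _; rewrite -!EFinM -EFinD lee_fin /drift_density /B.
  set e := extend T u z.1 z.2 w.
  have rhs0 (v : R) : 0 <= 2 * b 0 ^+ 2 * v ^+ 2 + 2 * L ^+ 2 * e ^+ 2.
    by rewrite addr_ge0// mulr_ge0 ?sqr_ge0// mulr_ge0 ?sqr_ge0.
  have [/andP[sT yO]|H] := boolP ((0 <= z.1 <= T) && (0 < z.2 < 1)); last first.
    have -> : \1_`[0%R, T]%classic z.1 * \1_`]0%R, 1%R[%classic z.2 = 0 :> R.
      rewrite !indicE !mem_setE !in_itv/=.
      by move: H; rewrite negb_and => /orP[] /negbTE ->; rewrite ?mul0r ?mulr0.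
    by rewrite mul0r expr0n.
  have -> : itvind (-1) T z.1 * itvind 0 1 z.2 = 1 :> R.
    have /andP[s0 s1] := sT; have /andP[y0 y1] := yO.
    rewrite !itvindE y0 (ltW y1) s1 (_ : -1 < z.1) ?mulr1//.
    by apply: lt_le_trans s0; rewrite ltrN10.
  rewrite !indicE !mem_setE !in_itv/= sT yO !mul1r expr1n mulr1.
  have -> : b e = b 0 + (b e - b 0) by ring.
  apply: le_trans (sqrD_le_dbl _ _) _; rewrite lerD2l -mulrA ler_wpM2l//.
  have := Lb e 0; rewrite subr0 => H.
  rewrite -(real_normK (num_real (b e - b 0))) -(real_normK (num_real e)) -exprMn.
  by apply: lerXn2r; rewrite ?nnegrE ?mulr_ge0.
rewrite ge0_integralD//; last 4 first.
- by move=> z _; rewrite mule_ge0// lee_fin ?sqr_ge0// mulr_ge0 ?sqr_ge0.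
- exact: emeasurable_funM.
- by move=> z _; rewrite mule_ge0// lee_fin ?sqr_ge0// mulr_ge0 ?sqr_ge0.
- exact: emeasurable_funM.
rewrite !ge0_integralZl_EFin//; last 4 first.
- by move=> z _; rewrite lee_fin sqr_ge0.
- by rewrite mulr_ge0 ?sqr_ge0.
- by move=> z _; rewrite lee_fin sqr_ge0.
- by rewrite mulr_ge0 ?sqr_ge0.
rewrite /B (integral_tensor_sqr (measurable_itvind _ _) (measurable_itvind _ _)).
have iE (l r : R) : l <= r -> (\int[mu]_y (itvind l r y ^+ 2)%:E = (r - l)%:E)%E.
  by move=> lr; under eq_integral => y _ do rewrite itvind_sqr; exact: integral_itvind.
have T1 : -1 <= T by apply: le_trans (ltW T0); rewrite lerN10.
rewrite !iE// -!EFinM; apply: lte_add_pinfty; first exact: ltry.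
by apply: lte_mul_pinfty => //; rewrite lee_fin mulr_ge0 ?sqr_ge0.
Qed.

Definition error (u ut : R -> R -> Omega -> R) (s x : R) (w : Omega) : R :=
  extend T u s x w - extend T ut s x w.

Variables (u ut : R -> R -> Omega -> R).
Hypothesis mu' : measurable_fun setT (fun z : mR * mR * Omega => extend T u z.1.1 z.1.2 z.2).
Hypothesis mut : measurable_fun setT (fun z : mR * mR * Omega => extend T ut z.1.1 z.1.2 z.2).

Lemma measurable_error : measurable_fun setT (fun z : mR * mR * Omega => error u ut z.1.1 z.1.2 z.2).
Proof. exact: measurable_funB. Qed.

Let measurable_at (f : mR * mR * Omega -> R) (w : Omega) :
  measurable_fun setT f -> measurable_fun setT (fun z : mR * mR => f (z, w)).
Proof. by move=> mf; exact: (measurableT_comp mf (measurable_pair2 w)). Qed.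

Lemma integral_error_sqr w :
  (\int[mu2]_z (extend T u z.1 z.2 w ^+ 2)%:E < +oo)%E ->
  (\int[mu2]_z (extend T ut z.1 z.2 w ^+ 2)%:E < +oo)%E ->
  (\int[mu2]_z (error u ut z.1 z.2 w ^+ 2)%:E < +oo)%E.
Proof.
move=> fu fut.
have m1 := measurable_at w mu'; have m2 := measurable_at w mut.
have m3 := measurable_at w measurable_error; rewrite /= in m1 m2 m3.
have s1 : measurable_fun setT (fun z : mR * mR => (extend T u z.1 z.2 w ^+ 2)%:E).
  by apply/measurable_EFinP; exact: measurable_funX.
have s2 : measurable_fun setT (fun z : mR * mR => (extend T ut z.1 z.2 w ^+ 2)%:E).
  by apply/measurable_EFinP; exact: measurable_funX.
apply: (@le_lt_trans _ _ (\int[mu2]_z (2%:E * (extend T u z.1 z.2 w ^+ 2)%:E + 2%:E * (extend T ut z.1 z.2 w ^+ 2)%:E))%E).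
  apply: ge0_le_integral => //.
  - by move=> z _; rewrite lee_fin sqr_ge0.
  - by apply/measurable_EFinP; exact: measurable_funX.
  - by apply: emeasurable_funD; apply: emeasurable_funM.
  move=> z _; rewrite -!EFinM -EFinD lee_fin /error.
  by apply: le_trans (sqrD_le_dbl _ _) _; rewrite sqrrN.
rewrite ge0_integralD//; last 4 first.
- by move=> z _; rewrite mule_ge0// lee_fin sqr_ge0.
- exact: emeasurable_funM.
- by move=> z _; rewrite mule_ge0// lee_fin sqr_ge0.
- exact: emeasurable_funM.
rewrite !ge0_integralZl_EFin//; try (by move=> z _; rewrite lee_fin sqr_ge0).
by apply: lte_add_pinfty; apply: lte_mul_pinfty.
Qed.

Lemma integral_sq_error w :
  (\int[mu]_s sq_error (error u ut) s w = \int[mu2]_z (error u ut z.1 z.2 w ^+ 2)%:E)%E.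
Proof.
have m3 := measurable_at w measurable_error; rewrite /= in m3.
rewrite sfprod_tonelli//; last by move=> z; rewrite lee_fin sqr_ge0.
by apply/measurable_EFinP; exact: measurable_funX.
Qed.

Lemma integral_upto_error t w :
  (\int[mu2]_z ((upto t z.1 * error u ut z.1 z.2 w) ^+ 2)%:E =
   sq_error_upto (error u ut) t w)%E.
Proof.
have m3 := measurable_at w measurable_error; rewrite /= in m3.
rewrite sfprod_tonelli; last 2 first.
- apply/measurable_EFinP; apply: measurable_funX; apply: measurable_funM => //.
  by apply: measurable_upto; [exact: measurable_cst|exact: measurable_fst].
- by move=> z; rewrite lee_fin sqr_ge0.
apply: eq_integral => s _ /=; rewrite /sq_error -ge0_integralZl//; last 3 first.
- apply/measurable_EFinP; apply: measurable_funX.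
  exact: (measurableT_comp m3 (measurable_pair1 s)).
- by move=> y _; rewrite lee_fin sqr_ge0.
- by rewrite lee_fin upto_ge0.
apply: eq_integral => y _; rewrite -EFinM; congr EFin; rewrite exprMn uptoE.
by case: (s <= t); rewrite ?expr1n ?expr0n.
Qed.

Lemma sq_error_upto_fin t w :
  (\int[mu2]_z (error u ut z.1 z.2 w ^+ 2)%:E < +oo)%E ->
  (sq_error_upto (error u ut) t w < +oo)%E.
Proof.
move=> fin; apply: le_lt_trans fin; rewrite -integral_upto_error.
have m3 := measurable_at w measurable_error; rewrite /= in m3.
apply: ge0_le_integral => //.
- by move=> z _; rewrite lee_fin sqr_ge0.
- apply/measurable_EFinP; apply: measurable_funX; apply: measurable_funM => //.
  by apply: measurable_upto; [exact: measurable_cst|exact: measurable_fst].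
- by apply/measurable_EFinP; exact: measurable_funX.
- move=> z _; rewrite lee_fin exprMn uptoE; case: (z.1 <= t).
    by rewrite expr1n mul1r.
  by rewrite expr0n mul0r sqr_ge0.
Qed.

Definition kernel_sqr (E : spde) (t x : R) : R :=
  fine (\int[mu2]_z (kernel E t x z.1 z.2 ^+ 2)%:E).

(** Cauchy-Schwarz for the kernel and [b u - b ut], restricted to the times before
    [t], where the kernel lives. *)
Lemma drift_difference E t x w : 0 <= t <= T -> 0 < x < 1 ->
  (\int[mu2]_z (kernel E t x z.1 z.2 ^+ 2)%:E < +oo)%E ->
  (\int[mu2]_z (extend T u z.1 z.2 w ^+ 2)%:E < +oo)%E ->
  (\int[mu2]_z (extend T ut z.1 z.2 w ^+ 2)%:E < +oo)%E ->
  `|\int[mu]_(s in Itime t) \int[mu]_(y in Ospace) (green E (t - s) x y * b (u s y w))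
    - \int[mu]_(s in Itime t) \int[mu]_(y in Ospace) (green E (t - s) x y * b (ut s y w))|
  <= Num.sqrt (kernel_sqr E t x) * (L * Num.sqrt (fine (sq_error_upto (error u ut) t w))).
Proof.
move=> /andP[t0 tT] xI fK fu fut.
have m1 := measurable_at w mu'; have m2 := measurable_at w mut; rewrite /= in m1 m2.
have mK := measurable_fun3 x (measurable_kernel E t).
have d1 := measurable_drift_density m1; have d2 := measurable_drift_density m2.
have i1 := integrable_mul_sqr (m := mu2) mK d1 fK (drift_density_sqr m1 fu).
have i2 := integrable_mul_sqr (m := mu2) mK d2 fK (drift_density_sqr m2 fut).
have dE (v : R -> R -> Omega -> R) s y : 0 < s < t -> 0 < y < 1 ->
    drift_density v w s y = b (v s y w).
  move=> /andP[s0 st] yI.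
  have sT : 0 <= s <= T by rewrite (ltW s0) (le_trans (ltW st)).
  by rewrite /drift_density !indicE !mem_setE !in_itv/= sT yI !mul1r extend_in.
rewrite (@kernel_integralE R E t x _ (drift_density u w) xI d1)//; last by move=> *; exact: dE.
rewrite (@kernel_integralE R E t x _ (drift_density ut w) xI d2)//; last by move=> *; exact: dE.
rewrite -RintegralB//.
pose G (z : mR * mR) : R := upto t z.1 * (drift_density u w z.1 z.2 - drift_density ut w z.1 z.2).
rewrite (eq_Rintegral mu2 (g := fun z => fun2 (kernel E t x) z * G z)); last first.
  move=> z _; rewrite /G /fun2 uptoE -mulrBr.
  have [zt|zt] := leP z.1 t; first by rewrite mul1r.
  by rewrite kernel_out ?mul0r// (ltNge z.1 t) (ltW zt) !andbF.
have mG : measurable_fun setT G.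
  apply: measurable_funM; first by apply: measurable_upto; [exact: measurable_cst|exact: measurable_fst].
  exact: measurable_funB d1 d2.
have A0 : 0 <= fine (sq_error_upto (error u ut) t w) by rewrite fine_ge0// sq_error_upto_ge0.
have Afin : sq_error_upto (error u ut) t w \is a fin_num.
  by rewrite ge0_fin_numE ?sq_error_upto_ge0//; apply: sq_error_upto_fin; exact: integral_error_sqr.
have K0 : (0 <= \int[mu2]_z (kernel E t x z.1 z.2 ^+ 2)%:E)%E.
  by apply: integral_ge0 => z _; rewrite lee_fin sqr_ge0.
have -> : L * Num.sqrt (fine (sq_error_upto (error u ut) t w)) =
    Num.sqrt (L ^+ 2 * fine (sq_error_upto (error u ut) t w)).
  by rewrite sqrtrM ?sqr_ge0// sqrtr_sqr ger0_norm.
apply: Rintegral_cauchy_schwarz => //.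
- by rewrite fine_ge0.
- by rewrite mulr_ge0// sqr_ge0.
- by rewrite /kernel_sqr fineK// ge0_fin_numE.
rewrite EFinM fineK// -integral_upto_error -ge0_integralZl_EFin//; last 3 first.
- by move=> z _; rewrite lee_fin sqr_ge0.
- apply/measurable_EFinP; apply: measurable_funX; apply: measurable_funM.
    by apply: measurable_upto; [exact: measurable_cst|exact: measurable_fst].
  by have := measurable_at w measurable_error.
- exact: sqr_ge0.
apply: ge0_le_integral => //.
- by move=> z _; rewrite lee_fin sqr_ge0.
- by apply/measurable_EFinP; exact: measurable_funX.
- apply: emeasurable_funM => //; apply/measurable_EFinP; apply: measurable_funX; apply: measurable_funM.
    by apply: measurable_upto; [exact: measurable_cst|exact: measurable_fst].
  by have := measurable_at w measurable_error.
move=> z _; rewrite -EFinM lee_fin /G -exprMn mulrCA.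
set p := upto t z.1; rewrite !exprMn ler_wpM2l ?sqr_ge0//.
rewrite /drift_density -mulrBr -exprMn.
set i := \1__ _ * _; set e := extend _ u _ _ _; set e' := extend _ ut _ _ _.
rewrite -(real_normK (num_real (i * _))) -(real_normK (num_real (L * _))).
apply: lerXn2r; rewrite ?nnegrE// normrM.
apply: (@le_trans _ _ (1 * `|b e - b e'|)).
  apply: ler_wpM2r => //; rewrite /i !indicE !mem_setE ger0_norm ?mulr_ge0//.
  by apply: mulr_ile1 => //; rewrite lern1 leq_b1.
by rewrite mul1r normrM (ger0_norm L0); exact: Lb.
Qed.

End mild_difference.

(** * The rate of convergence *)

Section wong_zakai.
Context {d : measure_display} {Omega : measurableType d} {R : realType}.
Local Notation mu := (@lebesgue_measure R).
Local Notation mR := (measurableTypeR R).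
Local Notation mu2 := (sfprod mu mu).
Variable P : probability Omega R.
Variables (T H p : R) (b : R -> R) (L K : R).
Hypothesis T0 : 0 < T.
Hypothesis H0 : 0 < H.
Hypothesis H1 : H <= 2^-1.
Hypothesis p2 : 2 <= p.
Hypothesis L0 : 0 <= L.
Hypothesis Lb : forall x y, `|b x - b y| <= L * `|x - y|.
Hypothesis K0 : 0 <= K.
Hypothesis gaussK : forall (X : Omega -> R) (v : R), centered_gaussian P X ->
  (\int[P]_w (X w ^+ 2)%:E <= v%:E)%E ->
  (\int[P]_w (`|X w| `^ p)%:E <= (K * v `^ (p / 2))%:E)%E.
Variables (E : spde) (W : R -> R -> Omega -> R).
Hypothesis sheet : fractional_sheet P T H W.
Variables (m n : nat).
Hypothesis m0 : (0 < m)%N.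
Hypothesis n0 : (0 < n)%N.
Variables (c : R -> Omega -> nat -> R) (u ut : R -> R -> Omega -> R).
Hypothesis mild_u : mild_solution P T E b c (conv_rough P T W) u.
Hypothesis mild_ut : mild_solution P T E b c (conv_wz T m n W) ut.

Let mu' : measurable_fun setT (fun z : mR * mR * Omega => extend T u z.1.1 z.1.2 z.2).
Proof. by case: mild_u => mu0 _ _; exact: measurable_extend. Qed.

Let mut : measurable_fun setT (fun z : mR * mR * Omega => extend T ut z.1.1 z.1.2 z.2).
Proof. by case: mild_ut => mut _ _; exact: measurable_extend. Qed.

Let p0 : 0 < p. Proof. by apply: lt_le_trans p2. Qed.

Lemma ae_extend_sqr (v : R -> R -> Omega -> R) conv : mild_solution P T E b c conv v ->
  {ae P, forall w, (\int[mu2]_z (extend T v z.1 z.2 w ^+ 2)%:E < +oo)%E}.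
Proof.
move=> [mv fv _]; apply: ae_mono fv => w; rewrite integral_extend_sqr//.
exact: (measurableT_comp (measurable_extend mv) (measurable_pair2 w)).
Qed.

(** In the difference of the two mild formulations the initial terms cancel, and
    [noise_part] subtracts the bound of the drift terms. *)
Lemma noise_part_le (t : R) : 0 <= t <= T ->
  exists Z Zt : R -> Omega -> R, {ae mu, forall x, 0 < x < 1 ->
    [/\ conv_rough P T W E t x (Z x), conv_wz T m n W E t x (Zt x) &
     {ae P, forall w, noise_part L (error T u ut) (kernel_sqr E) t x w <= `|Z x w - Zt x w|}]}.
Proof.
move=> tT; have /andP[t0 tT'] := tT.
have tI : t \in `[0, T] by rewrite in_itv.
have [_ _ /(_ t tI)[om [Z [ex1 /ae_muO cZ /ae_muO eu]]]] := mild_u.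
have [_ _ /(_ t tI)[om' [Zt [ex2 /ae_muO cZt /ae_muO eut]]]] := mild_ut.
have eom := expansion_unique ex1 ex2.
have fK := ae_kernel_sqr E t0 tT'.
exists Z, Zt.
have := ae_mono3 (fun x a b c => conj a (conj b c)) eom eu eut.
apply: ae_mono3 (ae_mono2 (fun x a b => conj a b) cZ cZt) fK => x [cZx cZtx] fKx [eomx [eux eutx]] xI.
split; [exact: cZx|exact: cZtx|].
have aef := ae_mono2 (fun x a b => conj a b) (ae_extend_sqr mild_u) (ae_extend_sqr mild_ut).
have := ae_mono3 (fun x a b c => conj a (conj b c)) (eomx xI) (eux xI) (eutx xI).
apply: ae_mono2 aef => w [fu fut] [eo [e1 e2]].
rewrite /noise_part ge_max normr_ge0/= lerBlDr.
have -> : error T u ut t x w = u t x w - ut t x w by rewrite /error !extend_in.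
rewrite e1 e2 eo.
have := drift_difference T0 L0 Lb mu' mut tT xI fKx fu fut.
set D := \int[mu]_(s in _) _; set D' := \int[mu]_(s in _) _ => HD.
have -> : om' x w + D + Z x w - (om' x w + D' + Zt x w) = (Z x w - Zt x w) + (D - D') by ring.
by apply: (le_trans (ler_normD _ _)); rewrite lerD2l.
Qed.

Lemma measurable_kernel_sqr (t : R) : measurable_fun setT (kernel_sqr E t).
Proof.
apply: (measurableT_comp (fine_measurable measurableT)).
apply: (measurable_fun_fubini_tonelli_F (m2 := mu2) (fun w => (fun3 (kernel E t) w ^+ 2)%:E)).
  by apply/measurable_EFinP; apply: measurable_funX; exact: measurable_kernel.
by move=> w; rewrite lee_fin sqr_ge0.
Qed.

Lemma integral_kernel_sqr (t : R) : 0 <= t <= T ->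
  (\int[mu]_x (kernel_sqr E t x)%:E <= (2 * (1 + T))%:E)%E.
Proof.
move=> /andP[t0 tT]; apply: le_trans (kernel_sqr_l1 E t0 tT).
have K2 x : (0 <= \int[mu2]_z (kernel E t x z.1 z.2 ^+ 2)%:E)%E.
  by apply: integral_ge0 => z _; rewrite lee_fin sqr_ge0.
apply: ge0_le_integral => //.
- by move=> x _; rewrite lee_fin fine_ge0.
- by apply/measurable_EFinP; exact: measurable_kernel_sqr.
- apply: (measurable_fun_fubini_tonelli_F (m2 := mu2) (fun w => (fun3 (kernel E t) w ^+ 2)%:E)).
    by apply/measurable_EFinP; apply: measurable_funX; exact: measurable_kernel.
  by move=> w; rewrite lee_fin sqr_ge0.
- move=> x _; rewrite /kernel_sqr; move: (K2 x); case: (X in (_ <= X)%E) => //=.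
Qed.

Let measurable_err := measurable_error mu' mut.

Variable rho : R -> R.
Hypothesis mrho : measurable_fun setT rho.
Hypothesis rho0 : forall x, 0 <= rho x.
Hypothesis rho1 : forall x, rho x <= 1.
Hypothesis rhoH : forall l, 0 <= l -> l <= 1 ->
  (\int[mu]_x (2 * Num.min (rho x) l)%:E = (l `^ (2 * H))%:E)%E.

Definition wz_bound : R := 512 * (4 + T) * (1 + (2 * H)^-1) * wz_rate (2 * H) E T m n.

Lemma wz_bound_gt0 : 0 < wz_bound.
Proof.
have n0' : 0 < n%:R :> R by rewrite ltr0n.
have k0 : 0 < T / m%:R by rewrite divr_gt0// ltr0n.
apply: mulr_gt0; first apply: mulr_gt0; first apply: mulr_gt0.
- by rewrite ltr0n.
- by rewrite addr_gt0.
- by rewrite addr_gt0// invr_gt0 mulr_gt0.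
- by rewrite addr_gt0 ?powR_gt0// mulr_gt0 ?powR_gt0// time_rate_gt0.
Qed.

(** The profile is twice the form of the kernel minus its projection, as
    [noise_integral_moment] demands.  The added multiple of a probability density
    makes that strict inequality hold and the profile positive, even where the
    form vanishes. *)
Lemma noise_part_moment (t : R) : 0 <= t <= T -> exists r : R -> R,
  [/\ measurable_fun setT r, forall x, 0 < r x,
   (\int[mu]_x (r x)%:E <= (3 * wz_bound)%:E)%E &
   {ae mu, forall x, (\int[P]_w ((noise_part L (error T u ut) (kernel_sqr E) t x w ^+ 2)%:E `^ (p / 2))
       <= (K * r x `^ (p / 2))%:E)%E}].
Proof.
move=> tT; have /andP[t0 tT'] := tT.
have tI : t \in `[0, T] by rewrite in_itv.
pose V (x : R) : \bar R := incr_form rho (fun s y => kernel E t x s y - kproj E T t m n x s y)%R.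
have mG : measurable_fun setT (fun3 (fun x s y => kernel E t x s y - kproj E T t m n x s y)).
  by apply: measurable_funB; [exact: measurable_kernel|exact: measurable_kproj].
have mV : measurable_fun setT V by exact: measurable_incr_form.
have V0 x : (0 <= V x)%E by exact: incr_form_ge0.
have h20 : 0 < 2 * H by exact: mulr_gt0.
have h21 : 2 * H <= 1 by have := ler_wpM2l (ler0n R 2) H1; rewrite divff ?pnatr_eq0.
have VB : (\int[mu]_x V x <= wz_bound%:E)%E.
  exact: (integral_incr_form_kproj E T0 t0 tT' m0 n0 mrho rho0 rho1 h20 h21 rhoH).
move: (wz_bound) wz_bound_gt0 VB => B B0 VB.
have Vfin : {ae mu, forall x, (V x < +oo)%E}.
  exact: (@ae_lt_pinfty R _ mR mu V mV V0 (le_lt_trans VB (ltry _))).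
have [g mg [g0 g1]] := @exists_positive_density R.
pose r (x : R) : R := 2 * fine (V x) + B * g x.
have mf : measurable_fun setT (fun x : mR => fine (V x)).
  exact: (measurableT_comp (fine_measurable measurableT) mV).
have fV0 x : 0 <= fine (V x) by rewrite fine_ge0.
have r0 x : 0 < r x by rewrite ltr_wpDl ?mulr_gt0// mulr_ge0.
exists r; split => //.
- by apply: measurable_funD; apply: measurable_funM.
- under eq_integral => x _ do rewrite /r EFinD.
  rewrite ge0_integralD//; last 4 first.
  + by move=> x _; rewrite lee_fin mulr_ge0.
  + by apply/measurable_EFinP; apply: measurable_funM.
  + by move=> x _; rewrite lee_fin mulr_ge0 ?(ltW (g0 _))// ltW.
  + by apply/measurable_EFinP; apply: measurable_funM.
  have -> : 3 * B = 2 * B + B by ring.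
  rewrite EFinD; apply: leeD.
    apply: (@le_trans _ _ (\int[mu]_x (2%:E * V x))%E).
      apply: ge0_le_integral => //.
      * by move=> x _; rewrite lee_fin mulr_ge0.
      * by apply/measurable_EFinP; apply: measurable_funM.
      * exact: emeasurable_funM.
      move=> x _; rewrite EFinM; apply: lee_wpmul2l => //.
      by move: (V0 x); case: (V x) => //= _; exact: leey.
    by rewrite ge0_integralZl_EFin// EFinM; apply: lee_wpmul2l.
  under eq_integral => x _ do rewrite EFinM.
  rewrite ge0_integralZl_EFin ?(ltW B0)//; last 2 first.
  + by move=> x _; rewrite lee_fin ltW.
  + exact/measurable_EFinP.
  by rewrite g1 mule1.
have [Z [Zt aeZ]] := noise_part_le tT.
apply: ae_mono3 aeZ Vfin (ae_kernel_sqr E t0 tT') => x Zx Vx Kx.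
have [xI|xI] := boolP (0 < x < 1); last first.
  rewrite integral0_eq; first by rewrite lee_fin mulr_ge0// powR_ge0.
  move=> w _; rewrite /noise_part /error !extend_out ?(negbTE xI) ?andbF// subrr normr0 sub0r.
  rewrite max_l; last by rewrite oppr_le0 !mulr_ge0 ?sqrtr_ge0.
  by rewrite expr0n poweR_EFin powR0// gt_eqF// divr_gt0.
have [cR cW aeP] := Zx xI.
have el := conv_wz_elementary T0 m0 n0 xI Kx cW.
have mZ : measurable_fun setT (Z x) by case: cR.
have mZt : measurable_fun setT (Zt x) := measurable_elementary_noise sheet el.
apply: (@le_trans _ _ (\int[P]_w (`|Z x w - Zt x w| `^ p)%:E)%E).
  apply: ae_ge0_le_integral => //.
  - by move=> w _; exact: poweR_ge0.
  - apply: (measurableT_comp (measurable_poweR (p / 2))); apply/measurable_EFinP.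
    apply: measurable_funX.
    have := measurable_noise_part L measurable_err (fun t _ => measurable_kernel_sqr t) tI.
    by move=> H'; exact: (measurableT_comp H' (measurable_pair1 x)).
  - apply/measurable_EFinP; apply: (measurableT_comp (measurable_powR p)).
    by apply: (measurableT_comp (@normr_measurable R setT)); exact: measurable_funB.
  apply: ae_mono aeP => w Hw _; rewrite poweR_EFin lee_fin.
  have np0 : 0 <= noise_part L (error T u ut) (kernel_sqr E) t x w by rewrite /noise_part le_max lexx.
  rewrite -powR_mulrn// -powRrM mulrCA divff ?pnatr_eq0// mulr1.
  by apply: ge0_ler_powR => //; rewrite ?nnegrE// ltW.
have mKx := measurable_fun3 x (measurable_kernel E t).
apply: (noise_integral_moment p0 sheet mrho rho0 rhoH gaussK cR el mKx).
- move=> s y sI yI; move: yI; rewrite in_itv/= => yI.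
  rewrite /kernel !indicE !mem_setE !in_itv/= xI yI mul1r mulr1.
  by [].
- move=> s y; rewrite !in_itv/= => H'; apply: kernel_out; apply: contra H'.
  by move=> /and4P[_ /andP[s0 s1] y0 y1]; rewrite y0 y1 (ltW s0) (le_trans (ltW s1)).
- rewrite -/(V x); have -> : V x = (fine (V x))%:E by rewrite fineK// ge0_fin_numE.
  by rewrite -EFinM lte_fin /r ltrDl mulr_gt0.
Qed.

Lemma L2norm_sq_error (t : R) (w : Omega) : 0 <= t <= T ->
  (L2norm (fun x => u t x w - ut t x w)%R = sq_error (error T u ut) t w `^ 2^-1)%E.
Proof.
move=> tT.
have oE : onO (fun x => u t x w - ut t x w) = fun x => error T u ut t x w.
  apply/funext => x; rewrite /error /extend indicE mem_setE in_itv/= tT !mul1r /onO.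
  by rewrite mulrBr.
have mO : measurable_fun Ospace (fun x => u t x w - ut t x w).
  have [_ H'] := measurable_restrictT (fun x => u t x w - ut t x w) (@measurable_Ospace R).
  apply: H'; rewrite -onO_patch oE.
  apply: (measurableT_comp measurable_err (g := fun x : mR => ((t, x), w) : mR * mR * Omega)).
  apply: measurable_fun_pair; last exact: measurable_cst.
  by apply: measurable_fun_pair; [exact: measurable_cst|].
by rewrite L2normE// oE.
Qed.

Lemma sup_error_le :
  (sup_error P T p u ut <=
   ((gronwall_const T K (p / 2) L (2 * (1 + T)) * (3 * wz_bound) `^ (p / 2)) `^ p^-1)%:E)%E.
Proof.
apply: ge_ereal_sup => _ [t /= tI <-].
have tT : 0 <= t <= T by move: tI; rewrite /= in_itv.
have q1 : 1 <= p / 2 by rewrite ler_pdivlMr// mul1r.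
have C0 : 0 <= 2 * (1 + T) by rewrite mulr_ge0// addr_ge0// ltW.
have S0 : 0 < 3 * wz_bound by rewrite mulr_gt0// wz_bound_gt0.
have fin : {ae P, forall w, (\int[mu]_s sq_error (error T u ut) s w < +oo)%E}.
  apply: ae_mono2 (ae_extend_sqr mild_u) (ae_extend_sqr mild_ut) => w f1 f2.
  by rewrite integral_sq_error//; exact: integral_error_sqr.
have out (s x : R) w : s \notin `[0, T] -> error T u ut s x w = 0.
  by rewrite in_itv/= => H'; rewrite /error !extend_out ?subrr// negb_and H'.
have mom := @sq_error_moment _ _ _ P _ _ _ _ _ _ _ _ T0 K0 q1 L0 C0 S0 measurable_err out
  (fun s _ => measurable_kernel_sqr s).
have kap0 (s x : R) : 0 <= kernel_sqr E s x.
  by rewrite fine_ge0// integral_ge0// => z _; rewrite lee_fin sqr_ge0.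
have kapC (s : R) : s \in `[0, T] -> (\int[mu]_x (kernel_sqr E s x)%:E <= (2 * (1 + T))%:E)%E.
  by rewrite in_itv => H'; exact: integral_kernel_sqr.
have nm (s : R) : s \in `[0, T] -> _ := fun H' => @noise_part_moment s H'.
have {}mom := mom kap0 kapC fin nm t tI.
rewrite Lnorm.unlock -poweR_EFin; apply: lee_poweR.
- by rewrite invr_ge0 ltW.
- by apply: integral_ge0 => w _; exact: poweR_ge0.
apply: le_trans mom; rewrite le_eqVlt; apply/orP; left; apply/eqP.
apply: eq_integral => w _; rewrite L2norm_sq_error// gee0_abs ?poweR_ge0//.
by rewrite -poweRrM mulrC.
Qed.

(** Subadditivity of the square root. *)
Lemma sqrt_wz_rate : wz_rate (2 * H) E T m n `^ 2^-1 <=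
  n%:R^-1 `^ H + time_rate E (T / m%:R) `^ 2^-1 * n%:R^-1 `^ (H - 2^-1).
Proof.
have n0' : 0 < n%:R :> R by rewrite ltr0n.
have k0 : 0 < T / m%:R by rewrite divr_gt0// ltr0n.
have x0 : 0 < time_rate E (T / m%:R) by exact: time_rate_gt0.
have nI (e : R) : n%:R^-1 `^ e = n%:R `^ (- e).
  by rewrite -powR_inv1 ?(ltW n0')// -powRrM mulN1r.
rewrite !nI /wz_rate.
have -> : n%:R `^ (- H) = (n%:R `^ (- (2 * H))) `^ 2^-1 :> R.
  by rewrite -powRrM mulNr mulrAC divff ?pnatr_eq0// mul1r.
have -> : n%:R `^ (- (H - 2^-1)) = (n%:R `^ (1 - 2 * H)) `^ 2^-1 :> R.
  rewrite -powRrM mulrBl mul1r mulrAC divff ?pnatr_eq0// mul1r opprB.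
  by [].
rewrite -powRM ?powR_ge0 ?(ltW x0)//.
set y := n%:R `^ _; set z := time_rate _ _ * _.
have y0 : 0 <= y by exact: powR_ge0.
have z0 : 0 <= z by rewrite mulr_ge0 ?powR_ge0// ltW.
rewrite !powR12_sqrt ?addr_ge0//.
rewrite -(@ler_pXn2r _ 2) ?nnegrE ?addr_ge0 ?sqrtr_ge0//.
rewrite sqr_sqrtr ?addr_ge0// sqrrD !sqr_sqrtr// addrAC lerDl.
by rewrite mulrn_wge0// mulr_ge0 ?sqrtr_ge0.
Qed.

Definition wz_const : R :=
  gronwall_const T K (p / 2) L (2 * (1 + T)) `^ p^-1
  * (3 * (512 * (4 + T) * (1 + (2 * H)^-1))) `^ 2^-1.

Lemma sup_error_le_rate :
  (sup_error P T p u ut <= (wz_const * (n%:R^-1 `^ H +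
     time_rate E (T / m%:R) `^ 2^-1 * n%:R^-1 `^ (H - 2^-1)))%:E)%E.
Proof.
apply: le_trans sup_error_le _; rewrite lee_fin.
have p00 : p != 0 by rewrite gt_eqF.
have G0 : 0 <= gronwall_const T K (p / 2) L (2 * (1 + T)).
  by rewrite /gronwall_const !(mulr_ge0, addr_ge0, powR_ge0).
have c0 : 0 <= 3 * (512 * (4 + T) * (1 + (2 * H)^-1)) :> R.
  apply: mulr_ge0; first exact: ler0n; apply: mulr_ge0.
    by apply: mulr_ge0; [exact: ler0n|rewrite addr_ge0// ltW].
  by rewrite addr_ge0// invr_ge0 mulr_ge0// ltW.
have r0 : 0 <= wz_rate (2 * H) E T m n.
  rewrite addr_ge0 ?powR_ge0// mulr_ge0 ?powR_ge0// ltW// time_rate_gt0//.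
  by rewrite divr_gt0// ltr0n.
rewrite powRM ?powR_ge0// -powRrM mulrAC divff// mul1r.
rewrite (_ : 3 * wz_bound = 3 * (512 * (4 + T) * (1 + (2 * H)^-1)) * wz_rate (2 * H) E T m n); last first.
  by exact: mulrA.
rewrite powRM// /wz_const -[leRHS]mulrA; apply: ler_wpM2l; first exact: powR_ge0.
by apply: ler_wpM2l; [exact: powR_ge0|exact: sqrt_wz_rate].
Qed.

End wong_zakai.

Lemma wong_zakai_rate (R : realType) (d : measure_display)
    (Omega : measurableType d) (P : probability Omega R)
    (T H p : R) (b : R -> R) (E : spde) (c : R -> Omega -> nat -> R) :
  0 < T -> 0 < H -> H <= 2^-1 -> 2 <= p -> lipschitz b ->
  exists C : R,
     forall W : R -> R -> Omega -> R, fractional_sheet P T H W ->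
     forall m n : nat, (0 < m)%N -> (0 < n)%N ->
     forall u ut : R -> R -> Omega -> R,
       mild_solution P T E b c (conv_rough P T W) u ->
       mild_solution P T E b c (conv_wz T m n W) ut ->
       (sup_error P T p u ut
          <= (C * (n%:R^-1 `^ H + time_rate E (T / m%:R) `^ 2^-1 * n%:R^-1 `^ (H - 2^-1)))%:E)%E.
Proof.
move=> T0 H0 H1 p2 blip.
have [L L0 Lb] := lipschitz_bound blip.
have p0 : 0 < p by exact: lt_le_trans p2.
have [K K0 gK] := gaussian_moment P p0.
have [rho [mrho rho0 rho1 rhoH]] := exists_increment_scale H0 H1.
exists (wz_const T H p L K) => W sheet m n m0 n0 u ut mu mut.
exact: (sup_error_le_rate T0 H0 H1 p2 L0 Lb K0 gK sheet m0 n0 mu mut mrho rho0 rho1 rhoH).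
Qed.

Theorem theorem3p2 (R : realType) (d : measure_display)
    (Omega : measurableType d) (P : probability Omega R)
    (T H p : R) (b : R -> R) (F : R -> set (set Omega))
    (u0 : Omega -> R -> R) (v0 : Omega -> nat -> R)
    (T_gt0 : 0 < T) (H_gt0 : 0 < H) (H_le : H <= 2^-1) (p_ge2 : 2 <= p)
    (b_lip : lipschitz b) (F_filt : filtration T F)
    (u0_Lp : Lp_L2 P p u0) :
  (exists C : R,
     forall W : R -> R -> Omega -> R, fractional_sheet P T H W ->
     forall m n : nat, (0 < m)%N -> (0 < n)%N ->
     forall u ut : R -> R -> Omega -> R,
       mild_solution P T SHE b (SHE_coef u0) (conv_rough P T W) u ->
       mild_solution P T SHE b (SHE_coef u0) (conv_wz T m n W) ut ->
       let k := T / m%:R in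
       let h := n%:R^-1 in
       (sup_error P T p u ut
          <= (C * (h `^ H + k `^ (4^-1) * h `^ (H - 2^-1)))%:E)%E) /\
  (Lp_dotH P p (-1) v0 ->
   exists C : R,
     forall W : R -> R -> Omega -> R, fractional_sheet P T H W ->
     forall m n : nat, (0 < m)%N -> (0 < n)%N ->
     forall u ut : R -> R -> Omega -> R,
       mild_solution P T SWE b (SWE_coef u0 v0) (conv_rough P T W) u ->
       mild_solution P T SWE b (SWE_coef u0 v0) (conv_wz T m n W) ut ->
       let k := T / m%:R in
       let h := n%:R^-1 in
       (sup_error P T p u ut
          <= (C * (h `^ H + k `^ (2^-1) * h `^ (H - 2^-1)))%:E)%E).
Proof.
split=> [|_].
  have [C HC] := wong_zakai_rate P SHE (SHE_coef u0) T_gt0 H_gt0 H_le p_ge2 b_lip.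
  exists C => W sheet m n m0 n0 u ut mu mut.
  have := HC W sheet m n m0 n0 u ut mu mut.
  have -> : time_rate SHE (T / m%:R) `^ 2^-1 = (T / m%:R) `^ 4^-1.
    by rewrite /time_rate -powRrM -invfM -natrM.
  exact.
have [C HC] := wong_zakai_rate P SWE (SWE_coef u0 v0) T_gt0 H_gt0 H_le p_ge2 b_lip.
by exists C => W sheet m n m0 n0 u ut mu mut; exact: (HC W sheet m n m0 n0 u ut mu mut).
Qed.
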